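(* Let $\mu=\mu_\beta$ be a central state of a model in the class described in the context. There exist functions $\epsilon_1(\beta)=\epsilon_1(\beta,u,U,d)\downarrow0$ as $\beta\uparrow\infty$ and $\epsilon_2(p)=\epsilon_2(p,u,U,d)\downarrow0$ as $p\downarrow0$, and there exists an increasing sequence of positive integers $\mathrm r=(r_i)_{i\ge1}$ (a sparse enough spacing), such that, with $\Lambda_n=\Lambda_n^{\mathrm r}$ as in the context, for $\mu$-a.e. $\omega$ and $\pi(\cdot\mid\omega)$-a.e. $\sigma$, $$\underline\phi^\omega(\sigma)=\liminf_{n\to\infty}\frac1{|\Lambda_n|}\sum_{v\in\Lambda_n}\mathbf 1_{\sigma_v=\omega_v}\ \ge\ 1-\epsilon_1(\beta)-\epsilon_2(p_1(\mu)).$$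
   Context: Let $d\ge 2$, $\mathcal T^d=(V,E)$ the Cayley tree in which every vertex has $d+1$ neighbours, $q\ge2$, $\Omega=\mathbb Z_q^V$ with coordinates $\sigma_v$. Model: formal Hamiltonian $H(\omega)=\sum_{\{v,w\}\in E}u_{\omega_v,\omega_w}+\sum_v\Psi(\omega_v)$, $(u_{i,j})$ symmetric, $u_{i,i}=0$, $0<u:=\min_{i\neq j}u_{i,j}\le\max u_{i,j}=:U$, $\|\Psi\|_\infty\le u(d-1)/8$, inverse temperature $\beta$. Gibbs specification $\gamma_\Lambda(\omega_\Lambda\mid\omega_{\Lambda^c})=(Z^\omega_\Lambda)^{-1}\prod_{\{v,w\}\cap\Lambda\neq\emptyset}Q(\omega_v,\omega_w)$, $Q(i,j)=e^{-\beta(u_{i,j}+(\Psi(i)+\Psi(j))/(d+1))}$. Central state: let $Q_0(i,j)=g(i-j)$, $g$ even strictly positive, $\sum_jg(j)=1$, no eigenvalue of $Q_0$ equal to $1/d$; for $Q$ near $Q_0$ there is a $C^1$ solution $\bar x(Q)>0$ of $x(i)=\sum_jQ(i,j)x(j)^d$ with $\bar x(Q_0)\equiv1$. If the model's transfer matrix is a positive multiple of such $Q$, the central state is the Gibbs measure which is the homogeneous tree-indexed Markov chain with marginal $\propto\bar x^{d+1}$ and transition matrix $P(i,j)=Q(i,j)\bar x(j)^d/\sum_kQ(i,k)\bar x(k)^d$ (for each oriented edge $(v,w)$, given the spins at vertices closer to $v$ than to $w$, $\sigma_w\sim P(\sigma_v,\cdot)$). $p_1(\mu)=\max_i\sum_{j\neq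 i}P(i,j)$. $\pi(\cdot\mid\omega)=\lim_{\Lambda\uparrow V}\gamma_\Lambda(\cdot\mid\omega)$ if it exists for all cylinder events, a fixed arbitrary probability measure otherwise. Thinned volumes: given an increasing sequence $\mathrm r=(r_i)$ of positive integers, choose vertices $v_1,v_2,\dots$ along one branch (a self-avoiding infinite path) of the tree with $|v_{i+1}-v_i|=r_i$ (graph distance), and set $\Lambda_n^{\mathrm r}=\{v_1,\dots,v_{n^2}\}$, so $|\Lambda_n|=n^2$. *)

(* Defs.v *)
From HB Require Import structures.
From mathcomp Require Import all_boot all_order all_algebra.
From mathcomp Require Import all_classical all_reals all_analysis.

Set Implicit Arguments.
Unset Strict Implicit.
Unset Printing Implicit Defensive.

Import Order.TTheory GRing.Theory Num.Theory.
Import numFieldNormedType.Exports.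
Local Open Scope classical_set_scope.
Local Open Scope ring_scope.

(* The Cayley tree T^d: vertices are the reduced words over the alphabet     *)
(* 'I_(d+1) (no two consecutive equal letters), i.e. the Cayley graph of the *)
(* free product of d+1 copies of Z_2.  Every vertex has d+1 neighbours: the  *)
(* word with its last letter removed, and the words obtained by appending a  *)
(* letter different from the last one.                                       *)

Definition reduced (d : nat) (s : seq 'I_d.+1) : bool :=
  sorted (fun a b => a != b) s.

Definition V (d : nat) := {s : seq 'I_d.+1 | reduced s}.

Definition root (d : nat) : V d := exist _ [::] isT.

(* parent of a non-root vertex (the root is its own "parent") *)
Definition parent (d : nat) (v : V d) : V d :=
  insubd (root d) (take (size (val v)).-1 (val v)).

Definition children (d : nat) (v : V d) : seq (V d) :=
  pmap insub [seq rcons (val v) a | a <- enum 'I_d.+1].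

Definition adj (d : nat) (v w : V d) : bool :=
  ((val v != [::]) && (parent v == w)) || ((val w != [::]) && (parent w == v)).

Fixpoint lcp (T : eqType) (s t : seq T) : nat :=
  match s, t with
  | a :: s', b :: t' => if a == b then (lcp s' t').+1 else 0
  | _, _ => 0
  end.

Definition dist (d : nat) (v w : V d) : nat :=
  size (val v) + size (val w) - 2 * lcp (val v) (val w).

(* Configuration space Omega = Z_q^V with the product sigma-algebra          *)
(* (generated by the single-site events {sigma_v = i}).                      *)
(* Spins are 'Z_q (for q >= 2 this is Z/qZ).                                 *)

(* 'I_n.+1 (hence 'Z_q) is pointed, as required for g_sigma_algebraType *)
HB.instance Definition _ (n : nat) := isPointed.Build 'I_n.+1 ord0.

Definition single_site_events (d q : nat) : set (set (V d -> 'Z_q)) :=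
  [set A | exists (v : V d) (i : 'Z_q), A = [set s | s v = i]].

Notation Omega d q := (g_sigma_algebraType (@single_site_events d q)).

Definition cylb (d q : nat) (Delta : seq (V d)) (xi : V d -> 'Z_q)
  (s : V d -> 'Z_q) : bool := all (fun x => s x == xi x) Delta.

Definition cyl (d q : nat) (Delta : seq (V d)) (xi : V d -> 'Z_q) :
  set (Omega d q) := [set s | cylb Delta xi s].

Definition transfer (R : realType) (d q : nat) (u : 'Z_q -> 'Z_q -> R)
  (Psi : 'Z_q -> R) (beta : R) (i j : 'Z_q) : R :=
  expR (- (beta * (u i j + (Psi i + Psi j) / (d.+1)%:R))).

Definition patch (d q : nat) (Lambda : seq (V d))
  (eta : (size Lambda).-tuple 'Z_q) (omega : V d -> 'Z_q) : V d -> 'Z_q :=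
  fun x => if x \in Lambda then nth (omega x) eta (index x Lambda) else omega x.

(* prod over the edges {v,w} meeting Lambda of Qm(s_v, s_w).  Each edge is   *)
(* {parent w, w} for a unique non-root w; it meets Lambda iff w is in Lambda *)
(* or (w is not in Lambda and) parent w is in Lambda, i.e. w is a child of a *)
(* vertex of Lambda.                                                         *)
Definition edge_weight (R : realType) (d q : nat) (Qm : 'Z_q -> 'Z_q -> R)
  (Lambda : seq (V d)) (s : V d -> 'Z_q) : R :=
  (\prod_(w <- undup Lambda | w != root d) Qm (s (parent w)) (s w)) *
  (\prod_(v <- undup Lambda)
     \prod_(c <- children v | c \notin Lambda) Qm (s v) (s c)).

Definition gamma (R : realType) (d q : nat) (Qm : 'Z_q -> 'Z_q -> R)
  (Lambda : seq (V d)) (Delta : seq (V d)) (xi : V d -> 'Z_q)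
  (omega : V d -> 'Z_q) : R :=
  (\sum_(eta : (size Lambda).-tuple 'Z_q)
      edge_weight Qm Lambda (patch eta omega)
      * (cylb Delta xi (patch eta omega))%:R)
  / (\sum_(eta : (size Lambda).-tuple 'Z_q)
      edge_weight Qm Lambda (patch eta omega)).

Definition net_lim (R : realType) (d : nat) (f : seq (V d) -> R) (L : R) :=
  forall e : R, 0 < e -> exists Lambda0 : seq (V d),
    forall Lambda : seq (V d), {subset Lambda0 <= Lambda} ->
      `|f Lambda - L| < e.

Definition is_limit_kernel (R : realType) (d q : nat)
  (Qm : 'Z_q -> 'Z_q -> R) (pi : Omega d q -> probability (Omega d q) R)
  (pi0 : probability (Omega d q) R) : Prop :=
  forall omega : Omega d q,
    ((forall Delta xi, exists L, net_lim (fun Lambda => gamma Qm Lambda Delta xi omega) L) ->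
       forall Delta xi L, net_lim (fun Lambda => gamma Qm Lambda Delta xi omega) L ->
         pi omega (cyl Delta xi) = L%:E) /\
    (~ (forall Delta xi, exists L, net_lim (fun Lambda => gamma Qm Lambda Delta xi omega) L) ->
       forall A, pi omega A = pi0 A).

Definition transP (R : realType) (d q : nat) (x : 'rV[R]_((Zp_trunc q).+2))
  (Q : 'M[R]_((Zp_trunc q).+2)) (i j : 'Z_q) : R :=
  Q i j * x ord0 j ^+ d / \sum_(k : 'Z_q) Q i k * x ord0 k ^+ d.

Definition marg (R : realType) (d q : nat) (x : 'rV[R]_((Zp_trunc q).+2))
  (i : 'Z_q) : R :=
  x ord0 i ^+ d.+1 / \sum_(k : 'Z_q) x ord0 k ^+ d.+1.

Definition tree_markov_chain (R : realType) (d q : nat)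
  (mu : probability (Omega d q) R) (nu : 'Z_q -> R) (P : 'Z_q -> 'Z_q -> R) :
  Prop :=
  (forall (v : V d) (i : 'Z_q), mu [set s : Omega d q | s v = i] = (nu i)%:E) /\
  (forall v w : V d, adj v w ->
     forall Delta : seq (V d), (forall x, x \in Delta -> (dist x v < dist x w)%N) ->
     forall (xi : V d -> 'Z_q) (i j : 'Z_q),
       mu (cyl Delta xi `&` [set s | s v = i] `&` [set s | s w = j])
       = ((P i j)%:E * mu (cyl Delta xi `&` [set s | s v = i]))%E).

Definition p1 (R : realType) (q : nat) (P : 'Z_q -> 'Z_q -> R) : R :=
  \big[Num.max/0]_(i : 'Z_q) \sum_(j : 'Z_q | j != i) P i j.

(* C^1 on an open set N : differentiable on N with continuous derivative     *)
(* (continuity of Q |-> 'd f Q H for every direction H, which in finite      *)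
(* dimension is continuity of the derivative).                               *)
Definition C1_on (R : realType) (m n : nat) (N : set 'M[R]_m)
  (f : 'M[R]_m -> 'rV[R]_n) : Prop :=
  (forall Q, N Q -> differentiable f Q) /\
  (forall H : 'M[R]_m, {within N, continuous (fun Q => 'd f Q H)}).

(* Main.v *)
(* Call an edge broken if its two endpoints carry different spins.  Under mu,
   the probability that all edges of a set F are broken is at most p^|F| with
   p = p_1(mu), so the mean of a polynomial in the broken-edge indicators which
   is multilinear with nonnegative coefficients is at most its value at p.

   Overlap: let sigma be omega resampled in a finite volume; the pair is
   exchangeable.  Every edge on the boundary of a disagreement cluster is broken
   in omega or in sigma, and on a tree with d >= 2 a cluster of n vertices has at
   least (d-1)n boundary edges.  Hence 2^(number of mismatches along N sites of
   a branch) is at most the average of the values at omega and at sigma of one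
   such polynomial, and its mean is at most (1 + C p^(1/2))^N.  Fatou's lemma
   carries this bound to pi, and summing over N bounds the density of mismatches
   by 4 C p^(1/2).

   Existence of the limit of gamma_Lambda: if p is small then beta is large.
   Normalised by their value at the spin of omega, the messages of the recursion
   from the boundary of Lambda to the root, and their dependence on Lambda, are
   bounded by powers of polynomials as above, with geometrically small means.

   Thus eps1 = 0 and eps2(p) = K p^(1/2) do, where K makes the bound trivial
   unless p is small; the spacing of the sites plays no role. *)

Require Import Defs.
From HB Require Import structures.
From mathcomp Require Import all_boot all_order all_algebra.
From mathcomp Require Import all_classical all_reals all_analysis.
From mathcomp Require Import measurable_realfun ring lra zify.

Import Order.TTheory GRing.Theory Num.Theory.
Import numFieldNormedType.Exports.
Local Open Scope classical_set_scope.
Local Open Scope ring_scope.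

Set Implicit Arguments.
Unset Strict Implicit.
Unset Printing Implicit Defensive.

(** * The tree and summation over finitely many spins *)

(** The functions eps1 and eps2 are fixed before q, so no estimate may depend on the number of
    spins. This has two effects. Sums over spins are replaced by maxima weighted by stochastic rows.
    And p_1 may lie far above every single off-diagonal entry of P, so beta is not controlled from
    above by p: a broken edge can multiply a message by exp(C beta), and its mean cost p exp(C beta)
    need not be small. The remedy is a fractional power 1/g with g proportional to beta: small
    entries and large costs then become constants free of beta, and the cost times p is small with
    p.

    The polynomials stand in for independence. Broken edges are correlated, but given any spin of
    the parent an edge is broken with probability at most p. Bounds multiply as long as no edge
    occurs twice, so everything is built along disjoint subtrees, the two configurations are
    separated by an arithmetic-geometric inequality, and products of two messages are bounded by the
    first power of a polynomial.

    Convergence of [gamma] has to be proved because the kernel is an arbitrary measure wherever it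
    fails. *)

Lemma lcp_rcons (T : eqType) (s t : seq T) (a : T) :
  ~~ prefix (rcons t a) s -> lcp s (rcons t a) = lcp s t.
Proof.
elim: t s => [|b t IH] [|e s] //=; first by rewrite prefix0s andbT eq_sym => /negPf ->.
by rewrite eq_sym; case: eqVneq => //= _ H; rewrite IH.
Qed.

Lemma lcp_sizel (T : eqType) (s t : seq T) : (lcp s t <= size s)%N.
Proof. by elim: s t => [|a s IH] [|b t] //=; case: ifP => // _; rewrite ltnS. Qed.

Lemma lcp_sizer (T : eqType) (s t : seq T) : (lcp s t <= size t)%N.
Proof. by elim: s t => [|a s IH] [|b t] //=; case: ifP => // _; rewrite ltnS. Qed.

Section Tree.
Variable d : nat.
Implicit Types v w c x : V d.
Local Notation root := (Defs.root d).

Lemma childrenE v c :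
  c \in children v <-> exists a, val c = rcons (val v) a.
Proof.
rewrite /children mem_pmap_sub; split.
  by case/mapP => a _ ->; exists a.
by case=> a ->; apply/mapP; exists a; rewrite ?mem_enum.
Qed.

Lemma val_parent v : val (parent v) = take (size (val v)).-1 (val v).
Proof. by rewrite /parent insubdK //; apply: take_sorted; exact: valP. Qed.

Lemma childrenP v c : reflect (c != root /\ parent c = v) (c \in children v).
Proof.
apply: (iffP idP).
  move=> /childrenE[a ca]; split.
    by apply: contra_eqN ca => /eqP ->; case: (val v).
  apply: val_inj; rewrite val_parent ca size_rcons /= -cats1 take_size_cat //.
move=> [cr <-]; apply/childrenE; rewrite val_parent.
move: cr; rewrite -(inj_eq val_inj) /=; case: (lastP (val c)) => [//|s a _].
by exists a; rewrite size_rcons /= -[in take _ _]cats1 take_size_cat.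
Qed.

Lemma mem_children_parent c : c != root -> c \in children (parent c).
Proof. by move=> cr; apply/childrenP. Qed.

Lemma size_child v c : c \in children v -> size (val c) = (size (val v)).+1.
Proof. by move=> /childrenE[a ->]; rewrite size_rcons. Qed.

Lemma children_uniq v : uniq (children v).
Proof.
rewrite /children pmap_sub_uniq // map_inj_uniq ?enum_uniq //.
by move=> a b; apply: rcons_injr.
Qed.

Lemma size_children v :
  size (children v) = if v == root then d.+1 else d.
Proof.
rewrite /children size_pmap_sub count_map.
case: eqVneq => [->|vr].
  rewrite (eq_count (a2 := predT)) ?count_predT ?size_enum_ord //.
case E: (val v) => [|b s]; first by case/eqP: vr; apply: val_inj.
have rv : reduced (b :: s) by rewrite -E; apply: valP.
rewrite (eq_count (a2 := predC (pred1 (last b s)))); last first.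
  by move=> a /=; move: rv; rewrite /reduced /= rcons_path => -> /=; rewrite eq_sym.
have := count_predC (pred1 (last b s)) (enum 'I_d.+1).
rewrite count_uniq_mem ?enum_uniq // mem_enum /= size_enum_ord add1n.
by case.
Qed.

Lemma size_children_ge v : (d <= size (children v))%N.
Proof. by rewrite size_children; case: ifP. Qed.

Lemma size_children_le v : (size (children v) <= d.+1)%N.
Proof. by rewrite size_children; case: ifP. Qed.

Lemma adjE v w : adj v w = (w \in children v) || (v \in children w).
Proof.
have nilE x : (val x != [::]) = (x != root) by [].
rewrite /adj !nilE orbC.
by congr orb; apply/andP/childrenP => -[-> /eqP].
Qed.

Fixpoint lev (k : nat) : seq (V d) :=
  if k is j.+1 then flatten [seq children v | v <- lev j] else [:: root].

Fixpoint ball (k : nat) : seq (V d) :=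
  if k is j.+1 then ball j ++ lev k else [:: root].

Lemma mem_lev k v : (v \in lev k) = (size (val v) == k).
Proof.
elim: k v => [|k IH] v /=.
  by rewrite inE size_eq0.
apply/flatten_mapP/eqP.
  by case=> u; rewrite IH => /eqP <- /size_child ->.
move=> sv; have vr : v != root by apply: contra_eqN sv => /eqP ->.
exists (parent v); last exact: mem_children_parent.
by rewrite IH val_parent size_take sv /= ltnSn.
Qed.

Lemma flatten_children_uniq (s : seq (V d)) :
  uniq s -> uniq (flatten [seq children v | v <- s]).
Proof.
elim: s => //= v s IH /andP[vs us].
rewrite cat_uniq children_uniq IH // andbT; apply/hasPn => c.
case/flatten_mapP => w ws /childrenP[_ pc]; apply/childrenP => -[_ pc'].
by move: vs; rewrite -pc' pc ws.
Qed.

Lemma lev_uniq k : uniq (lev k).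
Proof. by elim: k => //= k; apply: flatten_children_uniq. Qed.

Lemma mem_ball k v : (v \in ball k) = (size (val v) <= k)%N.
Proof.
elim: k v => [|k IH] v; first by rewrite leqn0 inE size_eq0.
rewrite [ball _]/= mem_cat IH -[flatten _]/(lev k.+1) mem_lev.
by rewrite [in RHS]leq_eqVlt ltnS orbC.
Qed.

Lemma ball_uniq k : uniq (ball k).
Proof.
elim: k => // k IH; rewrite [ball _]/= cat_uniq IH -[flatten _]/(lev k.+1) lev_uniq andbT.
apply/hasPn => v; rewrite mem_lev => /eqP sv.
by rewrite mem_ball sv ltnn.
Qed.

Definition below v w := prefix (val v) (val w).

Lemma below_refl v : below v v. Proof. exact: prefix_refl. Qed.

Lemma below_trans : transitive below.
Proof. by move=> v u w; apply: prefix_trans. Qed.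

Lemma below_child v c : c \in children v -> below v c.
Proof. by move=> /childrenE[a ca]; rewrite /below ca prefix_rcons. Qed.

Lemma below_size v w : below v w -> (size (val v) <= size (val w))%N.
Proof. exact: size_prefix. Qed.

Lemma below_uniq v c c' w :
  c \in children v -> c' \in children v -> below c w -> below c' w -> c = c'.
Proof.
move=> cv c'v; rewrite /below !prefixE => /eqP cw /eqP c'w; apply: val_inj.
by rewrite /= -cw -c'w (size_child cv) (size_child c'v).
Qed.

Lemma child_notbelow v c : c \in children v -> ~~ below c v.
Proof.
by move=> cv; apply/negP => /below_size; rewrite (size_child cv) ltnn.
Qed.

Lemma dist_child_lt v c x :
  c \in children v -> ~~ below c x -> (dist x v < dist x c)%N.
Proof.
move=> /childrenE[a ca]; rewrite /below /dist ca => /lcp_rcons ->.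
rewrite size_rcons; have := lcp_sizel (val x) (val v); have := lcp_sizer (val x) (val v).
set l := lcp _ _; set m := size _; set n := size _ ; lia.
Qed.

(** After one step away from the root, a step towards it would return to the unique parent just
    left. Climbing alone stops at the root. *)
Lemma path_eventually_down (x : nat -> V d) :
  (forall n, adj (x n) (x n.+1)) -> injective x ->
  exists n0, forall n, (n0 <= n)%N -> x n.+1 \in children (x n).
Proof.
move=> adjx injx.
have step n : x n.+1 \in children (x n) -> x n.+2 \in children (x n.+1).
  move=> /childrenP[_ p1]; have := adjx n.+1; rewrite adjE => /orP[//|/childrenP[_ p2]].
  by have /injx := etrans (esym p2) p1; lia.
have [n0 hn0] : exists n, x n.+1 \in children (x n).
  apply: contrapT => /forallNP H.
  have dec n : (size (val (x n)) + n = size (val (x 0)))%N.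
    elim: n => [|n IH]; first by rewrite addn0.
    have := adjx n; rewrite adjE => /orP[/H //|/size_child sx].
    by rewrite -IH sx addnS addSn.
  by have := dec (size (val (x 0%N))).+1; set m := size (val (x 0%N)); lia.
exists n0 => n /subnK <-; elim: (n - n0)%N => [//|m IH].
exact: step.
Qed.

End Tree.

(** * Summing out sites one at a time *)

Section SumOut.
Variables (I : eqType) (A : finType) (R : comNzRingType).
Implicit Types (s : I -> A) (F G : (I -> A) -> R) (v w : I) (L : seq I).

Definition upd s v (i : A) : I -> A := fun x => if x == v then i else s x.

Lemma updE s v i : upd s v i v = i. Proof. by rewrite /upd eqxx. Qed.

Lemma updN s v i w : w != v -> upd s v i w = s w.
Proof. by rewrite /upd => /negPf ->. Qed.

Lemma upd_id s v : upd s v (s v) = s.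
Proof. by apply/funext => x; rewrite /upd; case: eqP => [->|]. Qed.

Lemma updC s v w i j : v != w -> upd (upd s v i) w j = upd (upd s w j) v i.
Proof.
move=> vw; apply/funext => x; rewrite /upd.
by case: (eqVneq x w) => [->|//]; rewrite eq_sym (negPf vw).
Qed.

Definition sum_at v F : (I -> A) -> R := fun s => \sum_i F (upd s v i).

(** The result is again a function of the configuration, so Fubini becomes invariance under
    permutations of the list; [sum_patch] recovers the sums over tuples in [gamma]. *)
Definition sum_out L F := foldl (fun G v => sum_at v G) F L.

Lemma sum_atC v w F : sum_at v (sum_at w F) = sum_at w (sum_at v F).
Proof.
case: (eqVneq v w) => [-> //|vw]; apply/funext => s; rewrite /sum_at.
rewrite exchange_big /=; apply: eq_bigr => i _; apply: eq_bigr => j _.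
by rewrite updC // eq_sym.
Qed.

Lemma sum_out_cat L L' F : sum_out (L ++ L') F = sum_out L' (sum_out L F).
Proof. by rewrite /sum_out foldl_cat. Qed.

Lemma sum_out_at L v F : sum_out L (sum_at v F) = sum_at v (sum_out L F).
Proof. by elim: L F => //= w L IH F; rewrite sum_atC IH. Qed.

Lemma sum_out_cons v L F : sum_out (v :: L) F = sum_at v (sum_out L F).
Proof. by rewrite -sum_out_at. Qed.

Lemma sum_outC L L' F : sum_out L (sum_out L' F) = sum_out L' (sum_out L F).
Proof. by elim: L' F => //= v L' IH F; rewrite IH sum_out_at. Qed.

Lemma sum_out_perm L L' F : perm_eq L L' -> sum_out L F = sum_out L' F.
Proof.
apply: (catCA_perm_subst (F := fun l => sum_out l F)) => l1 l2 l3.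
by rewrite !sum_out_cat (sum_outC l2 l1).
Qed.

Definition indep L F := forall s s', (forall x, x \notin L -> s x = s' x) -> F s = F s'.

Lemma indep_upd L F s v i : indep L F -> v \in L -> F (upd s v i) = F s.
Proof.
by move=> iF vL; apply: iF => x xL; rewrite updN //; apply: contraNneq xL => ->.
Qed.

Lemma sum_out_ext L F G s :
  (forall s', (forall x, x \notin L -> s' x = s x) -> F s' = G s') ->
  sum_out L F s = sum_out L G s.
Proof.
elim: L s => [|v L IH] s FG; first by apply: FG.
rewrite !sum_out_cons; apply: eq_bigr => i _; apply: IH => s' s's.
apply: FG => x; rewrite inE negb_or => /andP[xv xL].
by rewrite s's // updN.
Qed.

Lemma sum_outM L F G s :
  indep L G -> sum_out L (fun s => G s * F s) s = G s * sum_out L F s.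
Proof.
elim: L F s => [|v L IH] F s iG //.
have iL : indep L G.
  by move=> s1 s2 s12; apply: iG => x; rewrite inE negb_or => /andP[_ /s12].
rewrite !sum_out_cons /sum_at mulr_sumr; apply: eq_bigr => i _.
by rewrite IH // (@indep_upd (v :: L) G) ?mem_head.
Qed.

Lemma sum_outM_cst L F (a : R) s :
  sum_out L (fun s => a * F s) s = a * sum_out L F s.
Proof. exact: (@sum_outM L F (fun=> a)). Qed.

Lemma sum_outD L F G s :
  sum_out L (fun s => F s + G s) s = sum_out L F s + sum_out L G s.
Proof.
elim: L s => [|v L IH] s //; rewrite !sum_out_cons /sum_at -big_split /=.
by apply: eq_bigr => i _; rewrite IH.
Qed.

Lemma sum_out_sum L (J : Type) (r : seq J) (F : J -> (I -> A) -> R) s :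
  sum_out L (fun s => \sum_(j <- r) F j s) s = \sum_(j <- r) sum_out L (F j) s.
Proof.
elim: L s => [|v L IH] s //; rewrite !sum_out_cons /sum_at.
under eq_bigr do rewrite IH.
rewrite exchange_big /=; apply: eq_bigr => j _.
by rewrite sum_out_at.
Qed.

Lemma indep_sum_out L F : indep L (sum_out L F).
Proof.
elim: L F => [|v L IH] F s s' ss'; first by congr (F _); apply/funext => x; apply: ss'.
rewrite sum_out_cons; apply: eq_bigr => i _; apply: IH => x xL.
by rewrite /upd; case: eqVneq => // xv; apply: ss'; rewrite inE negb_or xv.
Qed.

Lemma sum_out_dup v L F : v \in L ->
  sum_out (v :: L) F = (fun s => #|A|%:R * sum_out L F s).
Proof.
move=> vL; apply/funext => s; rewrite sum_out_cons /sum_at.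
rewrite (eq_bigr (fun=> sum_out L F s)); last first.
  by move=> i _; apply: (@indep_upd L) => //; apply: indep_sum_out.
by rewrite sumr_const mulr_natl.
Qed.

(** A volume in [gamma] is any list; repetitions only produce powers of [#|A|], which cancel in
    quotients. *)
Lemma sum_out_undup L F :
  sum_out L F = (fun s => #|A|%:R ^+ (size L - size (undup L)) * sum_out (undup L) F s).
Proof.
elim: L => [|v L IH]; first by apply/funext => s; rewrite mul1r.
rewrite [undup _]/=; case: ifP => vL.
  apply/funext => s; rewrite sum_out_dup // IH /= subSn ?size_undup // exprS.
  by rewrite mulrA.
apply/funext => s; rewrite sum_out_cons IH [size (v :: L)]/= [size (v :: _)]/= subSS.
by rewrite sum_out_cons /sum_at mulr_sumr.
Qed.

(** Distributivity: within [L] the factor of a site sees only that site, so the sums move inside the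
    product. It is applied to one generation of the tree. *)
Lemma sum_out_prod L (r : seq I) (G : (I -> A) -> R) (h : I -> (I -> A) -> A -> R) s :
  uniq r -> {subset L <= r} -> uniq L ->
  (forall v, v \in r -> forall i, indep L (fun s => h v s i)) -> indep L G ->
  sum_out L (fun s => G s * \prod_(v <- r) h v s (s v)) s
  = G s * \prod_(v <- r) (if v \in L then \sum_i h v s i else h v s (s v)).
Proof.
move=> ur + + ih iG; rewrite sum_outM // => Lr uL; congr (_ * _).
have {G iG} ih' := ih.
elim: L s uL Lr ih' ih => [|w L IH] s.
  by move=> _ _ _ _; apply: eq_bigr.
rewrite [uniq _]/= => /andP[wL uL] wLr ihw _.
have iL v : v \in r -> forall i, indep L (fun s => h v s i).
  move=> vr i s1 s2 s12; apply: ihw => // x.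
  by rewrite inE negb_or => /andP[_ /s12].
rewrite sum_out_cons /sum_at.
have Lr : {subset L <= r} by move=> x xL; apply: wLr; rewrite inE xL orbT.
have wr : w \in r by apply: wLr; rewrite mem_head.
rewrite (eq_bigr (fun i => h w s i * \prod_(v <- rem w r)
   (if v \in w :: L then \sum_i h v s i else h v s (s v)))); last first.
  move=> i _; rewrite IH // (perm_big _ (perm_to_rem wr)) /= big_cons (negPf wL).
  rewrite updE (@indep_upd (w :: L) (fun s => h w s i)) ?mem_head //; last exact: ihw.
  congr (_ * _).
  rewrite big_seq [in RHS]big_seq; apply: eq_bigr => v; rewrite mem_rem_uniq // inE => /andP[vw vr].
  rewrite (negPf vw) /=; case: ifP => _.
    apply: eq_bigr => j _.
    by rewrite (@indep_upd (w :: L) (fun s => h v s j)) ?mem_head //; apply: ihw.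
  by rewrite updN // (@indep_upd (w :: L) (fun s' => h v s' (s v))) ?mem_head //; apply: ihw.
by rewrite -mulr_suml (perm_big _ (perm_to_rem wr)) /= big_cons mem_head.
Qed.

End SumOut.

Section SumOutOrder.
Variables (I : eqType) (A : finType) (R : numDomainType).
Implicit Types (s : I -> A) (F G : (I -> A) -> R) (L : seq I).

Lemma sum_out_le L F G s :
  (forall s', (forall x, x \notin L -> s' x = s x) -> F s' <= G s') ->
  sum_out L F s <= sum_out L G s.
Proof.
elim: L s => [|v L IH] s FG; first by apply: FG.
rewrite !sum_out_cons; apply: ler_sum => i _; apply: IH => s' s's.
apply: FG => x; rewrite inE negb_or => /andP[xv xL].
by rewrite s's // updN.
Qed.

Lemma sum_out0 L s : sum_out L (fun=> 0 : R) s = 0.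
Proof.
elim: L s => // v L IH s; by rewrite sum_out_cons /sum_at big1.
Qed.

Lemma sum_out_ge0 L F s : (forall s', 0 <= F s') -> 0 <= sum_out L F s.
Proof. by move=> F0; rewrite -(sum_out0 L s); apply: sum_out_le. Qed.

Lemma sum_out_ge L F s : (forall s', 0 <= F s') -> F s <= sum_out L F s.
Proof.
elim: L s => // v L IH s F0; rewrite sum_out_cons /sum_at (bigD1 (s v)) //=.
rewrite upd_id (le_trans (IH _ F0)) // lerDl sumr_ge0 // => i _.
exact: sum_out_ge0.
Qed.

End SumOutOrder.

Section SumOutPatch.
Variables (R : realType) (d q : nat).
Implicit Types (s : V d -> 'Z_q) (F : (V d -> 'Z_q) -> R).

Lemma sum_tuple_cons (A : finType) n (G : n.+1.-tuple A -> R) :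
  \sum_eta G eta = \sum_i \sum_(eta : n.-tuple A) G [tuple of i :: eta].
Proof.
rewrite pair_big /= (reindex (fun p : A * n.-tuple A => [tuple of p.1 :: p.2])) //=.
exists (fun t : n.+1.-tuple A => (thead t, [tuple of behead t])).
  by move=> [i t] _ /=; congr pair; apply: val_inj.
by move=> t _; rewrite -tuple_eta.
Qed.

Lemma sum_patch (L : seq (V d)) F s :
  \sum_(eta : (size L).-tuple 'Z_q) F (Defs.patch eta s) = sum_out L F s.
Proof.
elim: L F s => [|v L IH] F s.
  rewrite (eq_bigr (fun=> F s)) => [|eta _]; last by congr F; apply/funext.
  by rewrite sumr_const card_tuple expn0.
rewrite sum_tuple_cons -[sum_out _ F]/(sum_out L (sum_at v F)) -IH /sum_at.
rewrite exchange_big /=; apply: eq_bigr => eta _; apply: eq_bigr => i _; congr F.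
apply/funext => x; rewrite /Defs.patch /upd /= inE [v == x]eq_sym.
by case: eqP.
Qed.

End SumOutPatch.

Section Local.
Variables (R : realType) (d q : nat).
Implicit Types (s : V d -> 'Z_q) (L : seq (V d)).

Lemma measurable_site (v : V d) (i : 'Z_q) :
  measurable [set s : Omega d q | s v = i].
Proof. by apply: sub_sigma_algebra; exists v, i. Qed.

Lemma cyl_cons v L s :
  cyl (v :: L) s = [set s' : Omega d q | s' v = s v] `&` cyl L s.
Proof.
apply/seteqP; split => s' /=; rewrite /cyl /cylb /=.
  by move=> /andP[/eqP].
by move=> [-> ->]; rewrite eqxx.
Qed.

Lemma measurable_cyl L s : measurable (cyl L s : set (Omega d q)).
Proof.
elim: L => [|v L IH]; first by rewrite (_ : cyl _ _ = setT) //; apply/seteqP; split.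
by rewrite cyl_cons; apply: measurableI => //; exact: measurable_site.
Qed.

Lemma cylbP L s s' : reflect (forall x, x \in L -> s' x = s x) (cylb L s s').
Proof. by apply: (iffP allP) => H x xL; apply/eqP/H. Qed.

Lemma cylbC L s s' : cylb L s s' = cylb L s' s.
Proof. by apply: eq_all => x; rewrite eq_sym. Qed.

Definition local L (F : (V d -> 'Z_q) -> R) :=
  forall s s', (forall x, x \in L -> s x = s' x) -> F s = F s'.

Lemma local_sub L L' F : {subset L <= L'} -> local L F -> local L' F.
Proof. by move=> LL' lF s s' ss'; apply: lF => x /LL'; apply: ss'. Qed.

Lemma local_indep L L' F : local L F -> (forall x, x \in L -> x \notin L') -> indep L' F.
Proof. by move=> lF LL' s s' ss'; apply: lF => x /LL'; apply: ss'. Qed.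

Lemma sum_out_cylb L s s0 : uniq L ->
  sum_out L (fun s' => (cylb L s s')%:R : R) s0 = 1.
Proof.
move=> uL.
have -> : (fun s' => (cylb L s s')%:R : R)
    = (fun s' => 1 * \prod_(v <- L) (fun v (_ : V d -> 'Z_q) i => (i == s v)%:R) v s' (s' v)).
  apply/funext => s'; rewrite mul1r /cylb; elim: L {uL} => [|v L IH] /=.
    by rewrite big_nil.
  by rewrite big_cons -IH; case: eqP => _; rewrite ?mul1r ?mul0r.
rewrite (sum_out_prod (r := L) (G := fun=> 1) (h := fun v _ i => (i == s v)%:R)) // mul1r big_seq big1 // => v vL.
rewrite vL (bigD1 (s v)) //= eqxx big1 ?addr0 // => i /negPf ->//.
Qed.

(** Expansion in cylinder indicators: it yields measurability of local functions and reduces their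
    integrals to the masses of cylinders. *)
Lemma localE L F s s0 : uniq L -> local L F ->
  F s = \sum_(eta : (size L).-tuple 'Z_q)
     F (Defs.patch eta s0) * (cylb L (Defs.patch eta s0) s)%:R.
Proof.
move=> uL lF; rewrite (sum_patch L (fun s' => F s' * (cylb L s' s)%:R) s0).
rewrite (@sum_out_ext _ _ _ L _ (fun s' => F s * (cylb L s s')%:R)).
  by rewrite sum_outM // sum_out_cylb // mulr1.
move=> s' _; rewrite cylbC; case: (cylbP L s s') => [ss'|_]; last by rewrite !mulr0.
by rewrite (lF _ _ ss').
Qed.

Lemma measurable_local L (F : Omega d q -> R) : uniq L -> local L F ->
  measurable_fun setT F.
Proof.
move=> uL lF.
have -> : F = (fun s : Omega d q => \sum_(eta : (size L).-tuple 'Z_q)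
     F (Defs.patch eta (fun=> 0)) * \1_(cyl L (Defs.patch eta (fun=> 0))) s).
  apply/funext => s; rewrite (localE s (fun=> 0) uL lF).
  apply: eq_bigr => eta _; rewrite indicE; congr (_ * _%:R).
  by congr nat_of_bool; apply/idP/idP => [H|/set_mem//]; apply/mem_set.
apply: measurable_sum => eta; apply: measurable_funM => //.
by apply: measurable_indic; apply: measurable_cyl.
Qed.

Lemma integral_local (mu : probability (Omega d q) R) L F s0 :
  uniq L -> local L F -> (forall s, 0 <= F s) ->
  (\int[mu]_s (F s)%:E =
   (sum_out L (fun s => F s * fine (mu (cyl L s))) s0)%:E)%E.
Proof.
move=> uL lF F0.
rewrite -(sum_patch L (fun s => F s * fine (mu (cyl L s)))) -sumEFin.
under eq_integral do rewrite (localE _ s0 uL lF) -sumEFin.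
rewrite ge0_integral_sum //=; first last.
- by move=> eta s _; rewrite lee_fin mulr_ge0.
- move=> eta; apply/measurable_EFinP; apply: measurable_funM => //.
  rewrite [X in measurable_fun _ X](_ : _ = \1_(cyl L (Defs.patch eta s0))).
    by apply: measurable_indic; apply: measurable_cyl.
  apply/funext => s; rewrite indicE; congr _%:R.
  by congr nat_of_bool; apply/idP/idP => [H|/set_mem//]; apply/mem_set.
apply: eq_bigr => eta _; rewrite EFinM fineK; last first.
  by apply: fin_num_measure; apply: measurable_cyl.
under eq_integral do rewrite EFinM.
rewrite ge0_integralZl //=.
- congr (_ * _)%E; rewrite -[in RHS](setIT (cyl _ _)) -integral_indic //; last exact: measurable_cyl.
  apply: eq_integral => s _; rewrite indicE; congr (_%:R)%:E.
  by congr nat_of_bool; apply/idP/idP => [H|/set_mem//]; apply/mem_set.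
- apply/measurable_EFinP.
  rewrite [X in measurable_fun _ X](_ : _ = \1_(cyl L (Defs.patch eta s0))).
    by apply: measurable_indic; apply: measurable_cyl.
  apply/funext => s; rewrite indicE; congr _%:R.
  by congr nat_of_bool; apply/idP/idP => [H|/set_mem//]; apply/mem_set.
- by rewrite lee_fin.
Qed.

End Local.

(** * Finite-dimensional laws of tree-indexed chains *)

Section TreeWeight.
Variables (R : realType) (d q : nat).
Implicit Types (s : V d -> 'Z_q) (L : seq (V d)).
Local Notation root := (Defs.root d).
Variables (nu : 'Z_q -> R) (g : V d -> 'Z_q -> 'Z_q -> R).

(** The kernel may vary with the edge above [c]. Constant equal to P, it gives the law of the chain
    ([chain_fdd]); otherwise it can absorb indicators attached to edges. *)
Fixpoint tree_weight (K : nat) s : R :=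
  if K is k.+1 then
    tree_weight k s * \prod_(c <- lev d k.+1) g c (s (parent c)) (s c)
  else nu (s root).

Lemma parent_lev k c : c \in lev d k.+1 -> parent c \in lev d k.
Proof. by rewrite !mem_lev val_parent size_take => /eqP -> /=; rewrite ltnSn. Qed.

Lemma lev_neq_root k c : c \in lev d k.+1 -> c != root.
Proof. by rewrite mem_lev; apply: contraTneq => ->. Qed.

Lemma lev_ball k : {subset lev d k <= ball d k}.
Proof. by move=> v; rewrite mem_lev mem_ball => /eqP ->. Qed.

Lemma ball_subset k m : (k <= m)%N -> {subset ball d k <= ball d m}.
Proof. by move=> km v; rewrite !mem_ball => /leq_trans; apply. Qed.

Lemma ballS_notin k x : x \in ball d k -> x \notin lev d k.+1.
Proof. by rewrite mem_ball mem_lev => h; rewrite ltn_eqF // ltnS. Qed.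

Lemma local_tree_weight K : local (ball d K) (tree_weight K).
Proof.
elim: K => [|k IH] s s' ss' /=; first by rewrite ss' ?mem_head.
congr (_ * _).
  by apply: IH => x xk; apply: ss'; apply: ball_subset xk.
rewrite big_seq [in RHS]big_seq; apply: eq_bigr => c ck.
rewrite !ss' //; first exact: lev_ball.
by apply: (@ball_subset k) => //; apply/lev_ball/parent_lev.
Qed.

(** Given the previous generation, each site sees only its parent. [L] may be part of a generation,
    since a volume may contain only some of its sites. *)
Lemma sum_out_lev k L F s : uniq L -> {subset L <= lev d k.+1} -> indep L F ->
  sum_out L (fun s => F s * \prod_(c <- lev d k.+1) g c (s (parent c)) (s c)) s
  = F s * \prod_(c <- lev d k.+1)
      (if c \in L then \sum_j g c (s (parent c)) j else g c (s (parent c)) (s c)).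
Proof.
move=> uL Lk iF.
rewrite (sum_out_prod (r := lev d k.+1) (h := fun c s j => g c (s (parent c)) j)) //.
  exact: lev_uniq.
move=> c ck j s1 s2 s12; rewrite s12 //; apply/negP => /Lk.
by apply/negP/ballS_notin/lev_ball/parent_lev.
Qed.

Lemma sum_out_tree_weight (b : V d -> R) K s :
  (forall i, 0 <= nu i) -> \sum_i nu i = 1 ->
  (forall c i j, 0 <= g c i j) -> (forall c i, \sum_j g c i j <= b c) ->
  sum_out (ball d K) (tree_weight K) s <= \prod_(c <- ball d K | c != root) b c.
Proof.
move=> nu0 nu1 g0 gb.
have b0 c : 0 <= b c by apply: le_trans (gb c 0); apply: sumr_ge0.
have tw0 k s' : 0 <= tree_weight k s'.
  by elim: k => //= k IH; rewrite mulr_ge0 // prodr_ge0.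
elim: K => [|k IH].
  rewrite big_cons big_nil eqxx /= /sum_at -nu1; apply: ler_sum => i _.
  by rewrite updE.
rewrite -[ball d k.+1]/(ball d k ++ lev d k.+1) sum_out_cat sum_outC big_cat /=.
have -> : \prod_(c <- lev d k.+1 | c != root) b c = \prod_(c <- lev d k.+1) b c.
  rewrite big_seq_cond [in RHS]big_seq; apply: eq_bigl => c.
  by case: (boolP (c \in _)) => //= /lev_neq_root.
apply: (@le_trans _ _ (sum_out (ball d k)
    (fun s => \prod_(c <- lev d k.+1) b c * tree_weight k s) s)); last first.
  by rewrite sum_outM // mulrC ler_wpM2r // prodr_ge0.
apply: sum_out_le => s' _.
rewrite (@sum_out_lev k (lev d k.+1) (tree_weight k)) ?lev_uniq //; last first.
  exact: local_indep (@local_tree_weight k) (@ballS_notin k).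
rewrite mulrC ler_wpM2r // big_seq [leRHS]big_seq; apply: ler_prod => c ck.
by rewrite ck gb andbT sumr_ge0.
Qed.

End TreeWeight.

Section Chain.
Variables (R : realType) (d q : nat).
Implicit Types (s : V d -> 'Z_q) (L : seq (V d)).
Local Notation root := (Defs.root d).
Variables (nu : 'Z_q -> R) (P : 'Z_q -> 'Z_q -> R) (mu : probability (Omega d q) R).
Hypothesis mc : tree_markov_chain mu nu P.

Lemma cyl_cat L L' s : cyl (L ++ L') s = cyl L s `&` cyl L' s :> set (Omega d q).
Proof.
apply/seteqP; split => s'; rewrite /cyl /cylb /= all_cat; first by move/andP.
by move=> [-> ->].
Qed.

(** The sites of a generation are added one by one. The Markov property applies because no site
    already present lies below the new one, hence all are closer to its parent. *)
Lemma chain_fdd K s : mu (cyl (ball d K) s) = (tree_weight nu (fun=> P) K s)%:E.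
Proof.
have [mc1 mc2] := mc.
elim: K => [|k IH].
  rewrite cyl_cons (_ : cyl [::] s = setT); last by apply/seteqP; split.
  by rewrite setIT mc1.
rewrite -[ball d k.+1]/(ball d k ++ lev d k.+1).
rewrite [tree_weight _ _ _ _](_ : _ = tree_weight nu (fun=> P) k s *
  \prod_(c <- lev d k.+1) P (s (parent c)) (s c)) //.
have : uniq (lev d k.+1) by exact: lev_uniq.
have : {subset lev d k.+1 <= lev d k.+1} by [].
move: {1 3 4 5}(lev d k.+1) => cs.
elim/last_ind: cs => [_ _|cs c IHc csl]; first by rewrite cats0 IH big_nil mulr1.
rewrite rcons_uniq => /andP[ccs ucs].
have cl : c \in lev d k.+1 by apply: csl; rewrite mem_rcons mem_head.
have pk : parent c \in ball d k by apply/lev_ball/parent_lev.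
have cp : c \in children (parent c) by apply: mem_children_parent; apply: lev_neq_root cl.
rewrite -cats1 catA cyl_cat cyl_cons (_ : cyl [::] s = setT); last by apply/seteqP; split.
rewrite setIT.
have -> : cyl (ball d k ++ cs) s =
    cyl (ball d k ++ cs) s `&` [set s' : Omega d q | s' (parent c) = s (parent c)].
  apply/esym/setIidl => s' /cylbP; apply; by rewrite mem_cat pk.
rewrite mc2; first last.
- move=> x; rewrite mem_cat => xD; apply: dist_child_lt => //; apply/negP => cx.
  have := below_size cx; have := cl; rewrite mem_lev => /eqP ->.
  case/orP: xD => [|xcs]; first by rewrite mem_ball => h; rewrite ltnNge h.
  move: cx; rewrite /below prefixE.
  have := csl x; rewrite mem_rcons inE xcs orbT => /(_ isT).
  rewrite mem_lev => /eqP sx; move: cl; rewrite mem_lev => /eqP ->; rewrite -sx take_size.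
  by move=> /eqP/val_inj xc; move: ccs; rewrite -xc xcs.
- by rewrite adjE cp.
have -> : cyl (ball d k ++ cs) s `&` [set s' : Omega d q | s' (parent c) = s (parent c)]
   = cyl (ball d k ++ cs) s.
  apply/setIidl => s' /cylbP; apply; by rewrite mem_cat pk.
rewrite IHc //; last by move=> x xcs; apply: csl; rewrite mem_rcons inE xcs orbT.
by rewrite big_cat big_seq1 /= -EFinM mulrC -mulrA.
Qed.

Lemma integral_chain K F s0 : local (ball d K) F -> (forall s, 0 <= F s) ->
  (\int[mu]_s (F s)%:E =
   (sum_out (ball d K) (fun s => tree_weight nu (fun=> P) K s * F s) s0)%:E)%E.
Proof.
move=> lF F0; rewrite (integral_local mu s0 (ball_uniq d K) lF F0); congr EFin.
by apply: sum_out_ext => s _; rewrite chain_fdd mulrC.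
Qed.

End Chain.

(** * Polynomials in the broken edges *)

Section Dominated.
Variables (R : realType) (d q : nat) (p : R).
Hypothesis p0 : 0 <= p.
Implicit Types (s : V d -> 'Z_q) (D : pred (V d)) (h : (V d -> 'Z_q) -> R).
Local Notation root := (Defs.root d).

(** An edge is named after its endpoint farther from the root; at the root the value is 0. *)
Definition broken (w : V d) s : R := (s (parent w) != s w)%:R.

Definition monomial (F : seq (V d)) s : R := \prod_(w <- F) broken w s.

(* [h] is a polynomial with nonnegative coefficients, squarefree in the
   variables [broken w] with [D w], whose value at [broken := p] is at most y. *)
Definition dom D h (y : R) := exists l : seq (R * seq (V d)),
  [/\ forall s, h s = \sum_(m <- l) m.1 * monomial m.2 s,
      forall m, m \in l -> [/\ 0 <= m.1, uniq m.2 & all D m.2]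
    & \sum_(m <- l) m.1 * p ^+ size m.2 <= y].

Lemma monomial_ge0 F s : 0 <= monomial F s.
Proof. by apply: prodr_ge0 => w _; rewrite ler0n. Qed.

Lemma dom_ge0 D h y : dom D h y -> 0 <= y.
Proof.
case=> l [_ lD]; apply: le_trans; rewrite big_seq; apply: sumr_ge0 => m /lD[m0 _ _].
by rewrite mulr_ge0 // exprn_ge0.
Qed.

Lemma dom_fun_ge0 D h y s : dom D h y -> 0 <= h s.
Proof.
case=> l [-> lD _]; rewrite big_seq; apply: sumr_ge0 => m /lD[m0 _ _].
by rewrite mulr_ge0 // monomial_ge0.
Qed.

Lemma dom_weak D D' h y y' :
  dom D h y -> (forall v, D v -> D' v) -> y <= y' -> dom D' h y'.
Proof.
case=> l [hl lD ly] DD' yy'; exists l; split => //; last exact: le_trans yy'.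
by move=> m /lD[? ? mD]; split=> //; apply: sub_all mD.
Qed.

Lemma dom_const D (c : R) : 0 <= c -> dom D (fun=> c) c.
Proof.
move=> c0; exists [:: (c, [::])]; split.
- by move=> s; rewrite big_seq1 /monomial big_nil mulr1.
- by move=> m; rewrite inE => /eqP ->.
- by rewrite big_seq1 expr0 mulr1.
Qed.

Lemma dom_broken D w : D w -> dom D (broken w) p.
Proof.
move=> Dw; exists [:: (1, [:: w])]; split.
- by move=> s; rewrite big_seq1 /monomial big_seq1 mul1r.
- by move=> m; rewrite inE => /eqP -> /=; rewrite Dw ler01.
- by rewrite big_seq1 expr1 mul1r.
Qed.

Lemma dom_add D h1 h2 y1 y2 : dom D h1 y1 -> dom D h2 y2 ->
  dom D (fun s => h1 s + h2 s) (y1 + y2).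
Proof.
move=> [l1 [hl1 lD1 ly1]] [l2 [hl2 lD2 ly2]]; exists (l1 ++ l2); split.
- by move=> s; rewrite big_cat hl1 hl2.
- by move=> m; rewrite mem_cat => /orP[/lD1|/lD2].
- by rewrite big_cat lerD.
Qed.

(** Disjoint sets of edges keep the products of monomials squarefree. This replaces independence
    when bounds on means are multiplied. *)
Lemma dom_mul D1 D2 D h1 h2 y1 y2 : dom D1 h1 y1 -> dom D2 h2 y2 ->
  (forall v, D1 v -> ~~ D2 v) -> (forall v, D1 v || D2 v -> D v) ->
  dom D (fun s => h1 s * h2 s) (y1 * y2).
Proof.
move=> d1 d2 D12 DD; have := dom_ge0 d1; have := dom_ge0 d2; move: d1 d2.
move=> [l1 [hl1 lD1 ly1]] [l2 [hl2 lD2 ly2]] y20 y10.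
exists [seq (a.1 * b.1, a.2 ++ b.2) | a <- l1, b <- l2]; split.
- move=> s; rewrite hl1 hl2 big_allpairs_dep /= mulr_suml; apply: eq_bigr => a _.
  rewrite mulr_sumr; apply: eq_bigr => b _; rewrite /monomial big_cat /=; ring.
- move=> m /allpairsP[[a b] /= [/lD1[a0 ua aD] /lD2[b0 ub bD] ->]] /=; split.
  + exact: mulr_ge0.
  + rewrite cat_uniq ua ub andbT; apply/hasPn => w /(allP bD) wD2; apply/negP => /(allP aD).
    by move/D12; rewrite wD2.
  + by rewrite all_cat; apply/andP; split; apply/allP => w wF; apply: DD;
      [rewrite (allP aD w wF)|rewrite (allP bD w wF) orbT].
- rewrite big_allpairs_dep /=.
  have -> : \sum_(a <- l1) \sum_(b <- l2) a.1 * b.1 * p ^+ size (a.2 ++ b.2)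
     = (\sum_(a <- l1) a.1 * p ^+ size a.2) * (\sum_(b <- l2) b.1 * p ^+ size b.2).
    rewrite mulr_suml; apply: eq_bigr => a _; rewrite mulr_sumr; apply: eq_bigr => b _.
    by rewrite size_cat exprD; ring.
  apply: ler_pM => //; rewrite big_seq; apply: sumr_ge0 => m.
    by move=> /lD1[m0 _ _]; rewrite mulr_ge0 // exprn_ge0.
  by move=> /lD2[m0 _ _]; rewrite mulr_ge0 // exprn_ge0.
Qed.

Lemma dom_scale D h y c : 0 <= c -> dom D h y -> dom D (fun s => c * h s) (c * y).
Proof.
by move=> c0 dh; apply: (dom_mul (D1 := pred0) (dom_const _ c0) dh) => // v; rewrite /= orFb.
Qed.

Lemma dom_sum (I : eqType) D (r : seq I) (h : I -> (V d -> 'Z_q) -> R) (y : I -> R) :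
  (forall i, i \in r -> dom D (h i) (y i)) ->
  dom D (fun s => \sum_(i <- r) h i s) (\sum_(i <- r) y i).
Proof.
elim: r => [|i r IH] H.
  under eq_fun do rewrite big_nil; rewrite big_nil; exact: dom_const.
under eq_fun do rewrite big_cons; rewrite big_cons.
by apply: dom_add; [apply: H; rewrite mem_head|apply: IH => j jr; apply: H; rewrite inE jr orbT].
Qed.

Lemma dom_prod (I : eqType) D (E : I -> pred (V d)) (r : seq I)
    (h : I -> (V d -> 'Z_q) -> R) (y : I -> R) :
  uniq r -> (forall i, i \in r -> dom (E i) (h i) (y i)) ->
  (forall i v, i \in r -> E i v -> D v) ->
  (forall i j v, i \in r -> j \in r -> E i v -> E j v -> i = j) ->
  dom D (fun s => \prod_(i <- r) h i s) (\prod_(i <- r) y i).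
Proof.
move=> ur H ED disj.
suff : dom (fun v => has (fun i => E i v) r) (fun s => \prod_(i <- r) h i s) (\prod_(i <- r) y i).
  by move=> dr; apply: (dom_weak dr) => // v /hasP[i ir]; apply: ED.
elim: r ur H {ED} disj => [|i r IH] /=.
  move=> *; under [X in dom _ X _]eq_fun do rewrite big_nil.
  by rewrite big_nil; exact: dom_const.
move=> /andP[ir ur] H disj.
under [X in dom _ X _]eq_fun do rewrite big_cons.
rewrite big_cons.
have dr : dom (fun v => has (fun i => E i v) r) (fun s => \prod_(i <- r) h i s) (\prod_(i <- r) y i).
  apply: IH => //; first by move=> j jr; apply: H; rewrite inE jr orbT.
  by move=> j k v jr kr; apply: disj; rewrite inE ?jr ?kr orbT.
apply: (dom_mul (H i (mem_head _ _)) dr) => // v Ev.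
apply/hasPn => j jr; apply/negP => Ejv; move: ir.
by rewrite (disj _ _ _ _ _ Ev Ejv) ?jr ?mem_head // inE jr orbT.
Qed.

Lemma dom_local D h y : dom D h y -> exists K, local (ball d K) h.
Proof.
case=> l [hl _ _].
exists (\max_(m <- l) \max_(w <- m.2) size (val w)) => s s' ss'.
rewrite !hl big_seq [in RHS]big_seq; apply: eq_bigr => m ml; congr (_ * _).
rewrite /monomial big_seq [in RHS]big_seq; apply: eq_bigr => w wm.
have wb : (size (val w) <= \max_(m <- l) \max_(w <- m.2) size (val w))%N.
  apply: leq_trans (leq_bigmax_seq (F := fun m : R * seq (V d) =>
    \max_(w <- m.2) size (val w)) _ ml isT).
  exact: (leq_bigmax_seq (F := fun w : V d => size (val w)) _ wm isT).
rewrite /broken !ss' // mem_ball // (leq_trans _ wb) // val_parent size_take.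
by case: ltnP => //; rewrite leq_pred.
Qed.

End Dominated.

Section DominatedChain.
Variables (R : realType) (d q : nat) (p : R).
Implicit Types (s : V d -> 'Z_q) (D : pred (V d)) (h : (V d -> 'Z_q) -> R).
Local Notation root := (Defs.root d).
Variables (nu : 'Z_q -> R) (P : 'Z_q -> 'Z_q -> R) (mu : probability (Omega d q) R).
Hypothesis mc : tree_markov_chain mu nu P.
Hypothesis nu0 : forall i, 0 <= nu i.
Hypothesis nu1 : \sum_i nu i = 1.
Hypothesis P0 : forall i j, 0 <= P i j.
Hypothesis P1 : forall i, \sum_j P i j = 1.
Hypothesis Pp : forall i, \sum_(j | j != i) P i j <= p.

(** Each indicator is absorbed into the kernel of its edge, whose row sums drop to at most [p]
    whatever the spin of the parent; summation from the last generation inwards then gives one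
    factor per edge. *)
Lemma integral_monomial F : uniq F ->
  (\int[mu]_s (monomial R F s)%:E <= (p ^+ size F)%:E)%E.
Proof.
move=> uF; have p0 : 0 <= p by apply: le_trans (Pp 0); apply: sumr_ge0.
case: (boolP (root \in F)) => rF.
  rewrite (eq_integral (fun=> 0%E)) ?integral0 ?lee_fin ?exprn_ge0 // => s _.
  have pr : parent root = root by apply: val_inj; rewrite val_parent.
  by rewrite /monomial (big_rem root) //= /broken pr eqxx mul0r.
pose K := \max_(w <- F) size (val w).
have FK : {subset F <= ball d K}.
  by move=> w wF; rewrite mem_ball (leq_bigmax_seq (F := fun w : V d => size (val w))).
have parK w : w \in F -> parent w \in ball d K.
  move=> /FK; rewrite !mem_ball; apply: leq_trans; rewrite val_parent size_take.
  by case: ltnP => //; rewrite leq_pred.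
have lF : local (ball d K) (monomial R F : (V d -> 'Z_q) -> R).
  move=> s s' ss'; rewrite /monomial big_seq [in RHS]big_seq; apply: eq_bigr => w wF.
  by rewrite /broken !ss' ?parK ?FK.
rewrite (integral_chain mc (fun=> 0) lF); last exact: monomial_ge0.
rewrite lee_fin.
pose g (c : V d) i j := P i j * (if c \in F then (i != j)%:R else 1).
pose b c : R := if c \in F then p else 1.
have -> : p ^+ size F = \prod_(c <- ball d K | c != root) b c.
  rewrite -big_filter (bigID (mem F)) /= [X in _ * X]big1 ?mulr1; last first.
    by move=> c /negPf cF; rewrite /b cF.
  rewrite -big_filter (perm_big F); last first.
    apply: uniq_perm; rewrite ?filter_uniq ?ball_uniq // => w.
    rewrite !mem_filter; case: (boolP (w \in F)) => //= wF.
    by rewrite FK // andbT; apply: contraNneq rF => <-.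
  rewrite (eq_big_seq (fun=> p)) => [|c cF]; last by rewrite /b cF.
  by rewrite big_const_seq count_predT iter_mulr_1.
have -> : (fun s => tree_weight nu (fun=> P) K s * monomial R F s) = tree_weight nu g K.
  apply/funext => s.
  have -> : monomial R F s = \prod_(c <- ball d K | c \in F) broken R c s.
    rewrite -big_filter; apply: perm_big; apply: uniq_perm; rewrite ?filter_uniq ?ball_uniq // => w.
    by rewrite mem_filter; case: (boolP (w \in F)) => //= /FK.
  elim: (K) => [|k IH] /=.
    by rewrite big_cons big_nil (negPf rF) mulr1.
  rewrite big_cat /= -/(lev d k.+1) mulrACA IH; congr (_ * _).
  rewrite [X in _ * X = _]big_mkcond -big_split; apply: eq_bigr => c _.
  by rewrite /g /=; case: ifP.
apply: sum_out_tree_weight => //.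
  by move=> c i j; rewrite /g mulr_ge0 //; case: ifP.
move=> c i; rewrite /g /b; case: ifP => _; last by under eq_bigr do rewrite mulr1; rewrite P1.
apply: le_trans (Pp i); rewrite [leRHS]big_mkcond; apply: ler_sum => j _ /=.
by rewrite eq_sym; case: eqVneq; rewrite ?mulr1 ?mulr0.
Qed.

Lemma dom_measurable D h y : dom p D h y -> measurable_fun setT (h : Omega d q -> R).
Proof.
by case/dom_local => K lh; apply: (measurable_local (ball_uniq d K) lh).
Qed.

Lemma dom_integral D h y : dom p D h y -> (\int[mu]_s (h s)%:E <= y%:E)%E.
Proof.
case=> l [hl lD ly]; apply: (@le_trans _ _ (\sum_(m <- l) m.1 * p ^+ size m.2)%:E); last by rewrite lee_fin.
(* Absolute values make the terms nonnegative for all pairs, also those outside [l], as needed to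
   exchange sum and integral. *)
have hl' s : h s = \sum_(m <- l) `|m.1| * monomial R m.2 s.
  by rewrite hl; apply: eq_big_seq => m /lD[m0 _ _]; rewrite ger0_norm.
have mm F : measurable_fun setT (monomial R F : Omega d q -> R).
  apply: measurable_prod => w _.
  apply: (@measurable_local _ _ _ (undup [:: parent w; w])); first exact: undup_uniq.
  by move=> s s' ss'; rewrite /broken !ss' // mem_undup !inE eqxx ?orbT.
under eq_integral do rewrite hl' -sumEFin.
rewrite ge0_integral_sum //=; first last.
- by move=> m s _; rewrite lee_fin mulr_ge0 // monomial_ge0.
- by move=> m; apply/measurable_EFinP/measurable_funM.
rewrite -sumEFin big_seq [leRHS]big_seq; apply: lee_sum => m /lD[m0 um _].
under eq_integral do rewrite EFinM.
rewrite ge0_integralZl //=; last first.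
- by move=> s _; rewrite lee_fin monomial_ge0.
- exact/measurable_EFinP.
by rewrite ger0_norm // EFinM lee_wpmul2l ?lee_fin // integral_monomial.
Qed.

End DominatedChain.

(** * The specification in terms of the chain *)

Section Specification.
Variables (R : realType) (d q : nat).
Implicit Types (s : V d -> 'Z_q) (L : seq (V d)) (F : (V d -> 'Z_q) -> R).
Local Notation root := (Defs.root d).

Lemma local_sum_out B L F : local B F -> local B (sum_out L F).
Proof.
elim: L F => [//|v L IH] F lF; apply: IH => s s' ss'.
rewrite /sum_at; apply: eq_bigr => i _; apply: lF => x xB.
by rewrite /upd ss'.
Qed.

Lemma localM B F G : local B F -> local B G -> local B (fun s => F s * G s).
Proof. by move=> lF lG s s' ss'; rewrite (lF _ _ ss') (lG _ _ ss'). Qed.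

Variables (W P : 'Z_q -> 'Z_q -> R) (x nu : 'Z_q -> R) (c Z : R).
Hypotheses (x0 : forall i, 0 < x i) (c0 : 0 < c) (Z0 : 0 < Z).
Hypothesis P0 : forall i j, 0 < P i j.
Hypothesis nuE : forall i, nu i = x i ^+ d.+1 / Z.
Hypothesis WE : forall i j, W i j = c * x i / x j ^+ d * P i j.

Local Notation tw := (tree_weight nu (fun=> P)).

Lemma nu_gt0 i : 0 < nu i.
Proof. by rewrite nuE divr_gt0 ?exprn_gt0. Qed.

Lemma tree_weight_gt0 K s : 0 < tw K s.
Proof.
elim: K => [|k IH]; first exact: nu_gt0.
by rewrite /= mulr_gt0 // prodr_gt0.
Qed.

Lemma sum_out_tw_gt0 L K s : 0 < sum_out L (tw K) s.
Proof.
apply: lt_le_trans (tree_weight_gt0 K s) _; apply: sum_out_ge => s'.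
exact/ltW/tree_weight_gt0.
Qed.

Lemma prod_parent k (F : V d -> R) :
  \prod_(w <- lev d k.+1) F (parent w) = \prod_(v <- lev d k) F v ^+ size (children v).
Proof.
rewrite /= big_flatten big_map; apply: eq_bigr => v _.
rewrite (eq_big_seq (fun=> F v)) => [|w /childrenP[_ ->] //].
by rewrite big_const_seq count_predT iter_mulr_1.
Qed.

Definition total_weight K s : R := \prod_(w <- ball d K | w != root) W (s (parent w)) (s w).

Lemma total_weightS k s : total_weight k.+1 s =
  total_weight k s * \prod_(w <- lev d k.+1) W (s (parent w)) (s w).
Proof.
rewrite /total_weight [ball d _]/= big_cat /= -/(lev d k.+1); congr (_ * _).
rewrite big_seq_cond [in RHS]big_seq; apply: eq_bigl => w.
by case: (boolP (w \in _)) => //= /lev_neq_root.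
Qed.

(** The factors telescope: an inner vertex receives x ^ d from the edges to its children and x ^ -d
    from the edge to its parent, while the root keeps x ^ (d + 1), that is [Z * nu]. Only the last
    generation retains a factor. *)
Lemma total_weightE k : exists2 C, 0 < C & forall s,
  total_weight k.+1 s = C * tw k.+1 s * \prod_(w <- lev d k.+1) (x (s w) ^+ d)^-1.
Proof.
have WW m s : \prod_(w <- lev d m.+1) W (s (parent w)) (s w)
   = c ^+ size (lev d m.+1) * \prod_(v <- lev d m) x (s v) ^+ size (children v)
     * \prod_(w <- lev d m.+1) (x (s w) ^+ d)^-1
     * \prod_(w <- lev d m.+1) P (s (parent w)) (s w).
  rewrite -(prod_parent m (fun v => x (s v))) -[size _]count_predT -iter_mulr_1 -big_const_seq.
  by rewrite -!big_split /=; apply: eq_bigr => w _; rewrite WE.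
elim: k => [|k [C C0 IH]].
  exists (c ^+ size (lev d 1) * Z); first by rewrite mulr_gt0 // exprn_gt0.
  move=> s; rewrite total_weightS WW /total_weight big_cons big_nil eqxx /= big_seq1.
  rewrite size_children eqxx nuE /= -/(lev d 1).
  field; exact: lt0r_neq0.
exists (C * c ^+ size (lev d k.+2)); first by rewrite mulr_gt0 // exprn_gt0.
move=> s; rewrite total_weightS WW IH.
have -> : \prod_(v <- lev d k.+1) x (s v) ^+ size (children v)
    = \prod_(v <- lev d k.+1) x (s v) ^+ d.
  by apply: eq_big_seq => v vk; rewrite size_children (negPf (lev_neq_root vk)).
rewrite -[tw k.+2 s]/(tw k.+1 s * \prod_(w <- lev d k.+2) P (s (parent w)) (s w)).
rewrite prodfV.
have xk0 : \prod_(v <- lev d k.+1) x (s v) ^+ d != 0.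
  by rewrite lt0r_neq0 // prodr_gt0 // => v _; rewrite exprn_gt0.
set X := \prod_(v <- lev d k.+1) _ in xk0 *.
by field.
Qed.

Lemma edge_weightE k L s : {subset L <= ball d k} ->
  total_weight k.+1 s = edge_weight W L s *
    \prod_(w <- ball d k.+1 | [&& w != root, w \notin L & parent w \notin L])
       W (s (parent w)) (s w).
Proof.
move=> Lk; have uB := ball_uniq d k.+1.
rewrite /total_weight (bigID (mem L)) /= [X in _ * X](bigID (fun w => parent w \in L)) /= mulrA.
rewrite /edge_weight; congr (_ * _ * _).
- rewrite -[in LHS]big_filter -[in RHS]big_filter; apply: perm_big.
  apply: uniq_perm; rewrite ?filter_uniq ?undup_uniq // => w.
  rewrite !mem_filter mem_undup -andbA; case: (w != root) => //=.
  by case: (boolP (w \in L)) => //= /Lk /(ball_subset (leqnSn k)).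
- transitivity (\prod_(w <- flatten [seq children v | v <- undup L] | w \notin L)
      W (s (parent w)) (s w)); last first.
    rewrite big_flatten big_map; apply: eq_bigr => v _.
    by rewrite big_seq_cond [in RHS]big_seq_cond; apply: eq_bigr => w /andP[/childrenP[_ ->]].
  rewrite -[in LHS]big_filter -[in RHS]big_filter; apply: perm_big.
  apply: uniq_perm; rewrite ?filter_uniq ?flatten_children_uniq ?undup_uniq // => w.
  rewrite !mem_filter; case: (boolP (w \in L)) => //=; rewrite ?andbF // => _.
  apply/idP/flatten_mapP.
    move=> /andP[/andP[/andP[wr _] pL] _]; exists (parent w); first by rewrite mem_undup.
    exact: mem_children_parent.
  move=> [v]; rewrite mem_undup => vL wv.
  have /childrenP[-> ->] := wv; rewrite vL /= -/(lev d k.+1) -/(ball d k.+1) mem_ball (size_child wv) ltnS -mem_ball.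
  exact: Lk.
- by apply: eq_bigl => w; rewrite andbA.
Qed.

Definition cond_exp L K F s : R := sum_out L (fun s => tw K s * F s) s / sum_out L (tw K) s.

(** The chain is a Gibbs measure: the weights of the specification and of the chain differ by a
    factor [r] depending only on sites off [L]. The extra generation keeps the leftover factors of
    [total_weightE] off [L]. *)
Lemma gammaE k L Delta xi s : {subset L <= ball d k} ->
  gamma W L Delta xi s = cond_exp L k.+1 (fun s' => (cylb Delta xi s')%:R) s.
Proof.
move=> Lk; have [C C0 HC] := total_weightE k.
pose r s : R := C^-1 * (\prod_(w <- lev d k.+1) x (s w) ^+ d) *
  \prod_(w <- ball d k.+1 | [&& w != root, w \notin L & parent w \notin L])
       W (s (parent w)) (s w).
have W0 i j : 0 < W i j by rewrite WE mulr_gt0 // divr_gt0 ?exprn_gt0 // mulr_gt0.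
have r0 s' : 0 < r s'.
  by rewrite /r !mulr_gt0 ?invr_gt0 // prodr_gt0 // => w _; rewrite exprn_gt0.
have twE s' : tw k.+1 s' = r s' * edge_weight W L s'.
  have := HC s'; rewrite (edge_weightE _ Lk) prodfV /r => H.
  have X0 : \prod_(w <- lev d k.+1) x (s' w) ^+ d != 0.
    by rewrite lt0r_neq0 // prodr_gt0 // => v _; rewrite exprn_gt0.
  move: X0 H; set X := \prod_(w <- lev d k.+1) _; set E := \prod_(w <- _ | _) _ => X0 H.
  rewrite (_ : C^-1 * X * E * _ = C^-1 * X * (edge_weight W L s' * E)); last by ring.
  by rewrite H; field; rewrite X0 lt0r_neq0.
have ir : indep L r.
  move=> s1 s2 s12; rewrite /r; congr (_ * _ * _).
    apply: eq_big_seq => w wk; rewrite s12 //; apply/negP => /Lk.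
    by apply/negP; apply: contraL wk; apply: ballS_notin.
  by apply: eq_bigr => w /and3P[_ wL pL]; rewrite !s12.
rewrite /gamma /cond_exp.
rewrite (sum_patch L (fun s' => edge_weight W L s' * (cylb Delta xi s')%:R)).
rewrite (sum_patch L (fun s' => edge_weight W L s')).
rewrite (_ : (fun s => tw k.+1 s * _) = (fun s' => r s' *
    (edge_weight W L s' * (cylb Delta xi s')%:R))); last first.
  by apply/funext => s'; rewrite twE mulrA.
rewrite (_ : tw k.+1 = (fun s' => r s' * edge_weight W L s')); last exact/funext.
rewrite !(@sum_outM _ _ _ L _ r) // invfM mulrACA divff ?mul1r //.
exact: lt0r_neq0.
Qed.

Lemma cond_exp_ge0 L K F s : (forall s, 0 <= F s) -> 0 <= cond_exp L K F s.
Proof.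
move=> F0; apply: divr_ge0; last exact/ltW/sum_out_tw_gt0.
by apply: sum_out_ge0 => s'; rewrite mulr_ge0 // ltW // tree_weight_gt0.
Qed.

Lemma local_cond_exp L K F : local (ball d K) F -> local (ball d K) (cond_exp L K F).
Proof.
move=> lF s s' ss'; rewrite /cond_exp; congr (_ / _).
  exact: (local_sum_out _ (localM (@local_tree_weight _ _ _ _ _ K) lF)).
exact: (local_sum_out _ (@local_tree_weight _ _ _ _ _ K)).
Qed.

Variable mu : probability (Omega d q) R.
Hypothesis mc : tree_markov_chain mu nu P.

(** Tower property: the conditional mean does not depend on the sites of [ball d n], so summing
    these out restores its denominator. *)
Lemma integral_cond_exp n K F : (n <= K)%N -> local (ball d K) F -> (forall s, 0 <= F s) ->
  (\int[mu]_s (cond_exp (ball d n) K F s)%:E = \int[mu]_s (F s)%:E)%E.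
Proof.
move=> nK lF F0.
rewrite (integral_chain mc (fun=> 0) lF F0).
rewrite (integral_chain mc (fun=> 0) (local_cond_exp _ lF)); last by move=> s; apply: cond_exp_ge0.
congr EFin.
have pB : perm_eq (ball d K) (ball d n ++ [seq v <- ball d K | v \notin ball d n]).
  have uB := ball_uniq d; apply: uniq_perm => //.
    rewrite cat_uniq uB filter_uniq // andbT; apply/hasPn => v.
    by rewrite mem_filter => /andP[].
  move=> v; rewrite mem_cat mem_filter; case: (boolP (v \in ball d n)) => //=.
  exact: ball_subset.
rewrite !(sum_out_perm _ pB) !sum_out_cat; congr (sum_out _ _ _).
apply/funext => s.
rewrite (_ : (fun s => _) = (fun s => cond_exp (ball d n) K F s * tw K s)); last first.
  by apply/funext => s'; rewrite mulrC.
rewrite sum_outM; last first.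
  move=> s1 s2 s12; rewrite /cond_exp; congr (_ / _); exact: indep_sum_out s12.
by rewrite /cond_exp divfK // lt0r_neq0 // sum_out_tw_gt0.
Qed.

End Specification.

(** * Disagreement clusters *)

Section Clusters.
Variables (R : realType) (d q : nat) (p al : R).
Hypotheses (d2 : (2 <= d)%N) (p0 : 0 <= p) (al1 : 1 <= al) (alp : al ^+ 2 * p <= 1).
Implicit Types (s : V d -> 'Z_q).
Local Notation root := (Defs.root d).

(* Generating function of the clusters rooted at [v], truncated at depth k, with
   weight [1 + al ^+ 2 * broken] for each candidate boundary edge; the prefactor
   compensates for the d - 1 boundary edges gained with each vertex. *)
Fixpoint cluster (k : nat) (v : V d) s : R :=
  if k is j.+1 then
    (al ^+ d.-1)^-1 * \prod_(c <- children v)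
       ((1 + al ^+ 2 * broken R c s) * (1 + cluster j c s))
  else 0.

(** The cluster of [v] deprived of the part below [c0]. With [c0] the next vertex of a branch, the
    sets of edges used at different sites of the branch are disjoint. *)
Definition hanging (k : nat) (c0 v : V d) s : R :=
  (al ^+ d.-1)^-1 * \prod_(c <- children v | c != c0)
       ((1 + al ^+ 2 * broken R c s) * (1 + cluster k c s)).

Lemma al_gt0 : 0 < al. Proof. exact: lt_le_trans al1. Qed.

Lemma broken_ge0 c s : 0 <= broken R c s. Proof. exact: ler0n. Qed.

Lemma cluster_ge0 k v s : 0 <= cluster k v s.
Proof.
have al0 := al_gt0.
elim: k v => //= k IH v; rewrite mulr_ge0 ?invr_ge0 ?exprn_ge0 ?(ltW al0) //.
apply: prodr_ge0 => c _; rewrite mulr_ge0 ?addr_ge0 //.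
by rewrite mulr_ge0 ?broken_ge0 // exprn_ge0 // ltW.
Qed.

Lemma hanging_ge0 k c0 v s : 0 <= hanging k c0 v s.
Proof.
have al0 := al_gt0.
rewrite mulr_ge0 ?invr_ge0 ?exprn_ge0 ?(ltW al0) //.
apply: prodr_ge0 => c _; rewrite mulr_ge0 ?addr_ge0 ?cluster_ge0 //.
by rewrite mulr_ge0 ?broken_ge0 // exprn_ge0 // ltW.
Qed.

(** Either the configurations agree at [c], and then the edge above [c] is broken in one of them
    since they differ at [v]; or the cluster continues to [c], which supplies the factor by
    hypothesis. *)
Lemma cluster_factor k v c s s' : c \in children v -> s v != s' v ->
  (s c != s' c -> al ^+ 2 <= cluster k c s * cluster k c s') ->
  al ^+ 2 <= ((1 + al ^+ 2 * broken R c s) * (1 + cluster k c s)) *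
             ((1 + al ^+ 2 * broken R c s') * (1 + cluster k c s')).
Proof.
move=> /childrenP[_ pc] vv' cc'; have a0 : 0 <= al ^+ 2 by rewrite exprn_ge0 // ltW // al_gt0.
have y0 := cluster_ge0 k c s; have y0' := cluster_ge0 k c s'.
have b0 := broken_ge0 c s; have b0' := broken_ge0 c s'.
rewrite mulrACA; case: (eqVneq (s c) (s' c)) => [e|/cc' h].
  have h1 : 1 <= (1 + cluster k c s) * (1 + cluster k c s') by nra.
  have h2 : al ^+ 2 <= (1 + al ^+ 2 * broken R c s) * (1 + al ^+ 2 * broken R c s').
    have : (1 <= broken R c s) || (1 <= broken R c s').
      rewrite /broken pc -e; case: (eqVneq (s v) (s c)) => [vc|_]; last by rewrite lexx.
      by rewrite eq_sym -vc (negPf vv') lexx orbT.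
    have aux (b b' : R) : 0 <= b' -> 1 <= b -> al ^+ 2 <= (1 + al ^+ 2 * b) * (1 + al ^+ 2 * b').
      move=> b'0 b1; have h3 : al ^+ 2 <= al ^+ 2 * b by rewrite ler_peMr.
      have h4 : 0 <= al ^+ 2 * b' by rewrite mulr_ge0.
      by move: h3 h4; set X := _ * b; set Y := _ * b' => h3 h4; nra.
    by case/orP => h3; [|rewrite mulrC]; apply: aux.
  by nra.
have h1 : 1 <= (1 + al ^+ 2 * broken R c s) * (1 + al ^+ 2 * broken R c s').
  by apply: mulr_ege1; rewrite lerDl mulr_ge0.
have h2 : al ^+ 2 <= (1 + cluster k c s) * (1 + cluster k c s') by nra.
by nra.
Qed.

Lemma normalizing_factor : (al ^+ d.-1)^-1 * (al ^+ d.-1)^-1 * (al ^+ 2) ^+ d.-1 = 1.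
Proof.
rewrite -exprM mulnC exprM expr2 mulrA -mulrA mulrACA mulVf ?mul1r ?mulr1 ?mulVf //;
  by rewrite expf_neq0 // gt_eqF // al_gt0.
Qed.

(* Every edge leaving the disagreement cluster of [v] is broken in [s] or in
   [s'], which gives a factor [al ^+ 2] per boundary edge. *)
Lemma cluster_swap k v s s' :
  (forall w, (size (val v) + k <= size (val w))%N -> s w = s' w) ->
  s v != s' v -> al ^+ 2 <= cluster k v s * cluster k v s'.
Proof.
elim: k v => [|k IH] v agree vv'.
  by move: vv'; rewrite agree ?eqxx // addn0.
have a1 : 1 <= al ^+ 2 by rewrite exprn_ege1.
rewrite /= mulrACA -big_split /=.
have : (al ^+ 2) ^+ d <= \prod_(c <- children v)
  ((1 + al ^+ 2 * broken R c s) * (1 + cluster k c s) *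
             ((1 + al ^+ 2 * broken R c s') * (1 + cluster k c s'))).
  apply: (@le_trans _ _ ((al ^+ 2) ^+ size (children v))).
    by rewrite ler_weXn2l // size_children_ge.
  rewrite -iter_mulr_1 -[size _]count_predT -big_const_seq big_seq [leRHS]big_seq.
  apply: ler_prod => c cv; rewrite (le_trans ler01) //=.
  apply: (cluster_factor cv vv') => cc'; apply: IH => // w.
  by rewrite (size_child cv) addSnnS; apply: agree.
move=> H; apply: le_trans (ler_wpM2l _ H).
  have -> : (al ^+ 2) ^+ d = (al ^+ 2) ^+ d.-1 * al ^+ 2.
    by rewrite -exprSr prednK // (ltn_trans _ d2).
  by rewrite mulrA normalizing_factor mul1r.
by rewrite mulr_ge0 // invr_ge0 exprn_ge0 // ltW // al_gt0.
Qed.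

(** Without [c0] at least d - 1 children remain, and their factors [al ^+ 2] just cancel the two
    prefactors. *)
Lemma hanging_swap k c0 v s s' : c0 \in children v ->
  (forall w, ((size (val v)).+1 + k <= size (val w))%N -> s w = s' w) ->
  s v != s' v -> 1 <= hanging k c0 v s * hanging k c0 v s'.
Proof.
move=> c0v agree vv'; have a1 : 1 <= al ^+ 2 by rewrite exprn_ege1.
rewrite /hanging mulrACA -big_split /=.
have : (al ^+ 2) ^+ d.-1 <= \prod_(c <- children v | c != c0)
  ((1 + al ^+ 2 * broken R c s) * (1 + cluster k c s) *
             ((1 + al ^+ 2 * broken R c s') * (1 + cluster k c s'))).
  apply: (@le_trans _ _ ((al ^+ 2) ^+ count (predC1 c0) (children v))).
    rewrite ler_weXn2l //.
    have := count_predC (pred1 c0) (children v).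
    rewrite count_uniq_mem ?children_uniq // c0v add1n => h.
    by rewrite -ltnS prednK ?(ltn_trans _ d2) // h size_children_ge.
  rewrite -iter_mulr_1 -big_const_seq big_seq_cond [leRHS]big_seq_cond.
  apply: ler_prod => c /andP[cv _]; rewrite (le_trans ler01) //=.
  apply: (cluster_factor cv vv') => cc'; apply: cluster_swap => // w.
  by rewrite (size_child cv); apply: agree.
move=> H; apply: le_trans (ler_wpM2l _ H); first by rewrite normalizing_factor.
by rewrite mulr_ge0 // invr_ge0 exprn_ge0 // ltW // al_gt0.
Qed.

(** A bound reproduced by the recursion for [cluster]: each of at most d + 1 children contributes 1
    + al ^ 2 * p <= 2 times 1 + cluster_bound <= 2. *)
Definition cluster_bound : R := 4 ^+ d.+1 / al ^+ d.-1.
Hypothesis y1 : cluster_bound <= 1.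

Definition strictly_below (v w : V d) := below v w && (w != v).

Lemma cluster_bound_ge0 : 0 <= cluster_bound.
Proof. by rewrite divr_ge0 ?exprn_ge0 // ltW // al_gt0. Qed.

Lemma dom_cluster_factor k c : dom p (strictly_below c) (cluster k c : (V d -> 'Z_q) -> R) cluster_bound ->
  dom p (below c) (fun s : V d -> 'Z_q => (1 + al ^+ 2 * broken R c s) * (1 + cluster k c s)) 4.
Proof.
move=> dc; have a0 : 0 <= al ^+ 2 by rewrite exprn_ge0 // ltW // al_gt0.
have h1 : dom p (pred1 c) (fun s : V d -> 'Z_q => 1 + al ^+ 2 * broken R c s) 2.
  apply: (@dom_weak _ _ _ p (pred1 c) _ _ (1 + al ^+ 2 * p)) => //; last by rewrite (_ : 2 = 1 + 1) // lerD2l.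
  apply: dom_add; first exact: dom_const.
  by apply: dom_scale => //; apply: dom_broken => /=.
have h2 : dom p (strictly_below c) (fun s => 1 + cluster k c s) 2.
  apply: (@dom_weak _ _ _ p (strictly_below c) _ _ (1 + cluster_bound)) => //; last by rewrite (_ : 2 = 1 + 1) // lerD2l.
  by apply: dom_add => //; exact: dom_const.
rewrite (_ : 4 = 2 * 2); last by ring.
apply: (dom_mul _ h1 h2) => // v /=.
  by move=> /eqP ->; rewrite /strictly_below eqxx andbF.
by case/orP => [/eqP ->|/andP[]//]; rewrite below_refl.
Qed.

Lemma dom_cluster k v : dom p (strictly_below v) (cluster k v : (V d -> 'Z_q) -> R) cluster_bound.
Proof.
have z0 : 0 <= (al ^+ d.-1)^-1 by rewrite invr_ge0 exprn_ge0 // ltW // al_gt0.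
elim: k v => [|k IH] v /=.
  apply: (@dom_weak _ _ _ p (strictly_below v) _ _ 0) => //; first exact: dom_const.
  exact: cluster_bound_ge0.
apply: (@dom_weak _ _ _ p (strictly_below v) _ _ ((al ^+ d.-1)^-1 * \prod_(c <- children v) 4)) => //.
  apply: dom_scale => //.
  apply: (dom_prod p0 (E := fun c => below c)); first exact: children_uniq.
  - by move=> c _; apply: dom_cluster_factor.
  - move=> c w cv cw; rewrite /strictly_below (below_trans (below_child cv) cw) /=.
    by apply: contraTneq cw => ->; apply: child_notbelow.
  - by move=> c c' w cv c'v; apply: (below_uniq cv c'v).
rewrite big_const_seq count_predT iter_mulr_1 mulrC /cluster_bound ler_wpM2r //.
by rewrite ler_weXn2l ?size_children_le // ler1n.
Qed.

Lemma dom_hanging k c0 v : c0 \in children v ->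
  dom p (fun w => below v w && ~~ below c0 w) (hanging k c0 v : (V d -> 'Z_q) -> R) cluster_bound.
Proof.
move=> c0v.
have z0 : 0 <= (al ^+ d.-1)^-1 by rewrite invr_ge0 exprn_ge0 // ltW // al_gt0.
apply: (@dom_weak _ _ _ p (fun w => below v w && ~~ below c0 w) _ _
  ((al ^+ d.-1)^-1 * \prod_(c <- [seq c <- children v | c != c0]) 4)) => //.
  rewrite /hanging; under [X in dom _ _ X _]eq_fun do rewrite -big_filter.
  apply: dom_scale => //.
  apply: (dom_prod p0 (E := fun c => below c)); first by rewrite filter_uniq // children_uniq.
  - by move=> c _; apply: dom_cluster_factor; apply: dom_cluster.
  - move=> c w; rewrite mem_filter => /andP[cc0 cv] cw.
    rewrite (below_trans (below_child cv) cw) /=; apply: contraNN cc0 => /= c0w.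
    by rewrite (below_uniq cv c0v cw c0w).
  - by move=> c c' w; rewrite !mem_filter => /andP[_ cv] /andP[_ c'v]; apply: (below_uniq cv c'v).
rewrite big_const_seq count_predT iter_mulr_1 mulrC /cluster_bound ler_wpM2r //.
rewrite ler_weXn2l ?ler1n // (leq_trans _ (size_children_le v)) //.
by rewrite size_filter count_size.
Qed.

(** Sites sampled along a descending branch, and for each the child through which the branch
    continues. *)
Variables (y nxt : nat -> V d).
Hypothesis nxt_child : forall i, nxt i \in children (y i).
Hypothesis nxt_below : forall i j, (i < j)%N -> below (nxt i) (y j).

Definition hanging_prod (k : nat) (r : seq nat) s : R :=
  \prod_(i <- r) (1 + hanging k (nxt i) (y i) s).

Definition mismatches (r : seq nat) s s' : nat := count (fun i => s (y i) != s' (y i)) r.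

Lemma dom_hanging_prod k r : uniq r ->
  dom p predT (hanging_prod k r : (V d -> 'Z_q) -> R) ((1 + cluster_bound) ^+ size r).
Proof.
move=> ur; rewrite -iter_mulr_1 -[size _]count_predT -big_const_seq.
apply: (dom_prod p0 (E := fun i w => below (y i) w && ~~ below (nxt i) w)) => //.
  by move=> i _; apply: dom_add; [exact: dom_const|apply: dom_hanging].
move=> i j w _ _ /andP[iw niw] /andP[jw njw].
case: (ltngtP i j) => // ij.
  by move: niw; rewrite (below_trans (nxt_below ij) jw).
by move: njw; rewrite (below_trans (nxt_below ij) iw).
Qed.

(** At a mismatch h h' >= 1, hence h + h' >= 2 and (1 + h)(1 + h') >= 4. A second
    arithmetic-geometric inequality turns the product over the two configurations into a sum, so
    that no edge is used twice. *)
Lemma mismatches_le k r s s' :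
  (forall i w, i \in r -> ((size (val (y i))).+1 + k <= size (val w))%N -> s w = s' w) ->
  2 ^+ mismatches r s s' <= (hanging_prod k r s + hanging_prod k r s') / 2.
Proof.
move=> agree.
have H : 4 ^+ mismatches r s s' <= hanging_prod k r s * hanging_prod k r s'.
  rewrite /mismatches /hanging_prod -big_split /= -iter_mulr_1 -big_const_seq.
  rewrite big_seq_cond big_mkcond /= [leRHS]big_seq [leRHS]big_mkcond /=; apply: ler_prod => i _.
  have h0 := hanging_ge0 k (nxt i) (y i) s; have h0' := hanging_ge0 k (nxt i) (y i) s'.
  case: (boolP (i \in r)) => ir /=; last by rewrite ler01 lexx.
  case: ifP => [vv'|_]; last by rewrite ler01 /=; nra.
  rewrite ler0n /=.
  have := hanging_swap (k := k) (nxt_child i) (fun w => @agree i w ir) vv'.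
  set h := hanging _ _ _ s in h0 *; set h' := hanging _ _ _ s' in h0' * => hh.
  have : 4 <= (h + h') ^+ 2 by have := sqr_ge0 (h - h'); nra.
  move=> hs; have : 2 <= h + h'.
    rewrite -(ler_pXn2r (_ : (0 < 2)%N)) ?nnegrE ?addr_ge0 //.
    by rewrite (_ : 2 ^+ 2 = 4) //; ring.
  by nra.
have g0 s1 : 0 <= hanging_prod k r s1.
  by apply: prodr_ge0 => i _; rewrite addr_ge0 ?hanging_ge0.
rewrite ler_pdivlMr // -(ler_pXn2r (_ : (0 < 2)%N)) ?nnegrE ?addr_ge0 ?mulr_ge0 ?exprn_ge0 //.
rewrite exprMn -exprM mulnC exprM (_ : 2 ^+ 2 = 4); last by ring.
have := sqr_ge0 (hanging_prod k r s - hanging_prod k r s').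
by nra.
Qed.

End Clusters.

(** * Exponential moments of the number of mismatches along a branch *)

Section Overlap.
Variables (R : realType) (d q : nat) (p al : R).
Hypotheses (d2 : (2 <= d)%N) (p0 : 0 <= p) (al1 : 1 <= al) (alp : al ^+ 2 * p <= 1).
Hypothesis cb1 : cluster_bound d al <= 1.
Implicit Types (s : V d -> 'Z_q).
Variables (W P : 'Z_q -> 'Z_q -> R) (x nu : 'Z_q -> R) (c Z : R).
Hypotheses (x0 : forall i, 0 < x i) (c0 : 0 < c) (Z0 : 0 < Z).
Hypothesis P0 : forall i j, 0 < P i j.
Hypothesis nuE : forall i, nu i = x i ^+ d.+1 / Z.
Hypothesis WE : forall i j, W i j = c * x i / x j ^+ d * P i j.
Hypothesis nu1 : \sum_i nu i = 1.
Hypothesis P1 : forall i, \sum_j P i j = 1.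
Hypothesis Pp : forall i, \sum_(j | j != i) P i j <= p.
Variable mu : probability (Omega d q) R.
Hypothesis mc : tree_markov_chain mu nu P.
Variables (y nxt : nat -> V d).
Hypothesis nxt_child : forall i, nxt i \in children (y i).
Hypothesis nxt_below : forall i j, (i < j)%N -> below (nxt i) (y j).

Lemma branch_inj : injective y.
Proof.
have H i j : (i < j)%N -> y i != y j.
  move=> /nxt_below ij; apply: contraTneq ij => <-.
  exact: child_notbelow.
move=> i j yij; case: (ltngtP i j) => // /H; rewrite yij eqxx //.
Qed.

(** The mean of 2 ^ mismatches under [gamma] on [ball d n], expanded over cylinders, the events on
    which [gamma] is given; in this form it passes to the limit term by term. *)
Definition mismatch_moment (r : seq nat) n s : R :=
  \sum_(eta : (size (map y r)).-tuple 'Z_q)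
    2 ^+ mismatches y r s (Defs.patch eta (fun=> 0)) *
    gamma W (ball d n) (map y r) (Defs.patch eta (fun=> 0)) s.

Lemma local_mismatches r s :
  local (map y r) (fun s' => 2 ^+ mismatches y r s s' : R).
Proof.
move=> s1 s2 s12; congr (_ ^+ _); apply: eq_in_count => i ir.
by rewrite s12 // map_f.
Qed.

Lemma mismatch_momentE r n k s : uniq r -> (n <= k)%N ->
  mismatch_moment r n s =
  cond_exp P nu (ball d n) k.+1 (fun s' => 2 ^+ mismatches y r s s') s.
Proof.
move=> ur nk; have uD : uniq (map y r) by rewrite map_inj_uniq //; exact: branch_inj.
rewrite /mismatch_moment.
under eq_bigr do rewrite (gammaE x0 c0 Z0 P0 nuE WE _ _ _ (ball_subset nk)) mulrA -sum_outM_cst.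
rewrite -mulr_suml -sum_out_sum; congr (_ / _); apply: sum_out_ext => s' _.
rewrite (localE s' (fun=> 0) uD (@local_mismatches r s)) mulr_sumr.
by apply: eq_bigr => eta _; rewrite mulrCA mulrA.
Qed.

Lemma mismatch_moment_ge0 r n s : uniq r -> 0 <= mismatch_moment r n s.
Proof.
move=> ur; rewrite (mismatch_momentE s ur (leqnn n)).
by apply: (cond_exp_ge0 x0 Z0 P0 nuE) => s'; rewrite exprn_ge0.
Qed.

Lemma local_mismatch_moment r n : uniq r ->
  exists K, local (ball d K) (mismatch_moment r n).
Proof.
move=> ur; pose K := maxn n.+1 (\max_(i <- r) size (val (y i))).
exists K => s s' ss'.
have yK i : i \in r -> y i \in ball d K.
  move=> ir; rewrite mem_ball leq_max; apply/orP; right.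
  exact: (leq_bigmax_seq (F := fun i => size (val (y i))) _ ir isT).
rewrite !(mismatch_momentE _ ur (leqnn n)).
rewrite (_ : (fun s0 => 2 ^+ mismatches y r s s0) = (fun s0 => 2 ^+ mismatches y r s' s0)); last first.
  apply/funext => s0; congr (_ ^+ _); apply: eq_in_count => i ir.
  by rewrite ss' // yK.
rewrite /cond_exp; congr (_ / _).
  apply: local_sum_out ss'; apply: localM.
    by apply: (local_sub _ (@local_tree_weight _ _ _ _ _ _)); apply: ball_subset; rewrite leq_max leqnn.
  by apply: local_sub (@local_mismatches r s') => v /mapP[i ir ->]; apply: yK.
apply: local_sum_out ss'.
by apply: (local_sub _ (@local_tree_weight _ _ _ _ _ _)); apply: ball_subset; rewrite leq_max leqnn.
Qed.

(* The configuration and its resampling inside [ball d n] have the same law,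
   so only one-configuration moments are needed. *)
Lemma integral_mismatch_moment r n : uniq r ->
  (\int[mu]_s (mismatch_moment r n s)%:E <= ((1 + cluster_bound d al) ^+ size r)%:E)%E.
Proof.
move=> ur; pose G := hanging_prod al y nxt n r : (V d -> 'Z_q) -> R.
have dG : dom p predT G ((1 + cluster_bound d al) ^+ size r) by apply: dom_hanging_prod.
have G0 s : 0 <= G s := dom_fun_ge0 s dG.
have [K lG] := dom_local dG.
pose k := maxn n K.
have lGk : local (ball d k.+1) G.
  by apply: local_sub lG; apply: ball_subset; rewrite leqW // leq_maxr.
have nk : (n <= k)%N by rewrite leq_maxl.
pose C := cond_exp P nu (ball d n) k.+1 G.
have C0 s : 0 <= C s := cond_exp_ge0 x0 Z0 P0 nuE (ball d n) k.+1 s G0.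
have mG : measurable_fun setT (G : Omega d q -> R) by apply: measurable_local lG; exact: ball_uniq.
have mC : measurable_fun setT (C : Omega d q -> R).
  by apply: measurable_local (local_cond_exp _ _ _ lGk); exact: ball_uniq.
(* [s] is kept while [s'] is resampled: the conditional mean of (G s + G s') / 2 is (G s + C s) / 2,
   and C has the same integral as G. *)
have le s : mismatch_moment r n s <= 2^-1 * (G s + C s).
  rewrite (mismatch_momentE s ur nk) /C /cond_exp.
  rewrite ler_pdivrMr ?(sum_out_tw_gt0 x0 Z0 P0 nuE) //.
  rewrite -mulrA mulrDl divfK ?lt0r_neq0 ?(sum_out_tw_gt0 x0 Z0 P0 nuE) //.
  rewrite mulrDr mulrA -!sum_outM_cst -sum_outD.
  apply: sum_out_le => s' ss'.
  have t0 := tree_weight_gt0 x0 Z0 P0 nuE k.+1 s'.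
  have := mismatches_le (k := n) d2 al1 nxt_child (r := r) (s := s) (s' := s').
  rewrite -/(G s) -/(G s') => H.
  rewrite (_ : _ + _ = tree_weight nu (fun=> P) k.+1 s' * ((G s + G s') / 2)); last by field.
  rewrite ler_pM2l //; apply: H => i w _ h; apply/esym/ss'.
  by rewrite mem_ball -ltnNge; apply: leq_trans h; rewrite addSn ltnS leq_addl.
apply: (@le_trans _ _ (\int[mu]_s (2^-1 * (G s + C s))%:E)%E).
  apply: ge0_le_integral => //.
  - by move=> s _; rewrite lee_fin mismatch_moment_ge0.
  - apply/measurable_EFinP; have [K' lm] := local_mismatch_moment n ur.
    by apply: measurable_local lm; exact: ball_uniq.
  - apply/measurable_EFinP; apply: measurable_funM => //; exact: measurable_funD.
  - by move=> s _; rewrite lee_fin.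
under eq_integral do rewrite EFinM EFinD.
rewrite ge0_integralZl ?lee_fin //; first last.
- by move=> s _; rewrite -EFinD lee_fin addr_ge0.
- by apply/measurable_EFinP; exact: measurable_funD.
rewrite ge0_integralD //; first last.
- exact/measurable_EFinP.
- by move=> s _; rewrite lee_fin.
- exact/measurable_EFinP.
- by move=> s _; rewrite lee_fin.
have iG := dom_integral mc (fun i => ltW (nu_gt0 x0 Z0 nuE i)) nu1 (fun i j => ltW (P0 i j)) P1 Pp dG.
rewrite (integral_cond_exp x0 Z0 P0 nuE mc) ?(leqW nk) //.
set v := (_ ^+ _) in iG *.
rewrite (_ : v%:E = 2^-1%:E * (v%:E + v%:E))%E; last by rewrite -EFinD -EFinM; congr EFin; field.
by rewrite lee_pmul2l ?fin_numE // ?lte_fin ?invr_gt0 // leeD.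
Qed.

End Overlap.

(** * Messages *)

Section RealLemmas.
Variable R : realDomainType.

Lemma exprD_ge (n : nat) (a b : R) : (0 < n)%N -> 0 <= a -> 0 <= b ->
  a ^+ n + b ^+ n <= (a + b) ^+ n.
Proof.
case: n => // n _ a0 b0; rewrite !exprS mulrDl; apply: lerD; apply: ler_wpM2l => //;
  by rewrite lerXn2r ?nnegrE ?addr_ge0 // ?lerDl ?lerDr.
Qed.

Lemma sum_expr_le (I : Type) (r : seq I) (n : nat) (a : I -> R) : (0 < n)%N ->
  (forall i, 0 <= a i) -> \sum_(i <- r) a i ^+ n <= (\sum_(i <- r) a i) ^+ n.
Proof.
move=> n0 a0; elim: r => [|i r IH]; first by rewrite !big_nil expr0n; case: n n0.
rewrite !big_cons; apply: le_trans (exprD_ge n0 (a0 i) _); last exact: sumr_ge0.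
by rewrite lerD2l.
Qed.

Lemma prodB_le (I : eqType) (r : seq I) (a b g : I -> R) : uniq r ->
  (forall i, i \in r -> [/\ 0 <= a i <= g i & 0 <= b i <= g i]) ->
  `|\prod_(i <- r) a i - \prod_(i <- r) b i| <=
  \sum_(i <- r) `|a i - b i| * \prod_(j <- r | j != i) g j.
Proof.
elim: r => [|i r IH] /=; first by rewrite !big_nil subrr normr0.
move=> /andP[ir ur] H.
have Hr j : j \in r -> [/\ 0 <= a j <= g j & 0 <= b j <= g j].
  by move=> jr; apply: H; rewrite inE jr orbT.
have [/andP[a0 ag] /andP[b0 bg]] := H i (mem_head _ _).
rewrite !big_cons eqxx /=.
have -> : \prod_(j <- r | j != i) g j = \prod_(j <- r) g j.
  rewrite big_seq_cond [RHS]big_seq; apply: eq_bigl => j.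
  by case: (boolP (j \in r)) => //= jr; apply: contraTneq jr => ->.
have -> : \sum_(j <- r) `|a j - b j| * \prod_(k <- i :: r | k != j) g k
   = g i * \sum_(j <- r) `|a j - b j| * \prod_(k <- r | k != j) g k.
  rewrite mulr_sumr; apply: eq_big_seq => j jr; rewrite big_cons.
  have -> : i != j by apply: contraNneq ir => ->.
  by rewrite mulrCA.
have -> : a i * \prod_(j <- r) a j - b i * \prod_(j <- r) b j =
    (a i - b i) * \prod_(j <- r) a j + b i * (\prod_(j <- r) a j - \prod_(j <- r) b j) by ring.
apply: le_trans (ler_normD _ _) _; rewrite !normrM; apply: lerD.
  apply: ler_wpM2l => //; rewrite ger0_norm; last first.
    by rewrite big_seq; apply: prodr_ge0 => j /Hr[/andP[]].
  by rewrite big_seq [leRHS]big_seq; apply: ler_prod => j /Hr[].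
apply: ler_pM => //; first by rewrite ger0_norm.
exact: IH.
Qed.

(** That is, t <= min(T, sqrt T). A product of two such quantities is still at most T; the bound T ^
    2 would use the edges of T twice. *)
Definition small (t T : R) := [/\ 0 <= t, t <= T & t ^+ 2 <= T].

Lemma smallM t t' T T' : small t T -> small t' T' -> small (t * t') (T * T').
Proof.
move=> [t0 tT t2] [t'0 t'T t'2]; split; first exact: mulr_ge0.
- exact: ler_pM.
- by rewrite exprMn; apply: ler_pM => //; rewrite exprn_ge0.
Qed.

Lemma small_prod (I : eqType) (r : seq I) (t T : I -> R) :
  (forall i, i \in r -> small (t i) (T i)) -> small (\prod_(i <- r) t i) (\prod_(i <- r) T i).
Proof.
elim: r => [|i r IH] H; first by rewrite !big_nil; split; rewrite ?expr1n.
rewrite !big_cons; apply: smallM; first by apply: H; rewrite mem_head.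
by apply: IH => j jr; apply: H; rewrite inE jr orbT.
Qed.

Lemma small_le t T T' : T <= T' -> small t T -> small t T'.
Proof. by move=> TT' [t0 t1 t2]; split => //; apply: le_trans TT'. Qed.

Lemma small_cross (A : eqType) (a i j : A) (t t' : A -> R) (T : R) :
  t a = 1 -> t' a = 1 -> (forall l, l != a -> small (t l) T) ->
  (forall l, l != a -> small (t' l) T) -> i != j -> 0 <= t i * t' j <= T.
Proof.
move=> ta t'a tT t'T ij; case: (eqVneq i a) => [ia|/tT[i0 iT i2]].
  by rewrite ia ta mul1r; have [] := t'T j; rewrite -?ia 1?eq_sym // => -> ->.
case: (eqVneq j a) => [->|/t'T[j0 jT j2]]; first by rewrite t'a mulr1 i0 iT.
by rewrite mulr_ge0 //=; have := sqr_ge0 (t i - t' j); nra.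
Qed.

End RealLemmas.

Section Messages.
Variables (R : realType) (d q : nat).
Implicit Types (s : V d -> 'Z_q) (L : seq (V d)).
Variable P : 'Z_q -> 'Z_q -> R.

(* In the notation of message passing, [message L s k v i] is the ratio of the
   partition functions of the part of [L] below [v], truncated at depth k, with
   spin [i], resp. [s v], at [v], and with boundary condition [s]. *)
Fixpoint message L s (k : nat) (v : V d) (i : 'Z_q) : R :=
  let inflow j c l :=
    if c \in L then \sum_m P l m * message L s j c m else P l (s c) in
  if k is j.+1 then \prod_(c <- children v) (inflow j c i / inflow j c (s v))
  else (i == s v)%:R.

Definition inflow L s j (c : V d) l : R :=
  if c \in L then \sum_m P l m * message L s j c m else P l (s c).

Lemma messageS L s k v i : message L s k.+1 v i =
  \prod_(c <- children v) (inflow L s k c i / inflow L s k c (s v)).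
Proof. by []. Qed.

(** [ep] bounds the off-diagonal entries and [Lr] the inverses of all entries; [e1] and [L2]
    dominate the g-th roots of [ep] and of Lr ^ 2. *)
Variables (ep Lr e1 L2 : R) (g : nat).
Hypotheses (P0 : forall i j, 0 < P i j) (P1 : forall i, \sum_j P i j = 1).
Hypothesis Pdiag : forall i, 2^-1 <= P i i.
Hypothesis Pep : forall i j, i != j -> P i j <= ep.
Hypothesis PLr : forall i j, 1 <= Lr * P i j.
Hypotheses (g0 : (0 < g)%N) (ep1 : ep <= 1) (ep0 : 0 <= ep) (epe : ep <= e1 ^+ g).
Hypotheses (e10 : 0 <= e1) (L20 : 0 <= L2) (LrL2 : Lr ^+ 2 <= L2 ^+ g).

Lemma P_le1 i j : P i j <= 1.
Proof. by rewrite -(P1 i) (bigD1 j) //= lerDl sumr_ge0 // => k _; apply: ltW. Qed.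

Lemma Lr_ge1 : 1 <= Lr.
Proof.
have := PLr 0 0; have := P_le1 0 0; have := P0 0 0; set x := P 0 0 => x0 x1 h.
have L0 : 0 <= Lr by rewrite leNgt; apply/negP => L0; nra.
by nra.
Qed.

Lemma message_ge0_self L s k v : (forall i, 0 <= message L s k v i) /\ message L s k v (s v) = 1.
Proof.
elim: k v => [|k IH] v; first by split=> [i|]; rewrite /= ?eqxx ?ler0n.
have inflow_gt0 c l : 0 < inflow L s k c l.
  rewrite /inflow; case: ifP => // _; have [m0 m1] := IH c.
  rewrite (bigD1 (s c)) //= m1 mulr1 ltr_pwDl //; apply: sumr_ge0 => i _.
  by rewrite mulr_ge0 // ltW.
split=> [i|]; rewrite messageS; first by apply: prodr_ge0 => c _; rewrite divr_ge0 ?ltW.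
by rewrite big1 // => c _; rewrite divff // lt0r_neq0.
Qed.

Lemma message_ge0 L s k v i : 0 <= message L s k v i.
Proof. by have [] := message_ge0_self L s k v. Qed.

Lemma message_self L s k v : message L s k v (s v) = 1.
Proof. by have [] := message_ge0_self L s k v. Qed.

Lemma inflow_ge L s k c l : P l (s c) <= inflow L s k c l.
Proof.
rewrite /inflow; case: ifP => // _.
rewrite (bigD1 (s c)) //= message_self mulr1 lerDl sumr_ge0 // => i _.
by rewrite mulr_ge0 ?message_ge0 // ltW.
Qed.

Lemma inflow_gt0 L s k c l : 0 < inflow L s k c l.
Proof. exact: lt_le_trans (inflow_ge L s k c l). Qed.

(* The g-th power of [xpol] bounds the messages at the spins other than [s v], and
   that of [wpol k n] bounds the effect on them of changing the volume beyond n
   generations: see [message_small] and [message_cross].  The exponent g absorbs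
   the inverse temperature, see [scale_exponent]. *)
Fixpoint xpol (k : nat) (v : V d) s : R :=
  if k is j.+1 then
    \prod_(c <- children v) (L2 * broken R c s + 16 * (e1 + xpol j c s))
  else 0.

Definition gpol k (c : V d) s : R := L2 * broken R c s + 16 * (e1 + xpol k c s).

Fixpoint wpol (k n : nat) (v : V d) s : R :=
  if n is m.+1 then
    \sum_(c <- children v) (4 + L2 * broken R c s) * wpol k m c s *
      \prod_(c' <- children v | c' != c) gpol k c' s
  else xpol k v s.

Lemma xpol_ge0 k v s : 0 <= xpol k v s.
Proof.
elim: k v => //= k IH v; apply: prodr_ge0 => c _.
by rewrite addr_ge0 ?mulr_ge0 ?addr_ge0 ?broken_ge0 //; exact: ler0n.
Qed.

Lemma gpol_ge0 k v s : 0 <= gpol k v s.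
Proof. by rewrite addr_ge0 ?mulr_ge0 ?addr_ge0 ?xpol_ge0 ?ler0n. Qed.

Lemma wpol_ge0 k n v s : 0 <= wpol k n v s.
Proof.
elim: n v => [|n IH] v /=; first exact: xpol_ge0.
apply: sumr_ge0 => c _; rewrite !mulr_ge0 ?addr_ge0 ?mulr_ge0 ?ler0n //.
by apply: prodr_ge0 => c' _; exact: gpol_ge0.
Qed.

Lemma xpol_le k k' v s : (k <= k')%N -> xpol k v s <= xpol k' v s.
Proof.
elim: k k' v => [|k IH] [|k'] v //=; first by move=> _; exact: (xpol_ge0 k'.+1).
rewrite ltnS => kk'; apply: ler_prod => c _.
rewrite (gpol_ge0 k c s) /= lerD2l ler_wpM2l ?lerD2l ?IH //; exact: ler0n.
Qed.

Lemma gpol_le k k' v s : (k <= k')%N -> gpol k v s <= gpol k' v s.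
Proof. by move=> kk'; rewrite lerD2l ler_wpM2l ?ler0n // lerD2l xpol_le. Qed.

Lemma wpol_le k k' n v s : (k <= k')%N -> wpol k n v s <= wpol k' n v s.
Proof.
move=> kk'; elim: n v => [|n IH] v /=; first exact: xpol_le.
apply: ler_sum => c _; have b0 : 0 <= 4 + L2 * broken R c s by rewrite addr_ge0 ?mulr_ge0 ?ler0n.
apply: ler_pM; rewrite ?mulr_ge0 ?wpol_ge0 //.
- by apply: prodr_ge0 => c' _; exact: gpol_ge0.
- by rewrite ler_wpM2l.
- by apply: ler_prod => c' _; rewrite gpol_ge0 gpol_le.
Qed.

(** If [s] breaks the edge above [c], only the crude ratio [Lr] is available, and [L2 * broken] pays
    for it. Otherwise a spin i at [v] costs [ep] or requires a message at a spin other than [s c],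
    while the denominator is at least 1/2. *)
Lemma inflow_small L s j k v c i : c \in children v -> i != s v ->
  (forall l, l != s c -> small (message L s j c l) (xpol k c s ^+ g)) ->
  small (inflow L s j c i / inflow L s j c (s v)) (gpol k c s ^+ g).
Proof.
move=> cv iv H; have [_ pc] := childrenP _ _ cv.
have D0 := inflow_gt0 L s j c (s v); have N0 := inflow_gt0 L s j c i.
have X0 := xpol_ge0 k c s.
have r0 : 0 <= inflow L s j c i / inflow L s j c (s v) by rewrite divr_ge0 // ltW.
case: (eqVneq (s v) (s c)) => [vc|vc]; last first.
  have rL : inflow L s j c i / inflow L s j c (s v) <= Lr.
    rewrite ler_pdivrMr //.
    have PP m : P i m <= Lr * P (s v) m by apply: le_trans (P_le1 i m) (PLr _ _).
    rewrite /inflow; case: ifP => // _; rewrite mulr_sumr; apply: ler_sum => m _.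
    by rewrite mulrA ler_wpM2r ?message_ge0.
  have L1 := Lr_ge1.
  have L2g : L2 ^+ g <= gpol k c s ^+ g.
    rewrite lerXn2r ?nnegrE ?gpol_ge0 // /gpol /broken pc vc mulr1 lerDl.
    by rewrite mulr_ge0 ?addr_ge0 // ler0n.
  apply: (small_le L2g); split=> //.
    by apply: le_trans LrL2; apply: le_trans rL _; rewrite expr2 ler_peMr // (le_trans ler01).
  by apply: le_trans LrL2; rewrite lerXn2r ?nnegrE // (le_trans ler01).
(* A maximum, to be averaged with a stochastic row, instead of a sum over spins: the bound stays
   free of q. *)
have [B [B0 BX B2] HB] : exists2 B, small B (xpol k c s ^+ g)
    & forall l, l != s c -> message L s j c l <= B.
  exists (\big[Num.max/0]_(l | l != s c) message L s j c l).
    apply: (big_ind (fun B => small B (xpol k c s ^+ g))) => //.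
      by split=> //; rewrite ?expr0n exprn_ge0.
    by move=> a b sa sb; rewrite /Num.max; case: ifP.
  by move=> l lc; apply: (le_bigmax_cond _ (fun l => message L s j c l)).
have num : inflow L s j c i <= ep + B.
  rewrite /inflow; case: ifP => _; last first.
    by rewrite -vc; apply: le_trans (Pep iv) _; rewrite lerDl.
  rewrite (bigD1 (s c)) //= message_self mulr1; apply: lerD.
    by rewrite -vc; apply: Pep.
  apply: (@le_trans _ _ (\sum_(m | m != s c) P i m * B)).
    by apply: ler_sum => m mc; rewrite ler_wpM2l ?HB // ltW.
  rewrite -mulr_suml ler_piMl // -(P1 i) [leRHS](bigD1 (s c)) //= lerDr; exact/ltW.
have den : 2^-1 <= inflow L s j c (s v).
  by apply: le_trans (inflow_ge _ _ _ _ _); rewrite vc.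
have rb : inflow L s j c i / inflow L s j c (s v) <= 2 * (ep + B).
  rewrite ler_pdivrMr //; apply: le_trans num _.
  by have := addr_ge0 ep0 B0; set t := ep + B; nra.
have E : ep + xpol k c s ^+ g <= (e1 + xpol k c s) ^+ g.
  by apply: le_trans (exprD_ge g0 e10 X0); rewrite lerD2r.
(* The constant 16 covers both parts of [small]: 2 is enough for the ratio and 8 for its square. *)
have G : 16 * (e1 + xpol k c s) ^+ g <= gpol k c s ^+ g.
  apply: (@le_trans _ _ ((16 * (e1 + xpol k c s)) ^+ g)).
    rewrite exprMn ler_wpM2r ?exprn_ge0 ?addr_ge0 //.
    by rewrite -[leLHS]expr1 ler_weXn2l // ler1n.
  rewrite lerXn2r ?nnegrE ?gpol_ge0 ?mulr_ge0 ?addr_ge0 ?ler0n //.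
  by rewrite /gpol lerDr mulr_ge0 ?ler0n.
apply: (small_le G); have T0 : 0 <= (e1 + xpol k c s) ^+ g by rewrite exprn_ge0 // addr_ge0.
split=> //.
  apply: le_trans rb _; apply: (@le_trans _ _ (2 * (e1 + xpol k c s) ^+ g)); last by lra.
  by rewrite ler_wpM2l //; apply: le_trans E; rewrite lerD2l.
apply: (@le_trans _ _ ((2 * (ep + B)) ^+ 2)).
  by rewrite lerXn2r ?nnegrE // mulr_ge0 ?addr_ge0.
have ep2 : ep ^+ 2 <= ep by rewrite expr2 ler_piMl.
apply: (@le_trans _ _ (8 * (ep + xpol k c s ^+ g))); last by move: E T0; lra.
by move: ep2 B2; have := sqr_ge0 (ep - B); set T := _ ^+ g; nra.
Qed.

Lemma message_small L s j k v i : (j <= k)%N -> i != s v ->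
  small (message L s j v i) (xpol k v s ^+ g).
Proof.
elim: j k v i => [|j IH] k v i jk iv.
  by rewrite /= (negPf iv); split; rewrite ?expr0n ?exprn_ge0 ?xpol_ge0.
case: k jk => // k jk; rewrite messageS /= -prodrXl.
by apply: small_prod => c cv; apply: inflow_small => // l; apply: IH.
Qed.

(** Once the summation indices of the second product are exchanged, the difference is an average of
    cross differences of messages with weights P i m * P i' n. *)
Lemma inflow_cross L L' s j j' k c i i' (T : R) : (j <= k)%N -> (j' <= k)%N ->
  c \in L -> c \in L' ->
  (forall l l', `|message L s j c l * message L' s j' c l' -
                  message L s j c l' * message L' s j' c l| <= T) ->
  `|inflow L s j c i * inflow L' s j' c i' - inflow L s j c i' * inflow L' s j' c i| <= T.
Proof.
move=> jk jk' cL cL' H; rewrite /inflow cL cL'.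
have E (t t' : 'Z_q -> R) a b : (\sum_m P a m * t m) * (\sum_m P b m * t' m)
    = \sum_m \sum_n P a m * P b n * (t m * t' n).
  rewrite mulr_suml; apply: eq_bigr => m _; rewrite mulr_sumr; apply: eq_bigr => n _; ring.
rewrite !E [X in _ - X]exchange_big /= -sumrB.
apply: le_trans (ler_norm_sum _ _ _) _.
apply: (@le_trans _ _ (\sum_m \sum_n P i m * P i' n * T)); last first.
  under eq_bigr do rewrite -mulr_suml -mulr_sumr P1 mulr1.
  by rewrite -mulr_suml P1 mul1r.
apply: ler_sum => m _; rewrite -sumrB; apply: le_trans (ler_norm_sum _ _ _) _.
apply: ler_sum => n _; rewrite [P i' n * P i m]mulrC -mulrBr normrM.
have PP : 0 <= P i m * P i' n by rewrite mulr_ge0 // ltW.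
by rewrite (ger0_norm PP) ler_wpM2l.
Qed.

(** In cross differences the normalisation is only a common denominator, and at i' = s v they are
    plain differences. Telescoping over the children, one child carries the difference and [gpol]
    bounds the others. *)
Lemma message_cross L L' s n v j j' k i i' : (j <= k)%N -> (j' <= k)%N ->
  (n <= j)%N -> (n <= j')%N ->
  (forall w, (size (val w) <= size (val v) + n)%N -> w \in L /\ w \in L') ->
  `|message L s j v i * message L' s j' v i' - message L s j v i' * message L' s j' v i|
  <= wpol k n v s ^+ g.
Proof.
elim: n v j j' i i' => [|n IH] v j j' i i' jk jk' nj nj' LL'.
  case: (eqVneq i i') => [->|ii']; first by rewrite subrr normr0 exprn_ge0 ?wpol_ge0.
  have mm L0 j0 : (j0 <= k)%N -> forall l, l != s v -> small (message L0 s j0 v l) (xpol k v s ^+ g).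
    by move=> j0k l lv; apply: message_small.
  have /andP[a0 aT] := small_cross (message_self L s j v) (message_self L' s j' v)
    (mm L j jk) (mm L' j' jk') ii'.
  have i'i : i' != i by rewrite eq_sym.
  have /andP[b0 bT] := small_cross (message_self L s j v) (message_self L' s j' v)
    (mm L j jk) (mm L' j' jk') i'i.
  rewrite ler_norml; move: a0 aT b0 bT; set X := _ ^+ g; set a := _ * _; set b := _ * _.
  by lra.
case: j jk nj => // j jk nj; case: j' jk' nj' => // j' jk' nj'.
rewrite !messageS -!big_split /=.
case: (eqVneq i i') => [->|ii'].
  by rewrite subrr normr0 exprn_ge0 ?(wpol_ge0 k n.+1).
have ratio_self L0 j0 c : inflow L0 s j0 c (s v) / inflow L0 s j0 c (s v) = 1.
  by rewrite divff // lt0r_neq0 // inflow_gt0.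
have ratio_small L0 j0 c : (j0 < k)%N -> c \in children v -> forall l, l != s v ->
    small (inflow L0 s j0 c l / inflow L0 s j0 c (s v)) (gpol k c s ^+ g).
  move=> j0k cv l lv; apply: inflow_small => // m mc; apply: message_small => //.
  exact: ltnW.
apply: le_trans (prodB_le (g := fun c => gpol k c s ^+ g) (children_uniq v) _) _.
  move=> c cv.
  have cross l l' := @small_cross _ _ (s v) l l'
    (fun m => inflow L s j c m / inflow L s j c (s v))
    (fun m => inflow L' s j' c m / inflow L' s j' c (s v)) _
    (ratio_self L j c) (ratio_self L' j' c) (ratio_small L j c jk cv) (ratio_small L' j' c jk' cv).
  by split; apply: cross; rewrite // eq_sym.
apply: (@le_trans _ _ (\sum_(c <- children v) ((4 + L2 * broken R c s) * wpol k n c s *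
      \prod_(c' <- children v | c' != c) gpol k c' s) ^+ g)); last first.
  apply: sum_expr_le => // c; rewrite !mulr_ge0 ?addr_ge0 ?mulr_ge0 ?wpol_ge0 ?ler0n //.
  by apply: prodr_ge0 => c' _; exact: gpol_ge0.
rewrite big_seq [leRHS]big_seq; apply: ler_sum => c cv.
rewrite exprMn -prodrXl ler_wpM2r //; first by apply: prodr_ge0 => c' _; rewrite exprn_ge0 ?gpol_ge0.
have LLc : c \in L /\ c \in L'.
  by apply: LL'; rewrite (size_child cv) addnS ltnS leq_addr.
have cross : `|inflow L s j c i * inflow L' s j' c i' - inflow L s j c i' * inflow L' s j' c i|
    <= wpol k n c s ^+ g.
  apply: (inflow_cross (k := k)); rewrite ?(ltnW jk) ?(ltnW jk') //; try by case: LLc.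
  move=> l l'; apply: IH => //; try exact: ltnW.
  by move=> w; rewrite (size_child cv) addSnnS; apply: LL'.
have D0 := inflow_gt0 L s j c (s v); have D0' := inflow_gt0 L' s j' c (s v).
have -> : forall a b a' b' : R, a / inflow L s j c (s v) * (b / inflow L' s j' c (s v)) -
    a' / inflow L s j c (s v) * (b' / inflow L' s j' c (s v)) =
    (a * b - a' * b') * (inflow L s j c (s v) * inflow L' s j' c (s v))^-1.
  by move=> *; field; rewrite !lt0r_neq0.
rewrite normrM mulrC exprMn; apply: ler_pM => //.
have DD : 0 <= (inflow L s j c (s v) * inflow L' s j' c (s v))^-1.
  by rewrite invr_ge0 mulr_ge0 // ltW.
rewrite (ger0_norm DD).
have /childrenP[_ pc] := cv; have L1 := Lr_ge1.
have K0 : 0 <= 4 + L2 * broken R c s by rewrite addr_ge0 ?mulr_ge0 ?ler0n.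
(* On an unbroken edge both denominators are at least 1/2, whence the 4 in [wpol]; on a broken one
   they are at least 1/Lr, and [L2] takes over. *)
case: (eqVneq (s v) (s c)) => [vc|vc].
  apply: (@le_trans _ _ (4 ^+ g)); last first.
    by rewrite lerXn2r ?nnegrE ?ler0n // lerDl mulr_ge0 ?ler0n.
  apply: (@le_trans _ _ 4); last by rewrite -[leLHS]expr1 ler_weXn2l // ler1n.
  rewrite -[leRHS]invrK lef_pV2 ?posrE ?mulr_gt0 ?invr_gt0 //.
  rewrite (_ : 4^-1 = 2^-1 * 2^-1); last by field.
  apply: ler_pM; rewrite ?invr_ge0 //;
    by apply: le_trans (inflow_ge _ _ _ _ _); rewrite vc.
apply: (@le_trans _ _ (Lr ^+ 2)); last first.
  apply: le_trans LrL2 _; rewrite lerXn2r ?nnegrE //.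
  by rewrite /broken pc vc mulr1 lerDr.
have iP l : (Lr^-1 <= P l (s c)) by rewrite -div1r ler_pdivrMr ?(lt_le_trans _ L1) // mulrC.
rewrite -[leRHS]invrK lef_pV2 ?posrE ?mulr_gt0 ?invr_gt0 ?exprn_gt0 ?(lt_le_trans _ L1) //.
rewrite -exprVn expr2.
apply: ler_pM; rewrite ?invr_ge0 ?(le_trans _ L1) //;
  by apply: le_trans (inflow_ge _ _ _ _ _); apply: iP.
Qed.

End Messages.

(** * Mean bounds for the message polynomials *)

Section MessagePolynomials.
Variables (R : realType) (d q : nat) (p e1 L2 : R).
Hypotheses (d2 : (2 <= d)%N) (p0 : 0 <= p) (e10 : 0 <= e1) (L20 : 0 <= L2).
Hypotheses (L2p : L2 * p <= e1) (e1sq : (33 * e1) ^+ 2 <= e1) (e1le : 33 * e1 <= 1).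
Hypothesis e1d : d.+1%:R * ((4 + e1) * (33 * e1)) <= 2^-1.

Lemma dom_gpol_of k (c : V d) :
  dom p (strictly_below c) (xpol e1 L2 k c : (V d -> 'Z_q) -> R) e1 ->
  dom p (below c) (gpol e1 L2 k c : (V d -> 'Z_q) -> R) (33 * e1).
Proof.
move=> dx; rewrite (_ : 33 * e1 = e1 + 16 * (e1 + e1)); last by ring.
apply: dom_add.
  apply: (@dom_weak _ _ _ p (pred1 c) _ _ (L2 * p)) => //.
    by apply: dom_scale => //; apply: dom_broken => /=.
  by move=> w /= /eqP ->; exact: below_refl.
apply: (@dom_weak _ _ _ p (strictly_below c) _ _ (16 * (e1 + e1))) => //; last by move=> w /andP[].
by apply: dom_scale => //; apply: dom_add => //; exact: dom_const.
Qed.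

Lemma dom_children (v : V d) (r : seq (V d)) (h : V d -> (V d -> 'Z_q) -> R) (y : R) :
  uniq r -> {subset r <= children v} ->
  (forall c, c \in r -> dom p (below c) (h c) y) ->
  dom p (strictly_below v) (fun s => \prod_(c <- r) h c s) (y ^+ size r).
Proof.
move=> ur rv H; rewrite -iter_mulr_1 -[size r]count_predT -big_const_seq.
apply: (dom_prod p0 (E := fun c => below c)) => //.
- move=> c w /rv cv cw; rewrite /strictly_below (below_trans (below_child cv) cw) /=.
  by apply: contraTneq cw => ->; apply: child_notbelow.
- by move=> c c' w /rv cv /rv c'v; apply: (below_uniq cv c'v).
Qed.

(** Branching closes the recursion: two or more children give at most (33 * e1) ^ 2 <= e1. *)
Lemma dom_xpol k v : dom p (strictly_below v) (xpol e1 L2 k v : (V d -> 'Z_q) -> R) e1.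
Proof.
elim: k v => [|k IH] v /=.
  by apply: (@dom_weak _ _ _ p (strictly_below v) _ _ 0) => //; exact: dom_const.
apply: (@dom_weak _ _ _ p (strictly_below v) _ _ ((33 * e1) ^+ size (children v))) => //.
  apply: dom_children => //; first exact: children_uniq.
  by move=> c _; apply: dom_gpol_of.
apply: le_trans e1sq; rewrite ler_wiXn2l ?mulr_ge0 //.
by rewrite (leq_trans d2) // size_children_ge.
Qed.

Lemma dom_gpol k c : dom p (below c) (gpol e1 L2 k c : (V d -> 'Z_q) -> R) (33 * e1).
Proof. exact/dom_gpol_of/dom_xpol. Qed.

(** At most d + 1 children can carry the difference, and as d >= 2 each of them has a sibling
    contributing 33 * e1; [e1d] makes every generation halve the bound. *)
Lemma dom_wpol k n v :
  dom p (strictly_below v) (wpol e1 L2 k n v : (V d -> 'Z_q) -> R) (2^-1 ^+ n).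
Proof.
elim: n v => [|n IH] v /=.
  apply: (dom_weak (dom_xpol k v)) => //; rewrite expr0.
  by have := e1le; have := e10; lra.
apply: (@dom_weak _ _ _ p (strictly_below v) _ _
   (\sum_(c <- children v) (4 + e1) * 2^-1 ^+ n * (33 * e1))) => //.
  apply: dom_sum => c cv.
  apply: (@dom_mul _ _ _ p p0 (below c) (fun w => strictly_below v w && ~~ below c w)).
  - apply: (@dom_mul _ _ _ p p0 (pred1 c) (strictly_below c)) => //.
    + apply: (@dom_weak _ _ _ p (pred1 c) _ _ (4 + L2 * p)) => //; last by rewrite lerD2l.
      apply: dom_add; first exact: dom_const.
      by apply: dom_scale => //; apply: dom_broken => /=.
    + by move=> w /= /eqP ->; rewrite /strictly_below eqxx andbF.
    + by move=> w /orP[/eqP ->|/andP[]//]; exact: below_refl.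
  - under [X in dom _ _ X _]eq_fun do rewrite -big_filter.
    apply: (@dom_weak _ _ _ p (fun w => strictly_below v w && ~~ below c w) _ _
       ((33 * e1) ^+ size [seq c' <- children v | c' != c])) => //; last first.
      rewrite -[leRHS]expr1 ler_wiXn2l ?mulr_ge0 // size_filter.
      have := count_predC (pred1 c) (children v).
      rewrite count_uniq_mem ?children_uniq // cv add1n /= => h.
      have := size_children_ge v; rewrite -h; move: d2; set a := count _ _.
      by clear; lia.
    rewrite -iter_mulr_1 -[size _]count_predT -big_const_seq.
    apply: (dom_prod p0 (E := fun c => below c)).
    + by rewrite filter_uniq // children_uniq.
    + by move=> c' _; exact: dom_gpol.
    + move=> c' w; rewrite mem_filter => /andP[cc' c'v] c'w.
      rewrite /strictly_below (below_trans (below_child c'v) c'w) /=; apply/andP; split.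
        by apply: contraTneq c'w => ->; apply: child_notbelow.
      by apply: contraNN cc' => cw; rewrite (below_uniq c'v cv c'w cw).
    + by move=> a b w; rewrite !mem_filter => /andP[_ av] /andP[_ bv]; apply: (below_uniq av bv).
  - by move=> w -> /=; rewrite andbF.
  - move=> w /orP[cw|/andP[]//]; rewrite /strictly_below (below_trans (below_child cv) cw) /=.
    by apply: contraTneq cw => ->; apply: child_notbelow.
rewrite big_const_seq count_predT iter_addr_0 -[X in X <= _]mulr_natl.
apply: (@le_trans _ _ (d.+1%:R * ((4 + e1) * 2^-1 ^+ n * (33 * e1)))).
  rewrite ler_wpM2r ?ler_nat ?size_children_le //.
  by rewrite !mulr_ge0 ?addr_ge0 ?exprn_ge0 ?invr_ge0.
rewrite (_ : _ * _ = 2^-1 ^+ n * (d.+1%:R * ((4 + e1) * (33 * e1)))); last by ring.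
by rewrite exprSr ler_wpM2l // exprn_ge0 // invr_ge0.
Qed.

End MessagePolynomials.

(** * Almost sure convergence of the specification *)

Section NetFilter.
Variables (T : eqType).

(** The directed set of finite volumes as a filter, so that limits of sums, products and quotients
    apply to [net_lim]. *)
Definition finite_net : set_system (seq T) :=
  [set A | exists L0 : seq T, forall L : seq T, {subset L0 <= L} -> A L].

Global Instance finite_net_filter : ProperFilter finite_net.
Proof.
split; first by move=> [L0 /(_ L0)]; apply.
split; first by exists [::].
  move=> A B [LA HA] [LB HB]; exists (LA ++ LB) => L HL; split.
    by apply: HA => v vA; apply: HL; rewrite mem_cat vA.
  by apply: HB => v vB; apply: HL; rewrite mem_cat vB orbT.
by move=> A B AB [L0 HA]; exists L0 => L /HA /AB.
Qed.

End NetFilter.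

Arguments finite_net {T}.

Lemma net_limP (R : realType) d (f : seq (V d) -> R) (l : R) :
  net_lim f l <-> f L @[L --> finite_net] --> l.
Proof.
split.
  by move=> H; apply/cvgrPdist_lt => e /H[L0 HL0]; exists L0 => L /HL0; rewrite distrC.
by move=> /cvgrPdist_lt H e /H[L0 HL0]; exists L0 => L /HL0; rewrite distrC.
Qed.

(** * From an arbitrary finite volume to messages on a fixed ball *)

Section Peeling.
Variables (R : realType) (d q : nat).
Implicit Types (s : V d -> 'Z_q) (L : seq (V d)).
Variables (P : 'Z_q -> 'Z_q -> R) (nu : 'Z_q -> R).
Hypotheses (P0 : forall i j, 0 < P i j).
Local Notation tw := (tree_weight nu (fun=> P)).

(** The constant collects the denominators of the normalised messages. It is chosen before [F], so
    it cancels in quotients. Sites of the generation off [L] keep their value in [s], where the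
    message is 1. *)
Lemma peel_level L s l j : uniq L -> exists2 C : R, 0 < C &
  forall m F, (m <= l)%N -> local (ball d m) F ->
  sum_out [seq v <- L | v \in ball d l.+1]
    (fun s' => tw l.+1 s' * F s' * \prod_(v <- lev d l.+1) message P L s j v (s' v)) s
  = C * sum_out [seq v <- L | v \in ball d l]
    (fun s' => tw l s' * F s' * \prod_(v <- lev d l) message P L s j.+1 v (s' v)) s.
Proof.
move=> uL.
exists (\prod_(v <- lev d l) \prod_(c <- children v) inflow P L s j c (s v)).
  by apply: prodr_gt0 => v _; apply: prodr_gt0 => c _; apply: inflow_gt0.
move=> m F ml lF; set C := \prod_(v <- _) _.
have pL : perm_eq [seq v <- L | v \in ball d l.+1]
   ([seq v <- L | v \in lev d l.+1] ++ [seq v <- L | v \in ball d l]).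
  apply: uniq_perm; rewrite ?filter_uniq // ?cat_uniq ?filter_uniq //.
    rewrite andbT; apply/hasPn => v; rewrite !mem_filter => /andP[vl _].
    by rewrite (negPf (ballS_notin vl)).
  move=> v; rewrite mem_cat !mem_filter -andb_orl [v \in ball d l.+1]mem_cat.
  by rewrite orbC.
rewrite (sum_out_perm _ pL) sum_out_cat -sum_outM_cst.
apply: sum_out_ext => s' ss'.
have -> : (fun s' => tw l.+1 s' * F s' * \prod_(v <- lev d l.+1) message P L s j v (s' v))
  = (fun s' => tw l s' * F s' * \prod_(c <- lev d l.+1)
      (fun c i i' => P i i' * message P L s j c i') c (s' (parent c)) (s' c)).
  apply/funext => s1; rewrite big_split [tw l.+1 s1]/=; rewrite -/(lev d l.+1).
  by rewrite /= mulrA; congr (_ * _); rewrite mulrAC.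
rewrite (sum_out_lev (fun c i i' => P i i' * message P L s j c i')
  (F := fun s' => tw l s' * F s')); first last.
- apply: (local_indep (L := ball d l)).
    apply: localM; first exact: local_tree_weight.
    by apply: local_sub lF; apply: ball_subset.
  by move=> x xl; rewrite mem_filter negb_and (ballS_notin xl).
- by move=> v; rewrite mem_filter => /andP[].
- exact: filter_uniq.
rewrite [RHS]mulrCA; congr (_ * _).
transitivity (\prod_(c <- lev d l.+1) inflow P L s j c (s' (parent c))).
  apply: eq_big_seq => c cl; rewrite mem_filter cl /= /inflow; case: ifP => // cL.
  have -> : s' c = s c.
    by apply: ss'; rewrite mem_filter cL andbF.
  by rewrite message_self ?mulr1.
rewrite /= big_flatten big_map /C -big_split /=; apply: eq_big_seq => v vl.
rewrite -big_split /=; apply: eq_big_seq => c /childrenP[_ ->].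
by rewrite -/(inflow P L s j c _) mulrC divfK // lt0r_neq0 // inflow_gt0.
Qed.

(** Strictly beyond every generation that meets [L], so truncating messages at this depth loses
    nothing. *)
Definition depth L : nat := (\max_(v <- L) size (val v)).+1.

(** The messages of depth 0 at generation [m + depth L] equal 1, as no site of [L] is that deep;
    they are inserted, and the generations beyond [m] are peeled off. *)
Lemma sum_out_messages L s m : uniq L -> {subset ball d m <= L} ->
  exists2 C : R, 0 < C & forall F, local (ball d m) F ->
  sum_out L (fun s' => tw (m + depth L) s' * F s') s
  = C * sum_out (ball d m)
    (fun s' => tw m s' * F s' * \prod_(v <- lev d m) message P L s (depth L) v (s' v)) s.
Proof.
move=> uL mL.
have [C C0 HC] : exists2 C : R, 0 < C & forall F, local (ball d m) F ->
  sum_out [seq v <- L | v \in ball d (m + depth L)]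
    (fun s' => tw (m + depth L) s' * F s' *
       \prod_(v <- lev d (m + depth L)) message P L s 0 v (s' v)) s
  = C * sum_out [seq v <- L | v \in ball d m]
    (fun s' => tw m s' * F s' * \prod_(v <- lev d m) message P L s (depth L) v (s' v)) s.
  rewrite -[in message _ _ _ (depth L)](add0n (depth L)).
  elim: (depth L) 0%N => [|n IH] j.
    by exists 1 => // F _; rewrite !addn0 mul1r.
  have [C C0 HC] := peel_level s (m + n) j uL.
  have [C' C'0 HC'] := IH j.+1.
  exists (C * C') => [|F lF]; first exact: mulr_gt0.
  by rewrite addnS (HC m) ?leq_addr // HC' // mulrA addSnnS.
exists C => // F lF.
have LK v : v \in L -> (size (val v) < depth L)%N.
  move=> vL; rewrite ltnS.
  exact: (leq_bigmax_seq (F := fun v : V d => size (val v)) _ vL isT).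
have -> : sum_out (ball d m) (fun s' => tw m s' * F s' *
       \prod_(v <- lev d m) message P L s (depth L) v (s' v)) s =
    sum_out [seq v <- L | v \in ball d m] (fun s' => tw m s' * F s' *
       \prod_(v <- lev d m) message P L s (depth L) v (s' v)) s.
  congr (_ s); apply: sum_out_perm; apply: uniq_perm; rewrite ?filter_uniq ?ball_uniq // => v.
  by rewrite mem_filter; case: (boolP (v \in ball d m)) => //= /mL.
rewrite -HC // (_ : [seq v <- L | _] = L); last first.
  apply/all_filterP/allP => v /LK h; rewrite mem_ball (leq_trans (ltnW h)) // leq_addl //.
apply: sum_out_ext => s' ss'; rewrite [X in _ = _ * X]big_seq big1 ?mulr1 // => v.
rewrite mem_lev => /eqP vl; rewrite /= ss' ?eqxx //.
by apply/negP => /LK; rewrite vl ltnNge leq_addl.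
Qed.

End Peeling.

Section Convergence.
Variables (R : realType) (d q : nat).
Implicit Types (s : V d -> 'Z_q) (L : seq (V d)).
Variables (W P : 'Z_q -> 'Z_q -> R) (x nu : 'Z_q -> R) (c Z : R).
Hypotheses (x0 : forall i, 0 < x i) (c0 : 0 < c) (Z0 : 0 < Z).
Hypothesis P0 : forall i j, 0 < P i j.
Hypothesis nuE : forall i, nu i = x i ^+ d.+1 / Z.
Hypothesis WE : forall i j, W i j = c * x i / x j ^+ d * P i j.
Local Notation tw := (tree_weight nu (fun=> P)).

Lemma cond_exp_undup L K F s : cond_exp P nu L K F s = cond_exp P nu (undup L) K F s.
Proof.
rewrite /cond_exp (sum_out_undup L) (sum_out_undup L (tw K)) -mulf_div divff ?mul1r //.
by rewrite expf_neq0 // pnatr_eq0 card_ord.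
Qed.

Definition outer_messages m L s s' : R :=
  \prod_(v <- lev d m) message P (undup L) s (depth (undup L)) v (s' v).

Lemma cond_exp_messages L s m F : {subset ball d m <= L} -> local (ball d m) F ->
  cond_exp P nu L (m + depth (undup L)) F s =
  sum_out (ball d m) (fun s' => tw m s' * F s' * outer_messages m L s s') s /
  sum_out (ball d m) (fun s' => tw m s' * outer_messages m L s s') s.
Proof.
move=> mL lF; rewrite cond_exp_undup.
have mL' : {subset ball d m <= undup L} by move=> v /mL; rewrite mem_undup.
have [C C0 HC] := sum_out_messages nu P0 s (undup_uniq L) mL'.
rewrite /cond_exp HC // (_ : tw (m + _) = (fun s' => tw (m + depth (undup L)) s' * 1)); last first.
  by apply/funext => s'; rewrite mulr1.
rewrite (HC (fun=> 1)) // -mulf_div divff ?mul1r ?lt0r_neq0 //.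
by congr (_ / sum_out _ _ _); apply/funext => s'; rewrite mulr1.
Qed.

Variables (ep Lr e1 L2 : R) (g : nat).
Hypotheses (P1 : forall i, \sum_j P i j = 1).
Hypothesis Pdiag : forall i, 2^-1 <= P i i.
Hypothesis Pep : forall i j, i != j -> P i j <= ep.
Hypothesis PLr : forall i j, 1 <= Lr * P i j.
Hypotheses (g0 : (0 < g)%N) (ep1 : ep <= 1) (ep0 : 0 <= ep) (epe : ep <= e1 ^+ g).
Hypotheses (e10 : 0 <= e1) (L20 : 0 <= L2) (LrL2 : Lr ^+ 2 <= L2 ^+ g).

(** Uniform in the truncation [k], because volumes of every depth are compared. *)
Definition contracting s := forall v (e : R), 0 < e -> exists n, forall k,
  wpol e1 L2 k n v s <= e.

Hypothesis d2 : (2 <= d)%N.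

Lemma lev_nonempty k : exists v, v \in lev d k.
Proof.
elim: k => [|k [v vk]]; first by exists (Defs.root d); rewrite mem_head.
have : (0 < size (children v))%N by rewrite (leq_trans _ (size_children_ge v)) // ltnW.
case E: (children v) => [//|w r] _; exists w; apply/flatten_mapP; exists v => //.
by rewrite E mem_head.
Qed.

Lemma depth_ball L n : {subset ball d n <= L} -> (n <= depth (undup L))%N.
Proof.
move=> nL; have [v vn] := lev_nonempty n.
have vL : v \in undup L by rewrite mem_undup; apply/nL/lev_ball.
move: vn; rewrite mem_lev => /eqP <-; rewrite leqW //.
exact: (leq_bigmax_seq (F := fun v : V d => size (val v)) _ vL isT).
Qed.

Definition net_message s v i L : R := message P (undup L) s (depth (undup L)) v i.

Lemma message_cvg s v i : contracting s -> cvg (net_message s v i L @[L --> finite_net]).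
Proof.
move=> cs; apply: cauchy_cvg; apply: cauchy_exP => e e0.
(* At most 1, so that e' ^ g <= e'. *)
pose e' := Num.min e 1 / 2.
have e'0 : 0 < e' by rewrite divr_gt0 // lt_min e0 ltr01.
have e'e : e' < e.
  rewrite /e'; apply: (@le_lt_trans _ _ (e / 2)); last by lra.
  by rewrite ler_pM2r // ge_min lexx.
have e'1 : e' <= 1.
  rewrite /e'; apply: (@le_trans _ _ (1 / 2)); last by lra.
  by rewrite ler_pM2r // ge_min lexx orbT.
have [n Hn] := cs v _ e'0.
exists (net_message s v i (ball d (size (val v) + n))).
exists (ball d (size (val v) + n)) => L HL; rewrite /ball_ /=.
(* The second spin is the reference [s v], where both messages are 1. *)
have := @message_cross _ _ _ P ep Lr e1 L2 g P0 P1 Pdiag Pep PLr g0 ep1 ep0 epe e10 L20 LrL2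
  (undup (ball d (size (val v) + n))) (undup L) s n v
  (depth (undup (ball d (size (val v) + n)))) (depth (undup L))
  (maxn (depth (undup (ball d (size (val v) + n)))) (depth (undup L))) i (s v).
rewrite leq_maxl leq_maxr => /(_ isT isT).
have dL L' : {subset ball d (size (val v) + n) <= L'} -> (n <= depth (undup L'))%N.
  by move=> /depth_ball; apply: leq_trans; rewrite leq_addl.
rewrite dL // dL // => /(_ isT isT).
rewrite !message_self // mulr1 mul1r => H; apply: le_lt_trans e'e; apply: le_trans (H _) _.
  by move=> w wn; rewrite !mem_undup; split; [|apply: HL]; rewrite mem_ball.
apply: (@le_trans _ _ (e' ^+ g)).
  by rewrite lerXn2r ?nnegrE ?wpol_ge0 // ltW.
by rewrite -[leRHS]expr1 ler_wiXn2l // ltW.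
Qed.

Lemma sum_out_cvg m s F : contracting s ->
  cvg (sum_out (ball d m) (fun s' => F s' * outer_messages m L s s') s @[L --> finite_net]).
Proof.
move=> cs.
have -> : (fun L => sum_out (ball d m) (fun s' => F s' * outer_messages m L s s') s) =
  (fun L => \sum_(eta : (size (ball d m)).-tuple 'Z_q)
     F (Defs.patch eta s) * outer_messages m L s (Defs.patch eta s)).
  by apply/funext => L; rewrite -(sum_patch (ball d m) (fun s' => F s' * outer_messages m L s s') s).
apply/cvg_ex; exists (\sum_(eta : (size (ball d m)).-tuple 'Z_q)
     F (Defs.patch eta s) * \prod_(v <- lev d m) lim (net_message s v (Defs.patch eta s v) L @[L --> finite_net])).
apply: cvg_big => [|eta _]; first exact: add_continuous.
apply: cvgM; first exact: cvg_cst.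
apply: cvg_big => [|v _]; first exact: mul_continuous.
exact: message_cvg.
Qed.

(** On volumes containing [ball d m], [gamma] is a quotient of fixed polynomials in finitely many
    convergent messages; the term of [s] itself keeps the denominator away from 0. *)
Lemma gamma_cvg s Delta xi : contracting s ->
  exists l, net_lim (fun L => gamma W L Delta xi s) l.
Proof.
move=> cs; pose m := \max_(v <- Delta) size (val v).
pose F s' : R := (cylb Delta xi s')%:R.
have lF : local (ball d m) F.
  move=> s1 s2 s12; rewrite /F; congr (nat_of_bool _)%:R; apply: eq_in_all => v vD.
  rewrite s12 // mem_ball.
  exact: (leq_bigmax_seq (F := fun v : V d => size (val v)) _ vD isT).
pose N L := sum_out (ball d m) (fun s' => tw m s' * F s' * outer_messages m L s s') s.
pose D L := sum_out (ball d m) (fun s' => tw m s' * outer_messages m L s s') s.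
have cN : cvg (N L @[L --> finite_net]) by exact: (@sum_out_cvg m s (fun s' => tw m s' * F s') cs).
have cD : cvg (D L @[L --> finite_net]) by exact: (@sum_out_cvg m s (tw m) cs).
have D0 L : tw m s <= D L.
  have t0 s' := tree_weight_gt0 x0 Z0 P0 nuE m s'.
  apply: le_trans (sum_out_ge _ _ _); last first.
    move=> s'; apply: mulr_ge0; first exact/ltW/t0.
    by apply: prodr_ge0 => v _; exact: message_ge0.
  by rewrite /outer_messages big1 ?mulr1 // => v _; apply: message_self.
have limD0 : lim (D L @[L --> finite_net]) != 0.
  rewrite lt0r_neq0 //; apply: lt_le_trans (tree_weight_gt0 x0 Z0 P0 nuE m s) _.
  by apply: limr_ge => //; exists [::] => L _; apply: D0.
exists (lim (N L @[L --> finite_net]) / lim (D L @[L --> finite_net])).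
apply/net_limP.
have : N L / D L @[L --> finite_net] --> lim (N L @[L --> finite_net]) / lim (D L @[L --> finite_net]).
  by apply: cvgM => //; apply: cvgV.
apply: cvg_trans; apply: near_eq_cvg; exists (ball d m) => L HL.
have dd : exists k, (m + depth (undup L) = k.+1)%N.
  by exists (m + \max_(v <- undup L) size (val v))%N; rewrite addnS.
have [k Ek] := dd.
rewrite (gammaE (k := k) x0 c0 Z0 P0 nuE WE) -?Ek ?cond_exp_messages //.
move=> v vL; rewrite mem_ball -ltnS -Ek.
have vL' : v \in undup L by rewrite mem_undup.
rewrite (@leq_trans (depth (undup L))) ?leq_addl // ltnS.
exact: (leq_bigmax_seq (F := fun v : V d => size (val v)) _ vL' isT).
Qed.

End Convergence.

(** * Contraction for almost every boundary condition *)

Section AlmostSureContraction.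
Variables (R : realType) (d q : nat) (p e1 L2 : R).
Hypotheses (d2 : (2 <= d)%N) (e10 : 0 <= e1) (L20 : 0 <= L2).
Hypotheses (L2p : L2 * p <= e1) (e1sq : (33 * e1) ^+ 2 <= e1) (e1le : 33 * e1 <= 1).
Hypothesis e1d : d.+1%:R * ((4 + e1) * (33 * e1)) <= 2^-1.
Variables (nu : 'Z_q -> R) (P : 'Z_q -> 'Z_q -> R) (mu : probability (Omega d q) R).
Hypothesis mc : tree_markov_chain mu nu P.
Hypothesis nu0 : forall i, 0 <= nu i.
Hypothesis nu1 : \sum_i nu i = 1.
Hypothesis P0 : forall i j, 0 <= P i j.
Hypothesis P1 : forall i, \sum_j P i j = 1.
Hypothesis Pp : forall i, \sum_(j | j != i) P i j <= p.

Lemma markov_le (h : Omega d q -> R) (y e : R) : measurable_fun setT h ->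
  (forall s, 0 <= h s) -> 0 < e -> (\int[mu]_s (h s)%:E <= y%:E)%E ->
  (mu [set s | e < h s]%R <= (y / e)%:E)%E.
Proof.
move=> mh h0 e0 ih.
have mA : measurable [set s | e < h s]%R.
  rewrite (_ : [set s | _] = setT `&` h @^-1` `]e, +oo[%classic); last first.
    by apply/seteqP; split => s /=; rewrite in_itv /= andbT // => -[].
  exact: mh.
have H : (e%:E * mu [set s | e < h s]%R <= y%:E)%E.
  rewrite -integral_cst //; apply: le_trans ih.
  apply: (@le_trans _ _ (\int[mu]_(s in [set s | e < h s]%R) (h s)%:E)%E).
    apply: ge0_le_integral => //.
    - by move=> s _; rewrite lee_fin ltW.
    - exact/measurable_EFinP/measurable_funTS.
    - by move=> s /= es; rewrite lee_fin ltW.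
  apply: ge0_subset_integral => //; first exact/measurable_EFinP.
  by move=> s _; rewrite lee_fin.
have fA : mu [set s | e < h s]%R \is a fin_num by exact: fin_num_measure.
move: H; rewrite -(fineK fA) -EFinM !lee_fin => H.
by rewrite ler_pdivlMr // mulrC.
Qed.

(** As [wpol] increases with [k], the union over [k] of the bad events costs no more than the
    uniform bound 2 ^ -n / e. A bad configuration lies in these unions for every n. *)
Lemma ae_contracting : {ae mu, forall s : Omega d q, contracting e1 L2 s}.
Proof.
have p0 : 0 <= p by apply: le_trans (Pp 0); apply: sumr_ge0.
have key (v : V d) (e : R) : 0 < e ->
    {ae mu, forall s : Omega d q, exists n, forall k, wpol e1 L2 k n v s <= e}.
  move=> e0; pose A k n := [set s : Omega d q | e < wpol e1 L2 k n v s].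
  have dw k n := dom_wpol q d2 p0 e10 L20 L2p e1sq e1le e1d k n v.
  have mw k n : measurable_fun setT (wpol e1 L2 k n v : Omega d q -> R).
    exact: dom_measurable (dw k n).
  have mA k n : measurable (A k n).
    rewrite (_ : A k n = setT `&` (wpol e1 L2 k n v : Omega d q -> R) @^-1` `]e, +oo[%classic); last first.
      by apply/seteqP; split => s /=; rewrite in_itv /= andbT // => -[].
    exact: mw.
  have muA k n : (mu (A k n) <= (2^-1 ^+ n / e)%:E)%E.
    apply: markov_le => //.
    - by move=> s; apply: wpol_ge0.
    - exact: (dom_integral mc nu0 nu1 P0 P1 Pp (dw k n)).
  pose U n := \bigcup_k A k n.
  have mU n : measurable (U n) by apply: bigcup_measurable => k _.
  have muU n : (mu (U n) <= (2^-1 ^+ n / e)%:E)%E.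
    have cU : (mu \o (A ^~ n)) k @[k --> \oo] --> mu (U n).
      apply: nondecreasing_cvg_mu => [k||k k' kk']; [exact: mA|exact: mU|].
      apply/subsetPset => s /= es.
      by apply: lt_le_trans es _; apply: wpol_le.
    rewrite -(cvg_lim _ cU) //; apply: lime_le; first by apply/cvg_ex; exists (mu (U n)).
    by near=> k; apply: muA.
  exists (\bigcap_n U n); split.
  - by apply: bigcap_measurable => // n _.
  - have mI : measurable (\bigcap_n U n) by apply: bigcap_measurable.
    have fI : mu (\bigcap_n U n) \is a fin_num by exact: fin_num_measure.
    have bnd n : fine (mu (\bigcap_n U n)) <= 2^-1 ^+ n / e.
      rewrite -lee_fin fineK //; apply: le_trans (muU n); apply: le_measure; rewrite ?inE //.
      exact: bigcap_inf.
    rewrite -(fineK fI); congr EFin; apply/eqP; rewrite eq_le fine_ge0 // andbT leNgt.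
    apply/negP => I0; set r := fine _ in I0 bnd *.
    have [n Hn] : exists n : nat, (r * e)^-1 < n%:R.
      exists (Num.bound (r * e)^-1); apply: archi_boundP.
      by rewrite invr_ge0 mulr_ge0 // ltW.
    have re0 : 0 < r * e by rewrite mulr_gt0.
    have := bnd n; rewrite ler_pdivlMr // exprVn; apply/negP; rewrite -ltNge.
    rewrite -[ltRHS]invrK ltf_pV2 ?posrE ?invr_gt0 ?exprn_gt0 //.
    apply: lt_trans Hn _; rewrite -natrX ltr_nat; exact: ltn_expl.
  - move=> s /= /forallNP ns n _; have /existsNP[k /negP] := ns n.
    by rewrite -ltNge => es; exists k.
(* Reduction to countably many conditions: vertices are enumerated by [pickle], and e runs through 1
   / (j + 1). *)
have : {ae mu, forall s : Omega d q, forall i : nat, forall j : nat,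
    if unpickle i is Some v then exists n, forall k, wpol e1 L2 k n v s <= j.+1%:R^-1 else True}.
  apply: ae_foralln => i; apply: ae_foralln => j.
  case: (unpickle i) => [v|]; last by apply: aeW.
  by apply: key; rewrite invr_gt0.
apply: filterS => s Hs v e e0.
have [n Hn] : exists n : nat, e^-1 < n%:R.
  exists (Num.bound e^-1); apply: archi_boundP.
  by rewrite invr_ge0 ltW.
have := Hs (pickle v) n; rewrite pickleK => -[m Hm]; exists m => k; apply: le_trans (Hm k) _.
rewrite -[leRHS]invrK lef_pV2 ?posrE ?invr_gt0 // ltW //; apply: lt_trans Hn _.
by rewrite ltr_nat.
Unshelve. all: by end_near. Qed.

Variables (W : 'Z_q -> 'Z_q -> R) (x : 'Z_q -> R) (c Z ep Lr : R) (g : nat).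
Hypotheses (x0 : forall i, 0 < x i) (c0 : 0 < c) (Z0 : 0 < Z).
Hypothesis P_gt0 : forall i j, 0 < P i j.
Hypothesis nuE : forall i, nu i = x i ^+ d.+1 / Z.
Hypothesis WE : forall i j, W i j = c * x i / x j ^+ d * P i j.
Hypothesis Pdiag : forall i, 2^-1 <= P i i.
Hypothesis Pep : forall i j, i != j -> P i j <= ep.
Hypothesis PLr : forall i j, 1 <= Lr * P i j.
Hypotheses (g0 : (0 < g)%N) (ep1 : ep <= 1) (ep0 : 0 <= ep) (epe : ep <= e1 ^+ g).
Hypothesis LrL2 : Lr ^+ 2 <= L2 ^+ g.

Lemma ae_gamma_cvg : {ae mu, forall s : Omega d q, forall Delta xi,
  exists l, net_lim (fun L => gamma W L Delta xi s) l}.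
Proof.
have F := ae_filter_ringOfSetsType mu.
apply: (@filterS _ _ F _ _ _ ae_contracting) => s cs Delta xi.
exact: (gamma_cvg x0 c0 Z0 P_gt0 nuE WE P1 Pdiag Pep PLr g0 ep1 ep0 epe e10 L20 LrL2 d2 Delta xi cs).
Qed.

End AlmostSureContraction.

(** * Density of mismatches *)

Section Series.
Variable R : realType.

Lemma nneseries_le (a : nat -> \bar R) (C : \bar R) : (forall n, 0 <= a n)%E ->
  (forall n, \sum_(0 <= k < n) a k <= C)%E -> (\sum_(0 <= k <oo) a k <= C)%E.
Proof.
move=> a0 H; apply: lime_le; first by apply: is_cvg_nneseries.
by near=> n; apply: H.
Unshelve. all: by end_near. Qed.

Lemma nneseries_geometric_lt (t : R) : 0 < t -> t < 1 ->
  (\sum_(0 <= k <oo) (t ^+ k)%:E < +oo)%E.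
Proof.
move=> t0 t1; apply: (@le_lt_trans _ _ (1 / (1 - t))%:E); last exact: ltry.
apply: nneseries_le => n; first by rewrite lee_fin exprn_ge0 // ltW.
rewrite sumEFin lee_fin; have := @geometric_le_lim R n 1 t ler01 t0.
rewrite ger0_norm ?(ltW t0) // => /(_ t1); apply: le_trans.
by rewrite /series /geometric /=; apply: ler_sum => k _; rewrite mul1r.
Qed.

Lemma nneseries_eventually_le1 (a : nat -> R) : (forall n, 0 <= a n) ->
  (\sum_(0 <= k <oo) (a k)%:E < +oo)%E -> exists N, forall n, (N <= n)%N -> a n <= 1.
Proof.
move=> a0 fin.
have a0' n : true -> (0 <= (a n)%:E)%E by rewrite lee_fin.
have /fine_cvgP[[N1 _ fin1] /cvgrPdist_lt/(_ 1 ltr01)[N2 _ lt1]] := nneseries_tail_cvg fin a0'.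
exists (maxn N1 N2) => n; rewrite geq_max => /andP[n1 n2].
have := lt1 _ n2; rewrite sub0r normrN /= => h.
rewrite -lee_fin; apply: (@le_trans _ _ (\sum_(n <= k <oo) (a k)%:E)%E).
  have := @nneseries_lim_ge R (fun k => (a k)%:E) xpredT n n.+1 (fun k _ => a0' k).
  by rewrite big_nat1.
rewrite -(fineK (fin1 _ n1)) lee_fin; apply: le_trans (ltW h); exact: ler_norm.
Qed.

Lemma limn_einf_ge0 (u : nat -> \bar R) : (forall n, 0 <= u n)%E -> (0 <= limn_einf u)%E.
Proof.
move=> u0; rewrite limn_einf_lim; apply: lime_ge; first exact: is_cvg_einfs.
by near=> n; apply: le_ereal_inf_tmp => _ [k _ <-].
Unshelve. all: by end_near. Qed.

Lemma limn_einf_le (u : nat -> \bar R) C : (forall n, u n <= C)%E -> (limn_einf u <= C)%E.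
Proof.
move=> uC; rewrite limn_einf_lim; apply: lime_le; first exact: is_cvg_einfs.
near=> n; apply: le_trans (uC n); apply: ereal_inf_lbound; exists n => //=.
Unshelve. all: by end_near. Qed.

Lemma measurable_limn_einf d (T : measurableType d) (f : nat -> T -> \bar R) :
  (forall n, measurable_fun setT (f n)) ->
  measurable_fun setT (fun x => limn_einf (f ^~ x)).
Proof.
move=> mf.
rewrite (_ : (fun x => _) = (fun x => - limn_esup (fun n => - f n x))%E); last first.
  by apply/funext => x; rewrite -[LHS]oppeK -limn_esupN.
apply: measurableT_comp => //; apply: measurable_fun_limn_esup => n.
exact: measurableT_comp.
Qed.

Lemma expR_half_le2 : expR (2^-1 : R) <= 2.
Proof.
have := expR_ge1Dx (- 2^-1 : R); rewrite expRN => h.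
have e0 := expR_gt0 (2^-1 : R).
rewrite -[leLHS]invrK -[leRHS]invrK lef_pV2 ?posrE ?invr_gt0 //.
by apply: le_trans h; lra.
Qed.

Lemma le_limn_inf_near (u : nat -> R) (c : R) : (forall n, 0 <= u n <= 1) ->
  (\forall n \near \oo, c <= u n) -> c <= limn_inf u.
Proof.
move=> u01 [N _ HN].
have bu : bounded_fun u.
  exists 1; split => // x x1 n _ /=; have /andP[u0 u1] := u01 n.
  by rewrite ger0_norm // (le_trans u1) // ltW.
rewrite limn_infE //; apply: (@le_trans _ _ (infs u N)).
  apply: lb_le_inf; first by exists (u N), N => /=.
  by move=> _ [n /= Nn <-]; apply: HN.
apply: ub_le_sup; first exact: bounded_fun_has_ubound_infs.
by exists N.
Qed.

Lemma ae_nneseries_fin d (T : measurableType d) (mu : probability T R)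
    (f : nat -> T -> \bar R) :
  (forall n, measurable_fun setT (f n)) -> (forall n x, 0 <= f n x)%E ->
  (\sum_(0 <= n <oo) \int[mu]_x f n x < +oo)%E ->
  {ae mu, forall x, (\sum_(0 <= n <oo) f n x < +oo)%E}.
Proof.
move=> mf f0 fin.
have g0 x : (0 <= \sum_(0 <= n <oo) f n x)%E by apply: nneseries_ge0.
have : mu.-integrable setT (fun x => \sum_(0 <= n <oo) f n x)%E.
  apply/integrableP; split.
    by apply: ge0_emeasurable_sum.
  under eq_integral do rewrite gee0_abs //.
  by rewrite integral_nneseries.
move=> /(integrable_ae measurableT); apply: filterS => x /(_ I) fx.
by rewrite ltey_eq fx.
Qed.

End Series.

Section Matches.
Variables (R : realType) (d q : nat) (v : nat -> V d) (s s' : V d -> 'Z_q).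

Lemma match_fraction_bounds N :
  0 <= (N%:R : R)^-1 * \sum_(i < N) (s' (v i) == s (v i))%:R <= 1.
Proof.
rewrite mulr_ge0 ?invr_ge0 //=; last by apply: sumr_ge0.
case: N => [|N]; first by rewrite big_ord0 mulr0.
rewrite mulrC ler_pdivrMr // mul1r.
apply: (@le_trans _ _ (\sum_(i < N.+1) 1)); last by rewrite sumr_const card_ord.
by apply: ler_sum => i _; case: (_ == _).
Qed.

(** The first [n0] sites, where the branch may still climb, are written off as mismatches. *)
Lemma matches_ge n0 N :
  N%:R - n0%:R - (mismatches (fun j => v (n0 + j)%N) (iota 0 N) s s')%:R
  <= \sum_(i < N) (s' (v i) == s (v i))%:R :> R.
Proof.
pose b i : nat := s (v i) != s' (v i).
have cE : mismatches (fun j => v (n0 + j)%N) (iota 0 N) s s' = (\sum_(0 <= j < N) b (n0 + j))%N.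
  rewrite /mismatches -sum1_count big_mkcond /= /index_iota subn0.
  by apply: eq_bigr => j _; rewrite /b; case: (_ == _).
have H : (\sum_(0 <= i < N) b i <= n0 + \sum_(0 <= j < N) b (n0 + j))%N.
  apply: (@leq_trans (\sum_(0 <= i < n0 + N) b i)%N).
    by rewrite [leqRHS](@big_cat_nat _ _ _ N) //= ?leq_addr // leq_addl.
  rewrite (@big_cat_nat _ _ _ n0) //= ?leq_addr //; apply: leq_add.
    apply: (@leq_trans (\sum_(0 <= i < n0) 1)%N); last by rewrite sum_nat_const_nat subn0 muln1.
    by apply: leq_sum => i _; rewrite /b; case: (_ == _).
  by rewrite -{1}[n0]add0n big_addn addKn; apply: leq_sum => j _; rewrite addnC.
have E : \sum_(i < N) (s' (v i) == s (v i))%:R = N%:R - (\sum_(0 <= i < N) b i)%:R :> R.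
  rewrite natr_sum big_mkord -[N in N%:R]card_ord -sumr_const -sumrB; apply: eq_bigr => i _.
  by rewrite /b eq_sym; case: (_ == _); rewrite ?subr0 ?subrr.
rewrite E cE -addrA lerD2l -opprD lerN2 -natrD ler_nat //.
Qed.

End Matches.

Lemma below_path d (x : nat -> V d) n0 a b :
  (forall n, (n0 <= n)%N -> x n.+1 \in children (x n)) -> (n0 <= a)%N -> (a <= b)%N ->
  below (x a) (x b).
Proof.
move=> H n0a /subnK <-; elim: (b - a)%N => [|n IH]; first exact: below_refl.
rewrite addSn; apply: below_trans IH _; apply/below_child/H.
by rewrite (leq_trans n0a) // leq_addl.
Qed.

(** * From exponential moments to densities along a branch *)

Section Branch.
Variables (R : realType) (d q : nat) (p al : R).
Hypotheses (d2 : (2 <= d)%N) (p0 : 0 <= p) (al1 : 1 <= al) (alp : al ^+ 2 * p <= 1).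
Local Notation cb := (cluster_bound d al).
Hypothesis cb1 : cb <= 1.
Variables (W P : 'Z_q -> 'Z_q -> R) (x nu : 'Z_q -> R) (c Z : R).
Hypotheses (x0 : forall i, 0 < x i) (c0 : 0 < c) (Z0 : 0 < Z).
Hypothesis P0 : forall i j, 0 < P i j.
Hypothesis nuE : forall i, nu i = x i ^+ d.+1 / Z.
Hypothesis WE : forall i j, W i j = c * x i / x j ^+ d * P i j.
Hypothesis nu1 : \sum_i nu i = 1.
Hypothesis P1 : forall i, \sum_j P i j = 1.
Hypothesis Pp : forall i, \sum_(j | j != i) P i j <= p.
Variable mu : probability (Omega d q) R.
Hypothesis mc : tree_markov_chain mu nu P.
Variables (y nxt : nat -> V d).
Hypothesis nxt_child : forall i, nxt i \in children (y i).
Hypothesis nxt_below : forall i j, (i < j)%N -> below (nxt i) (y j).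
Variables (pi : Omega d q -> probability (Omega d q) R) (pi0 : probability (Omega d q) R).
Hypothesis pi_lim : is_limit_kernel W pi pi0.
Hypothesis ae_lim : {ae mu, forall s : Omega d q, forall Delta xi,
  exists l, net_lim (fun L => gamma W L Delta xi s) l}.

Lemma cluster_bound_gt0 : 0 < cb.
Proof. by rewrite divr_gt0 // exprn_gt0 // (lt_le_trans ltr01). Qed.

(** Finitely many cylinders occur, and the balls are cofinal in the net of volumes. *)
Lemma mismatch_moment_cvg (s : Omega d q) r : uniq r ->
  (forall Delta xi, exists l, net_lim (fun L => gamma W L Delta xi s) l) ->
  ((mismatch_moment W y r n s)%:E @[n --> \oo] -->
    \int[pi s]_s' (2 ^+ mismatches y r s s')%:E)%E.
Proof.
move=> ur Hs; have [piE _] := pi_lim s.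
have uD : uniq (map y r) by rewrite map_inj_uniq //; apply: (branch_inj nxt_child nxt_below).
rewrite (integral_local (pi s) (fun=> 0) uD (@local_mismatches R d q y r s)); last first.
  by move=> s'; rewrite exprn_ge0.
apply: cvg_EFin; first by near=> n.
rewrite -(sum_patch (map y r) (fun s' => 2 ^+ mismatches y r s s' * fine (pi s (cyl (map y r) s')))).
rewrite /mismatch_moment; apply: cvg_big => [|eta _]; first exact: add_continuous.
apply: cvgM; first exact: cvg_cst.
have [l Hl] := Hs (map y r) (Defs.patch eta (fun=> 0)).
rewrite (piE Hs _ _ _ Hl) /=; apply/cvgrPdist_lt => e /Hl[L0 HL0].
exists (\max_(v <- L0) size (val v)) => // n /= nL; rewrite distrC; apply: HL0 => v vL.
rewrite mem_ball (leq_trans _ nL) //.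
exact: (leq_bigmax_seq (F := fun v : V d => size (val v)) _ vL isT).
Unshelve. all: by end_near. Qed.

(** The weights rho ^ N beat the growth (1 + cb) ^ N <= exp(cb N), so the weighted moments are
    summable, almost surely under [mu] and then under [pi s]; the terms are eventually at most 1. *)
Lemma mismatches_eventually : {ae mu, forall s : Omega d q, {ae pi s, forall s' : Omega d q,
  exists N0, forall N, (N0 <= N)%N -> (mismatches y (iota 0 N) s s')%:R <= 4 * cb * N%:R}}.
Proof.
have cb0 := cluster_bound_gt0; set rho := expR (- (2 * cb)).
have rho0 : 0 < rho by apply: expR_gt0.
have mmom N n : measurable_fun setT (mismatch_moment W y (iota 0 N) n : Omega d q -> R).
  have [K lK] := local_mismatch_moment x0 c0 Z0 P0 nuE WE nxt_child nxt_below n (iota_uniq 0 N).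
  by apply: measurable_local lK; exact: ball_uniq.
have mom0 N n s : 0 <= mismatch_moment W y (iota 0 N) n s.
  exact: (mismatch_moment_ge0 x0 c0 Z0 P0 nuE WE nxt_child nxt_below n s (iota_uniq 0 N)).
(* A liminf is measurable in [s], which is not assumed of [pi]. Fatou's lemma bounds its mean, and
   almost surely it equals the moment under [pi s]. *)
pose f N (s : Omega d q) : \bar R :=
  limn_einf (fun n => (rho ^+ N * mismatch_moment W y (iota 0 N) n s)%:E).
have mg N n : measurable_fun setT
    (fun s : Omega d q => (rho ^+ N * mismatch_moment W y (iota 0 N) n s)%:E).
  by apply/measurable_EFinP; apply: measurable_funM.
have mf N : measurable_fun setT (f N) by apply: measurable_limn_einf.
have f0 N s : (0 <= f N s)%E.
  by apply: limn_einf_ge0 => n; rewrite lee_fin mulr_ge0 // exprn_ge0 // ltW.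
have intf N : (\int[mu]_s f N s <= (expR (- cb) ^+ N)%:E)%E.
  have le1 n : (\int[mu]_s (rho ^+ N * mismatch_moment W y (iota 0 N) n s)%:E
      <= (expR (- cb) ^+ N)%:E)%E.
    under eq_integral do rewrite EFinM.
    rewrite ge0_integralZl ?lee_fin ?exprn_ge0 ?(ltW rho0) //; last 2 first.
    - by apply/measurable_EFinP.
    - by move=> s _; rewrite lee_fin.
    apply: (@le_trans _ _ ((rho ^+ N)%:E * ((1 + cb) ^+ N)%:E)%E).
      rewrite lee_wpmul2l ?lee_fin ?exprn_ge0 ?(ltW rho0) //.
      have := integral_mismatch_moment d2 p0 al1 alp cb1 x0 c0 Z0 P0 nuE WE nu1 P1 Pp mc
        nxt_child nxt_below n (iota_uniq 0 N).
      by rewrite size_iota.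
    rewrite -EFinM lee_fin -exprMn lerXn2r ?nnegrE ?mulr_ge0 ?addr_ge0 ?expR_ge0 ?(ltW cb0) //.
    apply: (@le_trans _ _ (rho * expR cb)); first by rewrite ler_wpM2l ?(ltW rho0) // expR_ge1Dx.
    by rewrite -expRD ler_expR; lra.
  apply: le_trans (fatou mu measurableT (mg N) _) _.
    by move=> n s _; rewrite lee_fin mulr_ge0 // exprn_ge0 // ltW.
  exact: limn_einf_le.
have sumf : (\sum_(0 <= N <oo) \int[mu]_s f N s < +oo)%E.
  apply: le_lt_trans (nneseries_geometric_lt (t := expR (- cb)) _ _).
  - by apply: lee_nneseries => [N _ _|N _]; [apply: integral_ge0|exact: intf].
  - exact: expR_gt0.
  - by rewrite expR_lt1 oppr_lt0.
have := ae_nneseries_fin mf f0 sumf; have := ae_lim.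
apply: filterS2 => s Hs fin.
have fE N : f N s = (\int[pi s]_s' (rho ^+ N * 2 ^+ mismatches y (iota 0 N) s s')%:E)%E.
  have ms : measurable_fun setT (fun s' : Omega d q => 2 ^+ mismatches y (iota 0 N) s s' : R).
    apply: (measurable_local (L := map y (iota 0 N))); last exact: local_mismatches.
    by rewrite map_inj_uniq ?iota_uniq //; apply: (branch_inj nxt_child nxt_below).
  under [RHS]eq_integral do rewrite EFinM.
  rewrite ge0_integralZl ?lee_fin ?exprn_ge0 ?(ltW rho0) //; last exact/measurable_EFinP.
  apply: (cvg_limn_einf_sup _).1; under eq_fun do rewrite EFinM.
  by apply: cvgeZl => //; apply: mismatch_moment_cvg => //; exact: iota_uniq.
have : (\sum_(0 <= N <oo) \int[pi s]_s' (rho ^+ N * 2 ^+ mismatches y (iota 0 N) s s')%:E < +oo)%E.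
  by under eq_eseriesr do rewrite -fE.
move=> /ae_nneseries_fin H.
have {H} : {ae pi s, forall s' : Omega d q,
    (\sum_(0 <= N <oo) (rho ^+ N * 2 ^+ mismatches y (iota 0 N) s s')%:E < +oo)%E}.
  apply: H => [N|N s']; last by rewrite lee_fin mulr_ge0 ?exprn_ge0 // ltW.
  apply/measurable_EFinP; apply: measurable_funM => //.
  apply: (measurable_local (L := map y (iota 0 N))); last exact: local_mismatches.
  by rewrite map_inj_uniq ?iota_uniq //; apply: (branch_inj nxt_child nxt_below).
apply: filterS => s' /nneseries_eventually_le1 [|N0 HN0].
  by move=> N; rewrite mulr_ge0 ?exprn_ge0 // ltW.
exists N0 => N /HN0; set m := mismatches _ _ _ _ => H.
(* With exp(1/2) <= 2 in place of 2, the exponents compare directly: m / 2 <= 2 cb N. *)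
have : expR (m%:R * 2^-1 - N%:R * (2 * cb)) <= 1.
  apply: le_trans H; rewrite expRD -mulrN expRM_natl expRM_natl mulrC.
  by rewrite ler_wpM2l ?exprn_ge0 ?(ltW rho0) // lerXn2r ?nnegrE ?expR_ge0 // expR_half_le2.
by rewrite -[leRHS]expR0 ler_expR; lra.
Qed.

Lemma liminf_match_fraction (w : nat -> V d) n0 (e : R) :
  (forall i, y i = w (n0 + i)%N) -> 5 * cb <= e ->
  {ae mu, forall s : Omega d q, {ae pi s, forall s' : Omega d q,
    1 - e <= limn_inf (fun n : nat =>
      (n ^ 2)%:R^-1 * \sum_(i < n ^ 2) (s' (w i) == s (w i))%:R)}}.
Proof.
move=> yE cbe; have cb0 := cluster_bound_gt0.
have := mismatches_eventually; apply: filterS => s; apply: filterS => s' [N0 HN0].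
apply: le_limn_inf_near; first by move=> n; exact: (match_fraction_bounds R w s s' (n ^ 2)).
(* From this size on the [n0] discarded sites are at most a fraction cb of the window, which raises
   4 cb to 5 cb. *)
pose M := maxn N0 (Num.bound (n0%:R / cb)).+1.
exists M => // n /= Mn.
have : (M <= n ^ 2)%N.
  by apply: leq_trans Mn _; case: n => // n; rewrite -mulnn leq_pmulr.
rewrite geq_max => /andP[/HN0 mis bnd].
have N2 : 0 < (n ^ 2)%:R :> R by rewrite ltr0n (leq_trans _ bnd).
have n0b : n0%:R <= cb * (n ^ 2)%:R.
  rewrite mulrC -ler_pdivrMr //; apply: le_trans (ltW (archi_boundP _)) _.
    by rewrite divr_ge0 // ltW.
  by rewrite ler_nat ltnW.
rewrite mulrC ler_pdivlMr //; apply: le_trans (matches_ge R w s s' n0 (n ^ 2)).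
have ee : 5 * cb * (n ^ 2)%:R <= e * (n ^ 2)%:R by rewrite ler_pM2r.
have -> : mismatches (fun j => w (n0 + j)%N) (iota 0 (n ^ 2)) s s'
    = mismatches y (iota 0 (n ^ 2)) s s'.
  by apply: eq_count => i; rewrite yE.
move: mis n0b ee; set mm := (mismatches _ _ _ _)%:R; set N' := (n ^ 2)%:R; set b := cb.
by lra.
Qed.

End Branch.

(** * The transition matrix at low temperature *)

Section Model.
Variables (R : realType) (m q : nat) (u0 U0 be c : R).
Local Notation d := m.+1.
Variables (u : 'Z_q -> 'Z_q -> R) (Psi x : 'Z_q -> R) (Q P : 'Z_q -> 'Z_q -> R).
Hypotheses (m0 : (0 < m)%N) (u00 : 0 < u0) (uU : u0 <= U0) (be0 : 0 < be) (c0 : 0 < c).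
Hypothesis uii : forall i, u i i = 0.
Hypothesis u_ge : forall i j, i != j -> u0 <= u i j.
Hypothesis u_le : forall i j, u i j <= U0.
Hypothesis Psi_le : forall i, `|Psi i| <= u0 * m%:R / 8.
Hypothesis x0 : forall i, 0 < x i.
Hypothesis WE : forall i j, transfer d u Psi be i j = c * Q i j.
Hypothesis PE : forall i j, P i j = Q i j * x j ^+ d / x i.
Hypothesis P0 : forall i j, 0 < P i j.
Hypothesis P_le1 : forall i j, P i j <= 1.
Hypothesis Pdiag : forall i, 2^-1 <= P i i.
Local Notation W := (transfer d u Psi be).

(* The diagonal equations determine [x i ^+ m] up to a factor in [1/2, 1], and
   eliminating x leaves only the energies. *)
Lemma transition_pow i a : P i a ^+ m =
  W i a ^+ m * W i i / W a a ^+ d * (P a a ^+ d / P i i).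
Proof.
have W0 k l : 0 < W k l by apply: expR_gt0.
have Q0 k l : 0 < Q k l by have := W0 k l; rewrite WE pmulr_rgt0.
have diag k : P k k = Q k k * x k ^+ m.
  by rewrite PE exprS; field; rewrite lt0r_neq0.
rewrite !diag !WE PE !exprMn !exprVn -!exprM mulnC exprM.
have x0' k : x k ^+ m != 0 by rewrite expf_neq0 // lt0r_neq0.
move: (x0' i) (x0' a); set X := x i ^+ m; set Y := x a ^+ m => X0 Y0.
have cm0 : c ^+ m != 0 by rewrite expf_neq0 // lt0r_neq0.
have qm0 : Q a a ^+ m != 0 by rewrite expf_neq0 // lt0r_neq0.
rewrite !(exprS c) !(exprS (Q a a)); move: cm0 qm0; set cm := c ^+ m; set qm := Q a a ^+ m => cm0 qm0.
by field; rewrite X0 cm0 qm0 !lt0r_neq0.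
Qed.

Lemma transfer_pow i a : W i a ^+ m * W i i / W a a ^+ d =
  expR (- (be * (m%:R * u i a + Psi i - Psi a))).
Proof.
rewrite /transfer -!expRM_natl -expRN -!expRD; congr expR; rewrite !uii.
have -> : d.+1%:R = m%:R + 2 :> R by rewrite -addn2 natrD.
have -> : d%:R = m%:R + 1 :> R by rewrite -addn1 natrD.
have m2 : m%:R + 2 != 0 :> R by rewrite lt0r_neq0 // addr_ge0_gt0.
by field.
Qed.

Lemma Psi_diff i a : `|Psi i - Psi a| <= m%:R * (u0 / 4).
Proof.
apply: le_trans (ler_normB _ _) _; apply: le_trans (lerD (Psi_le i) (Psi_le a)) _.
by rewrite le_eqVlt; apply/orP; left; apply/eqP; field.
Qed.

(** On taking m-th roots in [transition_pow], the field undoes at most a quarter of [u0], and the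
    diagonal entries cost at most a factor 2. *)
Lemma transition_upper i a : i != a -> P i a <= 2 * expR (- (3 / 4 * be * u0)).
Proof.
move=> ia; rewrite -(ler_pXn2r m0) ?nnegrE ?mulr_ge0 ?expR_ge0 ?(ltW (P0 i a)) //.
rewrite transition_pow transfer_pow exprMn -expRM_natl mulrC; apply: ler_pM.
- by rewrite divr_ge0 ?exprn_ge0 // ltW.
- exact: expR_ge0.
- rewrite ler_pdivrMr //; apply: (@le_trans _ _ 1); first by rewrite exprn_ile1 // ltW.
  have h : 2 * 2^-1 <= 2 ^+ m * P i i.
    apply: ler_pM; rewrite ?invr_ge0 //.
    by rewrite -[leLHS]expr1 ler_weXn2l // ler1n.
  by apply: le_trans h; rewrite divff.
- rewrite ler_expR mulrN lerN2.
  rewrite (_ : m%:R * (3 / 4 * be * u0) = be * (m%:R * (3 / 4 * u0))); last by ring.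
  rewrite ler_pM2l //; have := Psi_diff i a; rewrite ler_norml => /andP[h _].
  have : m%:R * u0 <= m%:R * u i a by rewrite ler_wpM2l // u_ge.
  by lra.
Qed.

(** The diagonal entries cost at most 2 ^ d <= 4 ^ m, as d = m + 1 <= 2 m. Since p dominates the
    off-diagonal entries, a small p forces a large inverse temperature. *)
Lemma transition_lower i a : 4^-1 * expR (- (be * (U0 + u0 / 4))) <= P i a.
Proof.
rewrite -(ler_pXn2r m0) ?nnegrE ?mulr_ge0 ?invr_ge0 ?expR_ge0 ?(ltW (P0 i a)) //.
rewrite transition_pow transfer_pow exprMn -expRM_natl [leRHS]mulrC; apply: ler_pM.
- by rewrite exprn_ge0 // invr_ge0.
- exact: expR_ge0.
- rewrite ler_pdivlMr //; apply: (@le_trans _ _ (4^-1 ^+ m)).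
    by rewrite ler_piMr // exprn_ge0 // invr_ge0.
  apply: (@le_trans _ _ (2^-1 ^+ d)); last first.
    by rewrite lerXn2r ?nnegrE ?invr_ge0 // ltW.
  have -> : 4^-1 = 2^-1 ^+ 2 :> R by field.
  by rewrite -exprM ler_wiXn2l ?invr_ge0 ?invf_le1 //; first lra; move: m0; clear; lia.
- rewrite ler_expR mulrN lerN2 mulrCA ler_pM2l //.
  have := Psi_diff i a; rewrite ler_norml => /andP[_ h].
  have : m%:R * u i a <= m%:R * U0 by rewrite ler_wpM2l.
  by lra.
Qed.

End Model.

(** * Constants that do not depend on the inverse temperature *)

Section Scales.
Variables (R : realType) (u0 U0 e1 : R).
Hypotheses (u00 : 0 < u0) (uU : u0 <= U0) (e10 : 0 < e1) (e11 : e1 < 1).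

(** Chosen so that e1 = exp(- theta u0 / 2), with [g] the integer part of be / theta. In [beta0],
    theta makes g >= 1 and 8 / u0 lets exponentials absorb the prefactors 2 and 4. The 4 in
    [boltzmann_scale] is 2 from the square times 2 from be <= 2 g theta. *)
Definition theta : R := 2 * ln e1^-1 / u0.
Definition beta0 : R := Num.max theta (8 / u0).
Definition boltzmann_scale : R := expR (4 * theta * (U0 + u0)).

Lemma theta_gt0 : 0 < theta.
Proof. by rewrite divr_gt0 // mulr_gt0 // ln_gt0 // invf_gt1. Qed.

(* With [g] of order [be], the Boltzmann factors at inverse temperature [be]
   become g-th powers of quantities which do not depend on [be]. *)
Lemma scale_exponent be : beta0 <= be -> exists g : nat,
  [/\ (0 < g)%N, 2 * expR (- (3 / 4 * be * u0)) <= e1 ^+ g &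
      (4 * expR (be * (U0 + u0 / 4))) ^+ 2 <= boltzmann_scale ^+ g].
Proof.
have th0 := theta_gt0.
rewrite /beta0 ge_max => /andP[thb ub].
have b0 : 0 < be by apply: lt_le_trans thb.
have ub8 : 8 <= be * u0 by rewrite -ler_pdivrMr.
have r1 : 1 <= be / theta by rewrite ler_pdivlMr // mul1r.
have /andP[gl gu] := truncn_itv (le_trans ler01 r1).
set g := Num.truncn _ in gl gu.
have g0 : (0 < g)%N.
  by have := le_lt_trans r1 gu; rewrite ltr1n ltnS.
exists g; split => //.
  have e1E : e1 = expR (- (theta * u0 / 2)).
    rewrite /theta (_ : 2 * ln e1^-1 / u0 * u0 / 2 = ln e1^-1); last by field; rewrite lt0r_neq0.
    by rewrite lnV ?posrE // opprK lnK ?posrE.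
  rewrite [in leRHS]e1E -expRM_natl.
  have gth : g%:R * theta <= be by rewrite -ler_pdivlMr.
  apply: (@le_trans _ _ (expR (be * u0 / 4) * expR (- (3 / 4 * be * u0)))).
    rewrite ler_wpM2r ?expR_ge0 //; apply: le_trans (expR_ge1Dx _); lra.
  rewrite -expRD ler_expR.
  have : g%:R * theta * u0 <= be * u0 by rewrite ler_pM2r.
  by lra.
rewrite /boltzmann_scale -expRM_natl.
have gth : be <= 2 * g%:R * theta.
  rewrite -ler_pdivrMr //; apply: le_trans (ltW gu) _.
  by rewrite -addn1 natrD mulr_natl mulr2n lerD2l ler1n.
have UU : 0 < U0 + u0 by rewrite addr_gt0 // (lt_le_trans u00).
apply: (@le_trans _ _ (expR (be * (U0 + u0)) ^+ 2)).
  rewrite lerXn2r ?nnegrE ?mulr_ge0 ?expR_ge0 //.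
  rewrite (_ : be * (U0 + u0) = 3 / 4 * (be * u0) + be * (U0 + u0 / 4)); last by field.
  rewrite expRD ler_wpM2r ?expR_ge0 //; apply: le_trans (expR_ge1Dx _); lra.
rewrite -expRM_natl ler_expR.
have : be * (U0 + u0) <= 2 * g%:R * theta * (U0 + u0) by rewrite ler_pM2r.
by lra.
Qed.

End Scales.

(** * Choice of the thresholds and assembly of the estimates *)

Unset Implicit Arguments.

Theorem theorem3p7 (R : realType) (d : nat) (u0 U0 : R) :
  (2 <= d)%N -> 0 < u0 -> u0 <= U0 ->
  exists eps1 eps2 : R -> R,
    (* eps1(beta) = eps1(beta,u,U,d) decreases to 0 as beta increases to oo *)
    (forall b b' : R, 0 < b -> b <= b' -> eps1 b' <= eps1 b) /\
    (eps1 b @[b --> +oo] --> 0) /\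
    (* eps2(p) = eps2(p,u,U,d) decreases to 0 as p decreases to 0 *)
    (forall p p' : R, 0 <= p -> p <= p' -> eps2 p <= eps2 p') /\
    (eps2 p @[p --> 0^'+] --> 0) /\
  forall (q : nat) (u : 'Z_q -> 'Z_q -> R) (Psi : 'Z_q -> R) (beta : R),
    (1 < q)%N ->
    (* the interaction matrix: symmetric, zero diagonal, u = min, U = max *)
    (forall i j, u i j = u j i) ->
    (forall i, u i i = 0) ->
    (forall i j, i != j -> u0 <= u i j) ->
    (exists i j, i != j /\ u i j = u0) ->
    (forall i j, u i j <= U0) ->
    (exists i j, u i j = U0) ->
    (forall i, `|Psi i| <= u0 * (d%:R - 1) / 8) ->
    0 < beta ->
    (* the reference matrix Q0(i,j) = g(i-j) *)
    forall g : 'Z_q -> R,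
    (forall i, g (- i) = g i) ->
    (forall i, 0 < g i) ->
    \sum_(i : 'Z_q) g i = 1 ->
    ~~ eigenvalue (\matrix_(i, j) g (i - j) : 'M[R]_((Zp_trunc q).+2)) (d%:R)^-1 ->
    (* the C^1 branch xbar of positive solutions of x = Q x^d, xbar(Q0) = 1 *)
    forall (N : set 'M[R]_((Zp_trunc q).+2))
           (xb : 'M[R]_((Zp_trunc q).+2) -> 'rV[R]_((Zp_trunc q).+2)),
    open N -> connected N ->
    N (\matrix_(i, j) g (i - j)) ->
    C1_on N xb ->
    xb (\matrix_(i, j) g (i - j)) = const_mx 1 ->
    (forall Q, N Q ->
       (forall i, 0 < xb Q ord0 i) /\
       (forall i, xb Q ord0 i = \sum_(j : 'Z_q) Q i j * xb Q ord0 j ^+ d)) ->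
    (* the model's transfer matrix is a positive multiple of Q, Q near Q0 *)
    forall (Q : 'M[R]_((Zp_trunc q).+2)) (c : R),
    N Q -> 0 < c ->
    (forall i j, transfer d u Psi beta i j = c * Q i j) ->
    (* mu is the central state *)
    forall mu : probability (Omega d q) R,
    tree_markov_chain mu (marg d (xb Q)) (transP d (xb Q) Q) ->
    (* pi( . | omega) *)
    forall (pi : Omega d q -> probability (Omega d q) R)
           (pi0 : probability (Omega d q) R),
    is_limit_kernel (transfer d u Psi beta) pi pi0 ->
    exists r : nat -> nat,
      (forall i, 0 < r i)%N /\ (forall i, r i < r i.+1)%N /\
      forall (x : nat -> V d) (k : nat -> nat),
        (* x is a branch: a self-avoiding infinite path *)
        (forall n, adj (x n) (x n.+1)) -> injective x ->
        (* v_i = x (k i) chosen along it with |v_{i+1} - v_i| = r_i *)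
        (forall i, k i < k i.+1)%N ->
        (forall i, dist (x (k i)) (x (k i.+1)) = r i) ->
        {ae mu, forall omega : Omega d q,
          {ae pi omega, forall sigma : Omega d q,
            1 - eps1 beta - eps2 (p1 (transP d (xb Q) Q)) <=
            limn_inf (fun n : nat =>
              (n ^ 2)%:R^-1 *
              \sum_(i < n ^ 2) (sigma (x (k i)) == omega (x (k i)))%:R)}}.
Proof.
case: d => [//|m] d2 u00 uU.
(* With D = d + 1, this value gives both contraction conditions, (33 * e1) ^ 2 <= e1 and D * (4 +
   e1) * 33 * e1 <= 1/2. *)
pose D : R := m.+1.+1%:R; pose e1 : R := (33 * 33 * D)^-1.
have D2 : 2 <= D by rewrite ler_nat.
have D0 : 0 < D by rewrite ltr0n.
have e10 : 0 < e1 by rewrite invr_gt0 !mulr_gt0.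
have e1D : 33 * (33 * e1) * D = 1.
  by rewrite /e1; field; rewrite lt0r_neq0.
have e1s : 33 * (33 * e1) * 2 <= 1 by rewrite -[leRHS]e1D ler_pM2l // !mulr_gt0.
have e11 : e1 < 1 by move: e1s e10; clear; lra.
pose L2 := boltzmann_scale u0 U0 e1.
have L20 : 0 < L2 by apply: expR_gt0.
(* Below these four thresholds, in order: L2 * p <= e1; diagonal entries are at least 1/2; sqrt p <=
   4 ^ -(d + 1), hence [cluster_bound] <= 1; the inverse temperature is at least [beta0]. *)
pose p0 : R := Num.min (Num.min (e1 / L2) 2^-1)
  (Num.min (4^-1 ^+ (2 * m.+1.+1)) (4^-1 * expR (- (beta0 u0 e1 * (U0 + u0))))).
have p00 : 0 < p0.
  have h4 : 0 < 4^-1 :> R by rewrite invr_gt0.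
  rewrite /p0 !lt_min divr_gt0 // invr_gt0 exprn_gt0 //= mulr_gt0 ?expR_gt0 //.
  by rewrite ltr0n.
(* The first term turns 5 * [cluster_bound] into K * sqrt p; the second makes the claim trivial for
   p >= p0. *)
pose K : R := Num.max (5 * 4 ^+ m.+1.+1) (Num.sqrt p0)^-1.
have K0 : 0 <= K by rewrite /K le_max mulr_ge0.
exists (fun=> 0), (fun p => K * Num.sqrt p).
split; first by [].
split; first exact: cvg_cst.
split; first by move=> p p' p_ge0 pp'; rewrite ler_wpM2l // ler_wsqrtr.
split.
  rewrite -[X in _ --> X](mulr0 K) -[X in K * X]sqrtr0.
  apply: cvgM; first exact: cvg_cst.
  by apply: cvg_at_right_filter; apply: sqrt_continuous.
move=> q u Psi be _ _ uii u_ge _ u_le _ Psi_le be0 g _ _ _ _ N xb _ _ _ _ _ xbE Q c NQ c0 WQ mu mc pi pi0 pi_lim.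
have [x0 xE] := xbE Q NQ; set P := transP m.+1 (xb Q) Q in mc *; set nu := marg m.+1 (xb Q) in mc.
pose x i := xb Q ord0 i.
pose Z : R := \sum_(k : 'Z_q) x k ^+ m.+1.+1.
have Q0 i j : 0 < Q i j.
  by rewrite -(pmulr_rgt0 _ c0) -WQ; apply: expR_gt0.
have PE i j : P i j = Q i j * x j ^+ m.+1 / x i.
  by rewrite /P /transP -xE.
have P0 i j : 0 < P i j by rewrite PE divr_gt0 ?mulr_gt0 ?exprn_gt0 // x0.
have P1 i : \sum_j P i j = 1.
  under eq_bigr do rewrite PE.
  by rewrite -mulr_suml -[X in X / _]xE divff // lt0r_neq0 // x0.
have Z0 : 0 < Z.
  by rewrite /Z (bigD1 0) //= ltr_pwDl ?exprn_gt0 ?x0 // sumr_ge0 // => i _; rewrite exprn_ge0 // ltW // x0.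
have nuE i : nu i = x i ^+ m.+1.+1 / Z by [].
have nu1 : \sum_i nu i = 1.
  by under eq_bigr do rewrite nuE; rewrite -mulr_suml divff // lt0r_neq0.
have WE i j : transfer m.+1 u Psi be i j = c * x i / x j ^+ m.+1 * P i j.
  by rewrite WQ PE; field; rewrite expf_neq0 /= lt0r_neq0 // x0.
set p := p1 P.
have Pp i : \sum_(j | j != i) P i j <= p.
  exact: (le_bigmax _ (fun i => \sum_(j | j != i) P i j)).
have p_gt0 : 0 < p.
  apply: lt_le_trans (Pp 0); rewrite (bigD1 1) //= ltr_pwDl // sumr_ge0 // => j _; exact/ltW.
exists succn; split=> //; split=> // v k adjv injv kinc _.
pose fr (s s' : Omega m.+1 q) n : R :=
  (n ^ 2)%:R^-1 * \sum_(i < n ^ 2) (s' (v (k i)) == s (v (k i)))%:R.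
have fr01 s s' n : 0 <= fr s s' n <= 1.
  exact: (match_fraction_bounds R (fun i => v (k i)) s s' (n ^ 2)).
case: (leP p0 p) => [p0p|pp0].
  have triv : 1 - 0 - K * Num.sqrt p <= 0.
    have sp0 : 0 < Num.sqrt p0 by rewrite sqrtr_gt0.
    have : 1 <= K * Num.sqrt p.
      rewrite -(mulVf (lt0r_neq0 sp0)); apply: ler_pM; rewrite ?invr_ge0 ?sqrtr_ge0 //.
        by rewrite /K le_max lexx orbT.
      by rewrite ler_wsqrtr.
    by lra.
  apply: aeW => s; apply: aeW => s'; apply: (le_limn_inf_near (fr01 s s')).
  by exists 0%N => // n _ /=; apply: le_trans triv _; have /andP[] := fr01 s s' n.
move: (pp0); rewrite /p0 !lt_min => /andP[/andP[pL p2] /andP[p4 pb]].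
have Pdiag i : 2^-1 <= P i i.
  by have := P1 i; rewrite (bigD1 i) //=; have := Pp i; move: p2; lra.
have P_le1' := P_le1 P0 P1.
have Psi_le' i : `|Psi i| <= u0 * m%:R / 8.
  by have := Psi_le i; rewrite -addn1 natrD addrK.
have upper := transition_upper d2 be0 c0 uii u_ge Psi_le' x0 WQ PE P0 P_le1' Pdiag.
have lower := transition_lower d2 be0 c0 uii u_le Psi_le' x0 WQ PE P0 P_le1' Pdiag.
(* Otherwise [lower] would push the entry P 0 1 above p, although it is one of the off-diagonal
   entries of a row. *)
have beb : beta0 u0 e1 <= be.
  rewrite leNgt; apply/negP => bb; have : P 0 1 <= p.
    apply: le_trans (Pp 0); rewrite [leRHS](bigD1 1) //= lerDl sumr_ge0 // => j _; exact/ltW.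
  apply/negP; rewrite -ltNge; apply: lt_le_trans (lower 0 1); apply: lt_le_trans pb _.
  rewrite ler_wpM2l ?invr_ge0 // ler_expR lerN2; apply: ler_pM; rewrite ?(ltW be0) ?(ltW bb) //; lra.
have [gg [gg0 epg Lrg]] := scale_exponent u00 uU e10 e11 beb.
set ep := 2 * _ in epg; set Lr := 4 * _ in Lrg.
have PLr i j : 1 <= Lr * P i j.
  rewrite -ler_pdivrMl ?mulr_gt0 ?expR_gt0 // mulr1 invfM -expRN; exact: lower.
have ep0 : 0 <= ep by rewrite mulr_ge0 // expR_ge0.
have ep1 : ep <= 1 by apply: le_trans epg _; rewrite exprn_ile1 // ltW.
have ae_lim : {ae mu, forall s : Omega m.+1 q, forall Delta xi,
    exists l, net_lim (fun L => gamma (transfer m.+1 u Psi be) L Delta xi s) l}.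
  apply: (ae_gamma_cvg (p := p) (e1 := e1) (L2 := L2) d2 (ltW e10) (ltW L20) _ _ _ _ mc _ nu1 _ P1 Pp
    x0 c0 Z0 P0 nuE WE Pdiag upper PLr gg0 ep1 ep0 epg Lrg).
  - by rewrite mulrC -ler_pdivlMr // ltW.
  - by nra.
  - by lra.
  - by nra.
  - by move=> i; rewrite ltW // (nu_gt0 x0 Z0 nuE).
  - by move=> i j; rewrite ltW.
(* The largest weight with al ^ 2 * p <= 1; since d - 1 >= 1, [cluster_bound] becomes of order sqrt
   p. *)
pose al := (Num.sqrt p)^-1.
have sp0 : 0 < Num.sqrt p by rewrite sqrtr_gt0.
have sp4 : Num.sqrt p <= 4^-1 ^+ m.+1.+1.
  rewrite -(ler_pXn2r (_ : 0 < 2)%N) ?nnegrE ?exprn_ge0 ?invr_ge0 ?sqrtr_ge0 //.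
  by rewrite (sqr_sqrtr (ltW p_gt0)) -exprM mulnC ltW.
have sp1 : Num.sqrt p <= 1.
  by apply: le_trans sp4 _; rewrite exprn_ile1 ?invr_ge0 // invf_le1 //; lra.
have al1 : 1 <= al by rewrite invf_ge1.
have alp : al ^+ 2 * p <= 1.
  by rewrite exprVn (sqr_sqrtr (ltW p_gt0)) mulVf // lt0r_neq0.
have cbs : cluster_bound m.+1 al <= 4 ^+ m.+1.+1 * Num.sqrt p.
  rewrite /cluster_bound ler_wpM2l ?exprn_ge0 // -[leRHS]invrK lef_pV2 ?posrE ?invr_gt0 ?exprn_gt0 //.
    by rewrite -/al -[leLHS]expr1 ler_weXn2l.
  by rewrite invr_gt0.
have cb1 : cluster_bound m.+1 al <= 1.
  apply: le_trans cbs _; apply: le_trans (ler_wpM2l _ sp4) _; first exact: exprn_ge0.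
  by rewrite -exprMn divff // expr1n.
have cb0 : 0 < cluster_bound m.+1 al by apply: cluster_bound_gt0.
have [n0 Hn0] := path_eventually_down adjv injv.
have kge i : (i <= k i)%N by elim: i => // i IH; apply: leq_ltn_trans IH (kinc i).
have kmono i j : (i < j)%N -> (k i < k j)%N.
  by move=> /subnK <-; elim: (j - i.+1)%N => [|n IH]; [exact: kinc|apply: ltn_trans IH (kinc _)].
(* As i <= k i, the samples from index [n0] on lie in the descending part of the path. *)
pose y j := v (k (n0 + j)%N); pose nxt j := v (k (n0 + j)%N).+1.
have kn0 j : (n0 <= k (n0 + j))%N by rewrite (leq_trans _ (kge _)) // leq_addr.
have nxt_child j : nxt j \in children (y j) by apply: Hn0.
have nxt_below i j : (i < j)%N -> below (nxt i) (y j).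
  by move=> ij; apply: below_path Hn0 _ _; rewrite ?leqW // kmono // ltn_add2l.
have KK : 5 * cluster_bound m.+1 al <= K * Num.sqrt p.
  apply: (@le_trans _ _ (5 * 4 ^+ m.+2 * Num.sqrt p)); first by rewrite -mulrA ler_wpM2l.
  by rewrite ler_wpM2r ?sqrtr_ge0 // /K le_max lexx.
rewrite subr0.
exact: (liminf_match_fraction d2 (ltW p_gt0) al1 alp cb1 x0 c0 Z0 P0 nuE WE nu1 P1 Pp mc
  nxt_child nxt_below pi_lim ae_lim (w := fun i => v (k i)) (fun i => erefl) KK).
Qed.
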